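(* The group $\mathrm{Homeo}(M,\xi)$ of contact homeomorphisms with the contact topology is path-connected and locally path-connected. Any two contact homeomorphisms can be connected inside $\mathrm{Homeo}(M,\xi)$ by a topological contact isotopy.
   Context: Setting. $M$ is a closed (compact, without boundary), connected smooth manifold of dimension $2n+1$ with a cooriented contact structure $\xi=\ker\alpha$, where $\alpha$ is a fixed contact form, and $\nu_\alpha=\alpha\wedge(d\alpha)^n$. $\mathrm{Diff}(M,\xi)$ is the group of diffeomorphisms $\phi$ with $\phi^*\alpha=e^{g}\alpha$ for a smooth function $g$ on $M$ (its conformal factor). A smooth contact isotopy is a smooth isotopy $\Phi=\{\phi_t\}_{0\le t\le1}$ in $\mathrm{Diff}(M,\xi)$ with $\phi_0=\mathrm{id}$; if $\frac{d}{dt}\phi_t=X_t\circ\phi_t$, its Hamiltonian is $H_t=\alpha(X_t)$; this is a bijection onto smooth functions $H\colon[0,1]\times M\to\mathbb R$, and one writes $\Phi=\Phi_H=\{\phi_H^t\}$. Its conformal factor $h$ is defined by $(\phi_H^t)^*\alpha=e^{h_t}\alpha$, and $(\Phi_H,H,h)$ is a smooth contact dynamical system. Norms and metrics. For a function $H$ on $M$, $\|H\|=\max_M H-\min_M H+\left|\frac{1}{\int_M\nu_\alpha}\int_M H\,\nu_\alpha\right|$; for $H\colon[0,1]\times M\to\mathbb R$, $\|H\|_{(1,\infty)}=\int_0^1\|H_t\|\,dt$; $|h|=\max_{t,x}|h(t,x)|$. Fix a Riemannian distance $d$ on $M$; $\overline d(\phi,\psi)=\max_x d(\phi(x),\psi(x))+\max_x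 d(\phi^{-1}(x),\psi^{-1}(x))$ for homeomorphisms and $\overline d(\Phi,\Psi)=\max_t\overline d(\phi_t,\psi_t)$ for isotopies. A triple $(\Phi,H,h)$ of a continuous isotopy of homeomorphisms and functions $H,h\colon[0,1]\times M\to\mathbb R$ is a topological contact dynamical system if there are smooth contact dynamical systems $(\Phi_{H_i},H_i,h_i)$ with $\Phi_{H_i}\to\Phi$ uniformly, $h_i\to h$ uniformly, and $\|H-H_i\|_{(1,\infty)}\to0$ ($H\in L^1([0,1],C^0(M))$); then $\Phi=\Phi_H$ is called a topological contact isotopy (based at the identity). The set of these triples is $\mathcal{TCDS}(M,\alpha)$, with metric $d_\alpha((\Phi_H,H,h),(\Phi_F,F,f))=\overline d(\Phi_H,\Phi_F)+|h-f|+\|H-F\|_{(1,\infty)}$. $\mathrm{Homeo}(M,\xi)$ is the group of time-one maps $\phi_H^1$ of topological contact dynamical systems. The contact topology on $\mathrm{Homeo}(M,\xi)$ is the quotient topology induced by the surjection $\mathrm{ev}_1\colon\mathcal{TCDS}(M,\alpha)\to\mathrm{Homeo}(M,\xi)$, $(\Phi_H,H,h)\mapsto\phi_H^1$. A topological contact isotopy whose time-zero map is not necessarily the identity is an isotopy of the form $\psi\circ\Phi_H=\{\psi\circ\phi_H^t\}$, with $\Phi_H$ a topological contact isotopy based at the identity and $\psi$ a topological automorphism of $\xi$, i.e. a homeomorphism that is a uniform limit of some $\psi_i\in\mathrm{Diff}(M,\xi)$ whose conformal factors also converge uniformly. (One could equally work with isotopies $\Phi_H\circ\psi$.) *)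

(* Defs.v *)
From HB Require Import structures.
From mathcomp Require Import all_boot all_order all_algebra all_fingroup.
From mathcomp Require Import all_classical all_reals all_analysis.

Set Implicit Arguments.
Unset Strict Implicit.
Unset Printing Implicit Defensive.

Import Order.TTheory GRing.Theory Num.Theory.
Import numFieldNormedType.Exports.

Local Open Scope classical_set_scope.
Local Open Scope ring_scope.

Definition path_connected (R : realType) (T : topologicalType) (A : set T) :=
  forall x y : T, A x -> A y -> exists gamma : R -> T,
    [/\ {within `[0, 1], continuous gamma}, gamma 0 = x, gamma 1 = y &
        forall t, t \in `[0, 1] -> A (gamma t)].

Definition locally_path_connected (R : realType) (T : topologicalType) :=
  forall (x : T) (U : set T), nbhs x U -> exists V : set T,
    [/\ open V, V x, V `<=` U & path_connected R V].

Section Smoothness.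
Context {R : realType}.
Implicit Types V W : normedModType R.

(* Used for finite-dimensional V only, where all directional derivatives being
   of class C^k amounts to the total derivative being of class C^k. *)
Fixpoint Ck (k : nat) V W (U : set V) (f : V -> W) : Prop :=
  match k with
  | 0 => forall x, U x -> {for x, continuous f}
  | k'.+1 => (forall x, U x -> differentiable f x) /\
             forall v : V, Ck k' U (fun x => 'D_v f x)
  end.

Definition smooth_open V W (U : set V) (f : V -> W) := forall k, Ck k U f.

(* Smoothness on an arbitrary subset: local existence of smooth extensions.
   On [0,1] x U this is smoothness up to the boundary; if A is open it is
   ordinary smoothness. *)
Definition smooth_on V W (A : set V) (f : V -> W) :=
  forall x, A x -> exists U : set V, [/\ open U, U x &
    exists2 g : V -> W, smooth_open U g & forall y, U y -> A y -> f y = g y].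

(* Integral over R^m, as an iterated Lebesgue integral; it is only applied to
   continuous functions of compact support. *)
Fixpoint iterated_integral (m : nat) : ('rV[R]_m -> R) -> R :=
  match m return ('rV[R]_m -> R) -> R with
  | 0 => fun f => f 0
  | m'.+1 => fun f => \int[lebesgue_measure]_x
      iterated_integral (fun v : 'rV[R]_m' => f (row_mx (x%:M : 'M[R]_1) v))
  end.

End Smoothness.

(* chart_inv i is only meaningful on the image of chart i. Second countability
   is a consequence of compactness. *)
Record closedManifold (R : realType) (m : nat) := ClosedManifold {
  pt :> topologicalType;
  chart_index : Type;
  dom : chart_index -> set pt;
  chart : chart_index -> pt -> 'rV[R]_m;
  chart_inv : chart_index -> 'rV[R]_m -> pt;
  chart_at : pt -> chart_index;
  dom_open : forall i, open (dom i);
  chart_at_dom : forall x, dom (chart_at x) x;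
  chart_image_open : forall i, open (chart i @` dom i);
  chartK : forall i x, dom i x -> chart_inv i (chart i x) = x;
  chart_continuous : forall i x, dom i x -> {for x, continuous (chart i)};
  chart_inv_continuous : forall i v, (chart i @` dom i) v ->
    {for v, continuous (chart_inv i)};
  chart_compatible : forall i j,
    smooth_on (chart i @` (dom i `&` dom j)) (chart j \o chart_inv i);
  manifold_hausdorff : hausdorff_space pt;
  manifold_compact : compact [set: pt];
  manifold_connected : connected [set: pt];
  manifold_nonempty : [set: pt] !=set0 }.

Section Manifold.
Context {R : realType} {m : nat} {M : closedManifold R m}.
Local Notation I := (chart_index M).
Local Notation E := 'rV[R]_m.

Definition transition (i j : I) : E -> E := chart j \o chart_inv i.

Definition local_rep (i j : I) (phi : M -> M) : E -> E :=
  chart j \o phi \o chart_inv i.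

Definition smooth_fun (f : M -> R) :=
  forall i, smooth_on (chart i @` dom i) (f \o chart_inv i : E -> R^o).

Definition smooth_map (phi : M -> M) := continuous phi /\
  forall i j, smooth_on (chart i @` (dom i `&` phi @^-1` dom j))
                        (local_rep i j phi).

(* Time-dependent objects are indexed by R; only times in [0,1] matter. *)
Definition continuous_family (T : topologicalType) (F : R -> M -> T) :=
  {within `[0, 1] `*` [set: M], continuous (fun p : R * M => F p.1 p.2)}.

Definition smooth_family (Phi : R -> M -> M) := continuous_family Phi /\
  forall i j, smooth_on
    [set p : R^o * E | p.1 \in `[0, 1] /\
       (chart i @` (dom i `&` Phi p.1 @^-1` dom j)) p.2]
    (fun p : R^o * E => local_rep i j (Phi p.1) p.2).

(* One-sided at the end points of [0,1]. *)
Definition has_velocity (c : R -> E) (t : R) (v : E) :=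
  (s - t)^-1 *: (c s - c t) @[s --> within `[0, 1] t^'] --> v.

Record partitionOfUnity := PartitionOfUnity {
  pou_size : nat;
  pou_fun : 'I_pou_size -> M -> R;
  pou_chart : 'I_pou_size -> I;
  pou_smooth : forall k, smooth_fun (pou_fun k);
  pou_ge0 : forall k x, 0 <= pou_fun k x;
  pou_sum1 : forall x, \sum_k pou_fun k x = 1;
  pou_support : forall k,
    closure [set x | pou_fun k x != 0] `<=` dom (pou_chart k) }.

Record riemannianMetric := RiemannianMetric {
  gram : I -> E -> 'M[R]_m;
  gram_smooth : forall i, smooth_on (chart i @` dom i) (gram i);
  gram_sym : forall i x, dom i x ->
    (gram i (chart i x))^T = gram i (chart i x);
  gram_posdef : forall i x, dom i x -> forall v : E, v != 0 ->
    0 < (v *m gram i (chart i x) *m v^T) 0 0;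
  gram_compatible : forall i j x, dom i x -> dom j x -> forall v w : E,
    v *m gram i (chart i x) *m w^T =
      'D_v (transition i j) (chart i x) *m gram j (chart j x)
        *m ('D_w (transition i j) (chart i x))^T }.

(* Meaningful where c is differentiable; independent of the chart. *)
Definition speed (g : riemannianMetric) (c : R -> M) (t : R) : R :=
  let j := chart_at (c t) in
  let v : E := 'D_1 (chart j \o c : R^o -> E) t in
  Num.sqrt ((v *m gram g j (chart j (c t)) *m v^T) 0 0).

Definition piecewise_smooth (c : R -> M) :=
  {within `[0, 1], continuous c} /\
  exists (N : nat) (s : nat -> R), [/\ s 0%N = 0, s N = 1 &
    forall l, (l < N)%N -> s l < s l.+1 /\
      forall j, smooth_on [set t : R^o | t \in `[s l, s l.+1] /\ dom j (c t)]
                          (chart j \o c : R^o -> E)].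

Definition curve_length (g : riemannianMetric) (c : R -> M) : \bar R :=
  (\int[lebesgue_measure]_(t in `[0%R, 1%R]) (speed g c t)%:E)%E.

Definition riemannian_dist (g : riemannianMetric) (x y : M) : R :=
  fine (ereal_inf [set curve_length g c | c in
    [set c | [/\ piecewise_smooth c, c 0 = x & c 1 = y]]]).

End Manifold.

Arguments partitionOfUnity {R m} M.
Arguments riemannianMetric {R m} M.

Section ContactForm.
Context {R : realType} {n : nat}.
Local Notation m := (n.*2.+1).
Local Notation E := 'rV[R]_m.

Definition pairing (a v : E) : R := \sum_k a 0 k * v 0 k.

Definition ext_deriv (a : E -> E) (x : E) (j k : 'I_m) : R :=
  'D_(delta_mx 0 j) (fun y => a y 0 k : R^o) x -
  'D_(delta_mx 0 k) (fun y => a y 0 j : R^o) x.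

(* The value of a /\ (da)^n on the standard basis of R^(2n+1). *)
Definition contact_density (a : E -> E) (x : E) : R :=
  (2 ^+ n)^-1 * \sum_(s : 'S_m) (-1) ^+ odd_perm s * a x 0 (s ord0) *
    \prod_(l < n) ext_deriv a x (s (inord l.*2.+1)) (s (inord l.*2.+2)).

(* form i v is the row of coefficients, at the point with coordinates v, of
   the contact form in the chart i. *)
Record contactForm (M : closedManifold R m) := ContactForm {
  form : chart_index M -> E -> E;
  form_smooth : forall i, smooth_on (chart i @` dom i) (form i);
  form_compatible : forall i j x, dom i x -> dom j x -> forall v : E,
    pairing (form i (chart i x)) v =
    pairing (form j (chart j x)) ('D_v (transition i j) (chart i x));
  form_contact : forall i x, dom i x ->
    contact_density (form i) (chart i x) != 0 }.

End ContactForm.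

Record homeo (T : topologicalType) := Homeo {
  hfun :> T -> T;
  hinv : T -> T;
  hfun_continuous : continuous hfun;
  hinv_continuous : continuous hinv;
  hfunK : cancel hfun hinv;
  hinvK : cancel hinv hfun }.

Section ContactDynamics.
Context {R : realType} {n : nat} {M : closedManifold R n.*2.+1}.
Variables (alpha : contactForm M) (g : riemannianMetric M)
          (P : partitionOfUnity M).
Local Notation E := 'rV[R]_(n.*2.+1).

(* Integral against the volume form alpha /\ (d alpha)^n, for the orientation
   that this form defines; hence the absolute value of the density. The value
   does not depend on the partition of unity P. *)
Definition contact_integral (H : M -> R) : R :=
  \sum_(k < pou_size P) iterated_integral (fun v : E =>
    let i := pou_chart k in let x := chart_inv i v in
    if v \in chart i @` dom i
    then pou_fun k x * H x * `|contact_density (form alpha i) v| else 0).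

Definition ham_norm (H : M -> R) : R :=
  sup (range H) - inf (range H) +
  `|contact_integral H / contact_integral (fun=> 1)|.

Definition ham_norm1oo (H : R -> M -> R) : \bar R :=
  (\int[lebesgue_measure]_(t in `[0%R, 1%R]) (ham_norm (H t))%:E)%E.

Definition unif_norm (h : R -> M -> R) : \bar R :=
  ereal_sup [set `|h p.1 p.2|%:E | p in `[0, 1] `*` [set: M]].

Definition homeo_dist (phi psi : homeo M) : R :=
  sup [set riemannian_dist g (phi x) (psi x) | x in [set: M]] +
  sup [set riemannian_dist g (hinv phi x) (hinv psi x) | x in [set: M]].

Definition isotopy_dist (Phi Psi : R -> homeo M) : R :=
  sup [set homeo_dist (Phi t) (Psi t) | t in `[0, 1]].

(* phi^* alpha = e^f alpha *)
Definition contactomorphism (phi : homeo M) (f : M -> R) :=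
  [/\ smooth_map phi, smooth_map (hinv phi), smooth_fun f &
      forall i j x, dom i x -> dom j (phi x) -> forall v : E,
        pairing (form alpha j (chart j (phi x)))
                ('D_v (local_rep i j phi) (chart i x)) =
        expR (f x) * pairing (form alpha i (chart i x)) v].

Definition smooth_contact_system
    (Phi : R -> homeo M) (H h : R -> M -> R) :=
  [/\ smooth_family Phi,
      Phi 0 = id :> (M -> M),
      forall t, t \in `[0, 1] -> contactomorphism (Phi t) (h t) &
      forall t x j, t \in `[0, 1] -> dom j (Phi t x) ->
        exists2 v, has_velocity (fun s => chart j (Phi s x)) t v &
          H t (Phi t x) = pairing (form alpha j (chart j (Phi t x))) v].

Definition simple_C0 (S : R -> M -> R) :=
  [/\ finite_set (S @` `[0, 1]),
      forall t, t \in `[0, 1] -> continuous (S t) &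
      forall f : M -> R, measurable (`[0, 1] `&` [set t | S t = f])].

(* Bochner integrable maps from [0,1] to C^0(M). *)
Definition L1_C0 (H : R -> M -> R) :=
  [/\ forall t, t \in `[0, 1] -> continuous (H t),
      exists2 S : nat -> R -> M -> R, forall k, simple_C0 (S k) &
        {ae @lebesgue_measure R, forall t, t \in `[0, 1] ->
           {uniform, (fun k => S k t) @ \oo --> H t}} &
      (ham_norm1oo H < +oo)%E].

Definition topological_contact_system
    (Phi : R -> homeo M) (H h : R -> M -> R) :=
  [/\ continuous_family Phi, L1_C0 H &
      exists (Phi_ : nat -> R -> homeo M) (H_ h_ : nat -> R -> M -> R),
        [/\ forall k, smooth_contact_system (Phi_ k) (H_ k) (h_ k),
            isotopy_dist (Phi_ k) Phi @[k --> \oo] --> 0,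
            unif_norm (h_ k \- h) @[k --> \oo] --> 0%E &
            ham_norm1oo (H \- H_ k) @[k --> \oo] --> 0%E]].

Record tcds := TCDS {
  isotopy : R -> homeo M;
  hamiltonian : R -> M -> R;
  conf_factor : R -> M -> R;
  tcdsP : topological_contact_system isotopy hamiltonian conf_factor }.

(* Only a pseudometric on this type: it ignores times outside [0,1] and
   modifications of the Hamiltonian on null sets of times. *)
Definition tcds_dist (p q : tcds) : \bar R :=
  ((isotopy_dist (isotopy p) (isotopy q))%:E +
   unif_norm (conf_factor p \- conf_factor q)%R +
   ham_norm1oo (hamiltonian p \- hamiltonian q)%R)%E.

Definition tcds_open (U : set tcds) := forall p, U p ->
  exists2 e : R, 0 < e & forall q, (tcds_dist p q < e%:E)%E -> U q.

Lemma tcds_openT : tcds_open setT.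
Proof. by move=> p _; exists 1. Qed.

Lemma tcds_openI : setI_closed tcds_open.
Proof.
move=> U V oU oV p [/oU[e e0 He] /oV[d d0 Hd]].
exists (Num.min e d); first by rewrite lt_min e0.
by move=> q; rewrite EFin_min lt_min => /andP[/He Uq /Hd Vq].
Qed.

Lemma tcds_open_bigU (J : Type) (F : J -> set tcds) :
  (forall j, tcds_open (F j)) -> tcds_open (\bigcup_j F j).
Proof.
move=> oF p [j _ /oF[e e0 He]]; exists e => // q /He Fq.
by exists j.
Qed.

HB.instance Definition _ := gen_eqMixin tcds.
HB.instance Definition _ := gen_choiceMixin tcds.
HB.instance Definition _ :=
  isOpenTopological.Build tcds tcds_openT tcds_openI tcds_open_bigU.

Record contactHomeo := ContactHomeo {
  chomeo :> homeo M;
  chomeoP : exists p : tcds, isotopy p 1 = chomeo }.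

Definition ev1 (p : tcds) : contactHomeo :=
  ContactHomeo (ex_intro _ p erefl).

(* Quotient topology of ev1. *)
Definition contact_open (U : set contactHomeo) := open (ev1 @^-1` U).

Lemma contact_openT : contact_open setT.
Proof. exact: openT. Qed.

Lemma contact_openI : setI_closed contact_open.
Proof. by move=> U V oU oV; apply: openI. Qed.

Lemma contact_open_bigU (J : Type) (F : J -> set contactHomeo) :
  (forall j, contact_open (F j)) -> contact_open (\bigcup_j F j).
Proof.
move=> oF; rewrite /contact_open preimage_bigcup.
by apply: bigcup_open => j _; apply: oF.
Qed.

HB.instance Definition _ := gen_eqMixin contactHomeo.
HB.instance Definition _ := gen_choiceMixin contactHomeo.
HB.instance Definition _ := isOpenTopological.Build contactHomeo
  contact_openT contact_openI contact_open_bigU.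

Definition topological_automorphism (psi : homeo M) :=
  exists (psi_ : nat -> homeo M) (f_ : nat -> M -> R) (f : M -> R),
    [/\ forall k, contactomorphism (psi_ k) (f_ k),
        homeo_dist (psi_ k) psi @[k --> \oo] --> 0 &
        {uniform, f_ @ \oo --> f}].

(* The time-zero map need not be the identity. *)
Definition topological_contact_isotopy (Psi : R -> M -> M) :=
  exists (psi : homeo M) (p : tcds), topological_automorphism psi /\
    forall t, t \in `[0, 1] -> Psi t = psi \o isotopy p t.

End ContactDynamics.

(* Main.v *)
(* Translating a contact isotopy to the right by a fixed contactomorphism does
   not change its Hamiltonian. Hence, for topological contact systems q, p and
   times a, b, c, one can run through q up to the time a and then through p from
   the time b to the time c: if both pieces are reparametrised so that they are
   constant near the junction, the smooth approximants concatenate to smooth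
   isotopies, and the limit is a topological contact system with time one map
   p_c p_b^-1 q_a. It depends continuously on q, a, b, c; for the Hamiltonians
   this rests on the inequality [int |tau'| N(tau) <= int N] for monotone time
   changes tau, and for the isotopies on the fact that the Riemannian distance
   is uniformly equivalent to the metric of an embedding.

   The path p_1 p_t^-1 q_t leads from p_1 to q_1 and is constant if q = p. By
   compactness of [0,1] it stays in a given open set around p_1 when q is close
   to p, so the path components of open sets are open. Finally, (a, b, c) =
   (1, 1, 0) gives an isotopy Phi from the identity to p_1^-1 q_1, and
   p_1 Phi_t = p_1 p_0^-1 Phi_t is a path of the same kind. *)

From HB Require Import structures.
Require Import Defs.
From mathcomp Require Import all_boot all_order all_algebra all_fingroup.
From mathcomp Require Import all_classical all_reals all_analysis.
From mathcomp Require Import ring lra measurable_realfun zify.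

Import Defs.

Set Implicit Arguments.
Unset Strict Implicit.
Unset Printing Implicit Defensive.

Import Order.TTheory GRing.Theory Num.Theory.
Import numFieldNormedType.Exports.

Local Open Scope classical_set_scope.
Local Open Scope ring_scope.

(** * Smooth maps between normed spaces *)

Section CkCalculus.
Context {R : realType}.
Implicit Types U V W : normedModType R.

(** The pointwise product of two contact isotopies has a Hamiltonian in which the second one enters
    multiplied by a conformal factor and transported by the first flow. In a concatenation only one
    factor moves at a time, so Hamiltonians are merely rescaled in time and added. The price is a
    time change that comes to rest, or runs backwards, composed with a Hamiltonian controlled only
    outside a null set of times. The inequality for |tau'| N(tau) answers this twice: it bounds the
    norms, and it shows that almost every time sent into a null set is one where tau' = 0. Norms of
    Hamiltonians are integrals of functions not assumed measurable, so sums are estimated through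
    measurable majorants. Convergence of concatenations is proved along an arbitrary filter; this
    yields both that the limit is a topological system and that it varies continuously. Since open
    sets of the quotient are tested on preimages under [ev1], all neighbourhoods are taken among
    systems, never among homeomorphisms. *)

Lemma nbhs_eq_open V W (A : set V) (f g : V -> W) x : open A -> A x ->
  (forall y, A y -> f y = g y) -> \near x, f x = g x.
Proof.
move=> oA Ax fg; have : nbhs x A by exact: open_nbhs_nbhs.
by apply: filterS => y /fg.
Qed.

(** The first-order expansion of f at x is also one of g, with the same linear part. *)
Lemma near_eq_differentiable V W (f g : V -> W) x :
  (\near x, f x = g x) -> differentiable f x -> differentiable g x.
Proof.
move=> fg df.
have fgx : f x = g x by apply: nbhs_singleton fg.
have dg : g \o shift x = cst (g x) + 'd f x +o_ 0 id.
  have /eqaddoP dfo := diff_locally df.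
  apply/eqaddoP => e e0; near=> y.
  have <- : (f \o shift x - (cst (f x) + 'd f x)) y =
            (g \o shift x - (cst (g x) + 'd f x)) y.
    rewrite !fctE /= fgx; congr (_ - _).
    near: y; have := fg; rewrite (near_shift 0) subr0.
    exact.
  by near: y; exact: dfo.
apply/diff_locallyP; rewrite (diff_unique (diff_continuous df) dg); split=> //.
exact: diff_continuous.
Unshelve. all: by end_near. Qed.

Lemma Ck_eq V W k (A : set V) (f g : V -> W) : open A ->
  (forall x, A x -> f x = g x) -> Ck k A f -> Ck k A g.
Proof.
elim: k f g => [|k IH] f g oA fg /=.
  move=> cf x Ax.
  have fgx := nbhs_eq_open oA Ax fg.
  rewrite /prop_for /continuous_at -(fg x Ax); apply: cvg_trans (cf x Ax).
  by apply: near_eq_cvg; apply: filterS fgx => y.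
move=> [df Df]; split=> [x Ax|v].
  by apply: near_eq_differentiable (df x Ax); exact: nbhs_eq_open fg.
apply: IH (Df v) => // x Ax; apply: near_eq_derive; exact: nbhs_eq_open fg.
Qed.

Lemma Ck_sub V W k (A B : set V) (f : V -> W) :
  B `<=` A -> Ck k A f -> Ck k B f.
Proof.
elim: k f => [|k IH] f BA /=; first by move=> cf x /BA; exact: cf.
move=> [df Df]; split=> [x /BA|v]; [exact: df|exact: IH].
Qed.

Lemma CkW V W k (A : set V) (f : V -> W) : Ck k.+1 A f -> Ck k A f.
Proof.
elim: k f => [|k IH] f /= [df Df].
  by move=> x Ax; apply: differentiable_continuous; exact: df.
by split=> // v; apply: IH; exact: Df.
Qed.

Lemma Ck_continuous V W k (A : set V) (f : V -> W) x :
  Ck k A f -> A x -> {for x, continuous f}.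
Proof.
by elim: k => [|k IH]; [exact|move=> /CkW; exact: IH].
Qed.

Lemma Ck_cst V W k (A : set V) (c : W) : Ck k A (cst c).
Proof.
elim: k c => [|k IH] c /=; first by move=> x _; exact: cst_continuous.
split=> [x _|v]; first exact: differentiable_cst.
have -> : (fun x : V => 'D_v (cst c) x) = cst 0; last exact: IH.
by apply/funext => x; rewrite derive_cst.
Qed.

Lemma Ck_linear V W k (A : set V) (L : {linear V -> W}) : continuous L ->
  Ck k A L.
Proof.
move=> cL; case: k => [|k] /=; first by move=> x _; exact: cL.
split=> [x _|v]; first exact: linear_differentiable.
have -> : (fun x : V => 'D_v L x) = cst (L v); last exact: Ck_cst.
apply/funext => x; rewrite deriveE; last exact: linear_differentiable.
by rewrite diff_lin.
Qed.

Lemma CkD V W k (A : set V) (f g : V -> W) : open A ->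
  Ck k A f -> Ck k A g -> Ck k A (f \+ g).
Proof.
elim: k f g => [|k IH] f g oA /=.
  by move=> cf cg x Ax; apply: continuousD; [exact: cf|exact: cg].
move=> [df Df] [dg Dg]; split=> [x Ax|v].
  by apply: differentiableD; [exact: df|exact: dg].
apply: (@Ck_eq _ _ _ _ ((fun x => 'D_v f x) \+ (fun x => 'D_v g x))) => //.
  move=> x Ax /=; rewrite deriveD//; apply: diff_derivable; [exact: df|exact: dg].
exact: IH.
Qed.

Lemma Ck_sum V W k (A : set V) n (f : 'I_n -> V -> W) : open A ->
  (forall i, Ck k A (f i)) -> Ck k A (fun x => \sum_i f i x).
Proof.
move=> oA; elim: n f => [|n IH] f fC.
  apply: Ck_eq (@Ck_cst _ _ k A 0) => // x Ax; by rewrite big_ord0.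
apply: (@Ck_eq _ _ _ _ (f ord0 \+ (fun x => \sum_i f (lift ord0 i) x))) => //.
  by move=> x Ax /=; rewrite big_ord_recl.
by apply: CkD => //; apply: IH => i.
Qed.

Lemma Ck_linear_comp U V W k (A : set U) (f : U -> V) (L : {linear V -> W}) :
  open A -> continuous L -> Ck k A f -> Ck k A (L \o f).
Proof.
move=> oA cL; elim: k f => [|k IH] f /=.
  by move=> cf x Ax; apply: continuous_comp; [exact: cf|exact: cL].
move=> [df Df]; split=> [x Ax|v].
  by apply: differentiable_comp; [exact: df|exact: linear_differentiable].
apply: Ck_eq (IH _ (Df v)) => // x Ax /=.
have dfx := df x Ax.
have dL := @linear_differentiable _ _ _ L (f x) cL.
rewrite [RHS]deriveE; last exact: differentiable_comp.
by rewrite diff_comp//= diff_lin// deriveE.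
Qed.

(** Typing the scalar as [R^o] makes scalar multiplication a bilinear map of normed spaces, so that
    the differentiation rule for bilinear maps yields the Leibniz rule. *)
Definition scale_fun V (r : R^o) (v : V) : V := r *: v.

Lemma scale_fun_is_bilinear V :
  bilinear_for
    (GRing.Scale.Law.clone _ _ *:%R _) (GRing.Scale.Law.clone _ _ *:%R _)
    (@scale_fun V).
Proof.
split=> [u'|u] a x y /=; rewrite /scale_fun; first by rewrite scalerDl scalerA.
by rewrite scalerDr !scalerA mulrC.
Qed.
HB.instance Definition _ V := bilinear_isBilinear.Build R R^o V V _ _
  (@scale_fun V) (@scale_fun_is_bilinear V).

Lemma is_diff_scale V (p : R^o * V) :
  is_diff p (fun q => q.1 *: q.2) (fun q => p.1 *: q.2 + q.1 *: p.2).
Proof.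
have cf : continuous (fun q : R^o * V => scale_fun q.1 q.2).
  by move=> q; exact: scale_continuous.
apply: DiffDef; first exact: (@differentiable_bilin _ _ _ _ (@scale_fun V)).
exact: (@diff_bilin _ _ _ _ (@scale_fun V)).
Qed.

Lemma differentiableZ_fun V W (r : V -> R^o) (f : V -> W) x :
  differentiable r x -> differentiable f x ->
  differentiable (fun y => r y *: f y) x.
Proof.
move=> dr df.
have h := is_diff_scale (r x, f x).
apply: (@differentiable_comp _ _ _ _ (fun y => (r y, f y)) (fun q => q.1 *: q.2)).
  exact: differentiable_pair.
exact: ex_diff.
Qed.

Lemma deriveZ_fun V W (r : V -> R^o) (f : V -> W) x v :
  differentiable r x -> differentiable f x ->
  'D_v (fun y => r y *: f y) x = r x *: 'D_v f x + 'D_v r x *: f x.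
Proof.
move=> dr df.
have h := is_diff_scale (r x, f x).
rewrite deriveE; last exact: differentiableZ_fun.
rewrite (@diff_comp _ _ _ _ (fun y => (r y, f y)) (fun q => q.1 *: q.2)); last 2 first.
- exact: differentiable_pair.
- exact: ex_diff.
by rewrite diff_val /= diff_pair//= !deriveE.
Qed.

Lemma CkZ V W k (A : set V) (r : V -> R^o) (f : V -> W) : open A ->
  Ck k A r -> Ck k A f -> Ck k A (fun x => r x *: f x).
Proof.
move=> oA; elim: k r f => [|k IH] r f.
  by move=> cr cf x Ax; apply: continuousZ; [exact: cr|exact: cf].
move=> Cr Cf; have [dr Dr] := Cr; have [df Df] := Cf; split=> [x Ax|v].
  by apply: differentiableZ_fun; [exact: dr|exact: df].
apply: (@Ck_eq _ _ _ _
    ((fun x => r x *: 'D_v f x) \+ (fun x => 'D_v r x *: f x))) => //.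
  by move=> x Ax /=; rewrite deriveZ_fun//; [exact: dr|exact: df].
(* In each Leibniz term one factor is a derivative, of class C^k, and the other is the
   undifferentiated function, lowered from C^(k+1) to C^k. *)
apply: CkD => //; first exact: (IH r _ (CkW Cr) (Df v)).
exact: (IH _ f (Dr v) (CkW Cf)).
Qed.

Lemma Ck_pair U V W k (A : set U) (f : U -> V) (g : U -> W) : open A ->
  Ck k A f -> Ck k A g -> Ck k A (fun x => (f x, g x)).
Proof.
move=> oA; elim: k f g => [|k IH] f g.
  by move=> cf cg x Ax; apply: cvg_pair; [exact: cf|exact: cg].
move=> [df Df] [dg Dg]; split=> [x Ax|v].
  by apply: differentiable_pair; [exact: df|exact: dg].
apply: (@Ck_eq _ _ _ _ (fun x => ('D_v f x, 'D_v g x))) => //; last exact: (IH _ _ (Df v) (Dg v)).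
move=> x Ax; have dfx := df x Ax; have dgx := dg x Ax.
rewrite [RHS]deriveE; last exact: differentiable_pair.
by rewrite diff_pair//= !deriveE.
Qed.

(* Finite-dimensionality, in the form needed to differentiate compositions:
   the chain rule expands a direction depending on the point in a fixed basis. *)
Definition has_coordinates W := exists (n : nat) (e : 'I_n -> W)
  (c : 'I_n -> {linear W -> R^o}),
  (forall l, continuous (c l)) /\ forall w, w = \sum_l c l w *: e l.

Lemma Ck_comp U V W k (A : set U) (B : set V) (f : U -> V) (g : V -> W) :
  has_coordinates V -> open A -> open B -> (forall x, A x -> B (f x)) ->
  Ck k A f -> Ck k B g -> Ck k A (g \o f).
Proof.
move=> hV oA oB AB; elim: k g => [|k IH] g.
  by move=> cf cg x Ax; apply: continuous_comp; [exact: cf|exact/cg/AB].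
move=> Cf [dg Dg]; have [df Df] := Cf.
split=> [x Ax|v].
  by apply: differentiable_comp; [exact: df|exact/dg/AB].
have [n [e [c [cc ce]]]] := hV.
apply: (@Ck_eq _ _ _ _ (fun x =>
  \sum_l c l ('D_v f x) *: 'D_(e l) g (f x))) => //.
  move=> x Ax; have dfx := df x Ax; have dgx := dg _ (AB _ Ax).
  rewrite [RHS]deriveE; last exact: differentiable_comp.
  rewrite diff_comp//= -[X in _ = X](_ : 'd g (f x) ('D_v f x) = _); last first.
    by rewrite deriveE.
  rewrite [in RHS](ce ('D_v f x)) linear_sum; apply: eq_bigr => l _.
  by rewrite linearZ/= (deriveE (e l) dgx).
apply: Ck_sum => // l; apply: CkZ => //.
  by apply: (@Ck_linear_comp _ _ _ _ _ (fun x => 'D_v f x)) => //; exact: Df.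
by apply: (IH (fun y => 'D_(e l) g y)); [exact: CkW|exact: Dg].
Qed.

Lemma smooth_open_sub V W (A B : set V) (f : V -> W) :
  B `<=` A -> smooth_open A f -> smooth_open B f.
Proof. by move=> BA fA k; apply: Ck_sub (fA k). Qed.

Lemma smooth_open_comp U V W (A : set U) (B : set V) (f : U -> V) (g : V -> W) :
  has_coordinates V -> open A -> open B -> (forall x, A x -> B (f x)) ->
  smooth_open A f -> smooth_open B g -> smooth_open A (g \o f).
Proof. by move=> hV oA oB AB fA gB k; apply: Ck_comp (fA k) (gB k). Qed.

Lemma smooth_open_on V W (A : set V) (f : V -> W) :
  open A -> smooth_open A f -> smooth_on A f.
Proof. by move=> oA fA x Ax; exists A; split => //; exists f. Qed.

Lemma smooth_on_sub V W (A B : set V) (f : V -> W) :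
  B `<=` A -> smooth_on A f -> smooth_on B f.
Proof.
move=> BA fA x /BA Ax; have [U [oU Ux [g gU fg]]] := fA x Ax.
by exists U; split=> //; exists g => // y Uy /BA; exact: fg.
Qed.

Lemma smooth_on_eq V W (A : set V) (f g : V -> W) :
  (forall x, A x -> f x = g x) -> smooth_on A f -> smooth_on A g.
Proof.
move=> fg fA x Ax; have [U [oU Ux [h hU fh]]] := fA x Ax.
by exists U; split=> //; exists h => // y Uy Ay; rewrite -fg// fh.
Qed.

(** Smooth extensions are demanded point by point, so A may be cut down around each of its points.
    This lets the intermediate chart of a composition depend on the point. *)
Lemma smooth_on_local V W (A : set V) (f : V -> W) :
  (forall x, A x -> exists2 B : set V, nbhs x B & smooth_on (A `&` B) f) ->
  smooth_on A f.
Proof.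
move=> loc x Ax; have [B Bx fB] := loc x Ax.
have [|U [oU Ux [g gU fg]]] := fB x; first by split=> //; exact: nbhs_singleton.
have oB : open B° by exact: open_interior.
exists (U `&` B°); split=> //; first exact: openI.
exists g; first by apply: smooth_open_sub gU.
move=> y [Uy By] Ay; apply: fg => //; split=> //; exact: interior_subset.
Qed.

Lemma continuous_open_preimage V W (A : set V) (B : set W) (f : V -> W) :
  open A -> open B -> (forall x, A x -> {for x, continuous f}) ->
  open (A `&` f @^-1` B).
Proof.
move=> oA oB cf; rewrite openE => x [Ax Bfx].
apply: filterI; first exact: open_nbhs_nbhs.
by apply: cf => //; exact: open_nbhs_nbhs.
Qed.

Lemma smooth_open_continuous V W (A : set V) (f : V -> W) x :
  smooth_open A f -> A x -> {for x, continuous f}.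
Proof. by move=> /(_ 0%N); exact: Ck_continuous. Qed.

Lemma smooth_open_differentiable V W (A : set V) (f : V -> W) x :
  smooth_open A f -> A x -> differentiable f x.
Proof. by move=> /(_ 1%N)[+ _]; exact. Qed.

Lemma smooth_open_derive V W (A : set V) (f : V -> W) v :
  smooth_open A f -> smooth_open A (fun x => 'D_v f x).
Proof. by move=> fA k; have [_ +] := fA k.+1; exact. Qed.

Lemma smooth_on_comp U V W (A : set U) (B : set V) (f : U -> V) (g : V -> W) :
  has_coordinates V -> (forall x, A x -> B (f x)) ->
  smooth_on A f -> smooth_on B g -> smooth_on A (g \o f).
Proof.
move=> hV AB fA gB x Ax.
have [D1 [oD1 D1x [f1 f1C ff1]]] := fA x Ax.
have [D2 [oD2 D2x [g1 g1C gg1]]] := gB (f x) (AB x Ax).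
(* Off A the extension f1 may leave D2, so its domain is restricted. *)
have openO : open (D1 `&` f1 @^-1` D2).
  by apply: continuous_open_preimage => // y D1y; exact: smooth_open_continuous f1C _.
exists (D1 `&` f1 @^-1` D2); split=> //.
  by split=> //=; rewrite -ff1.
exists (g1 \o f1).
  apply: smooth_open_comp g1C => //; last exact: smooth_open_sub f1C.
  by move=> y [].
by move=> y [D1y D2y] Ay /=; rewrite -ff1// gg1//; [rewrite ff1|exact: AB].
Qed.

Lemma smooth_on_pair U V W (A : set U) (f : U -> V) (g : U -> W) :
  smooth_on A f -> smooth_on A g -> smooth_on A (fun x => (f x, g x)).
Proof.
move=> fA gA x Ax.
have [D1 [oD1 D1x [f1 f1C ff1]]] := fA x Ax.
have [D2 [oD2 D2x [g1 g1C gg1]]] := gA x Ax.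
have openO : open (D1 `&` D2) by exact: openI.
exists (D1 `&` D2); split=> //; exists (fun y => (f1 y, g1 y)).
  by move=> k; apply: Ck_pair => //; [apply: Ck_sub (f1C k)|apply: Ck_sub (g1C k)].
by move=> y [D1y D2y] Ay; rewrite ff1// gg1.
Qed.

Lemma smooth_onD V W (A : set V) (f g : V -> W) :
  smooth_on A f -> smooth_on A g -> smooth_on A (f \+ g).
Proof.
move=> fA gA x Ax.
have [D1 [oD1 D1x [f1 f1C ff1]]] := fA x Ax.
have [D2 [oD2 D2x [g1 g1C gg1]]] := gA x Ax.
have openO : open (D1 `&` D2) by exact: openI.
exists (D1 `&` D2); split=> //; exists (f1 \+ g1).
  by move=> k; apply: CkD => //; [apply: Ck_sub (f1C k)|apply: Ck_sub (g1C k)].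
by move=> y [D1y D2y] Ay /=; rewrite ff1// gg1.
Qed.

Lemma smooth_on_linear V W (A : set V) (L : {linear V -> W}) :
  continuous L -> smooth_on A L.
Proof.
move=> cL; apply: (@smooth_on_sub _ _ setT) => //.
by apply: smooth_open_on; [exact: openT|move=> k; exact: Ck_linear].
Qed.

Lemma smooth_on_linear_comp U V W (A : set U) (f : U -> V) (L : {linear V -> W}) :
  continuous L -> smooth_on A f -> smooth_on A (L \o f).
Proof.
move=> cL fA x Ax; have [D1 [oD1 D1x [f1 f1C ff1]]] := fA x Ax.
exists D1; split=> //; exists (L \o f1) => [k|y Oy Ay /=]; last by rewrite ff1.
exact: Ck_linear_comp.
Qed.

Lemma smooth_on_open_continuous V W (A : set V) (f : V -> W) x :
  smooth_on A f -> nbhs x A -> {for x, continuous f}.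
Proof.
move=> fA nA; have [D1 [oD1 D1x [f1 f1C ff1]]] := fA x (nbhs_singleton nA).
rewrite /prop_for /continuous_at (ff1 x D1x (nbhs_singleton nA)).
apply: cvg_trans (smooth_open_continuous f1C D1x); apply: near_eq_cvg.
have : nbhs x D1 by exact: open_nbhs_nbhs.
by apply: filterS2 nA => y Ay Oy; rewrite ff1.
Qed.

Lemma has_coordinates_rV m : has_coordinates 'rV[R]_m.
Proof.
pose c (l : 'I_m) (v : 'rV[R]_m) : R^o := v 0 l.
have clin l : linear (c l) by move=> a u v; rewrite /c !mxE.
pose cL l : {linear 'rV[R]_m -> R^o} :=
  HB.pack (c l) (GRing.isLinear.Build _ _ _ _ _ (clin l)).
exists m, (fun l => delta_mx 0 l), cL; split=> [l|w].
  exact: coord_continuous.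
exact: row_sum_delta.
Qed.

Lemma has_coordinates_R : has_coordinates (R^o : normedModType R).
Proof.
have clin : linear (id : R^o -> R^o) by [].
pose cL : {linear R^o -> R^o} := HB.pack (id : R^o -> R^o) (GRing.isLinear.Build _ _ _ _ _ clin).
exists 1%N, (fun=> 1), (fun=> cL); split=> [l x|w] /=.
  exact: cvg_id.
by rewrite big_ord1 /= [RHS]mulr1.
Qed.

Lemma has_coordinates_pair V W : has_coordinates V -> has_coordinates W ->
  has_coordinates (V * W)%type.
Proof.
move=> [n [e [c [cc ce]]]] [p [e' [c' [cc' ce']]]].
pose d (l : 'I_(n + p)) (v : V * W) : R^o := match fintype.split l with inl i => c i v.1 | inr j => c' j v.2 end.
have dlin l : linear (d l).
  by move=> a u v; rewrite /d; case: (fintype.split l) => i; rewrite linearP.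
pose dL l : {linear (V * W)%type -> R^o} :=
  HB.pack (d l) (GRing.isLinear.Build _ _ _ _ _ (dlin l)).
exists (n + p)%N, (fun l => match fintype.split l with inl i => (e i, 0) | inr j => (0, e' j) end), dL.
split=> [l|[u v]].
  rewrite /= /d; case: (fintype.split l) => i x.
    by apply: continuous_comp; [exact: cvg_fst|exact: cc].
  by apply: continuous_comp; [exact: cvg_snd|exact: cc'].
rewrite big_split_ord/=.
transitivity (\sum_i (c i u *: e i, 0) + \sum_j (0, c' j v *: e' j) : V * W).
  have s1 I (r : seq I) (F : I -> V) : \sum_(i <- r) (F i, 0) = (\sum_(i <- r) F i, 0) :> V * W.
    by elim/big_rec2: _ => // i x y _ ->; congr pair; rewrite /= addr0.
  have s2 I (r : seq I) (F : I -> W) : \sum_(i <- r) (0, F i) = (0, \sum_(i <- r) F i) :> V * W.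
    by elim/big_rec2: _ => // i x y _ ->; congr pair; rewrite /= addr0.
  by rewrite s1 s2 -ce -ce' /=; congr pair; rewrite /= ?addr0 ?add0r.
congr (_ + _); apply: eq_bigr => i _.
  rewrite /d; have := unsplitK (inl i : 'I_n + 'I_p)%type; rewrite /unsplit => ->.
  by congr pair; rewrite /= scaler0.
rewrite /d; have := unsplitK (inr i : 'I_n + 'I_p)%type; rewrite /unsplit => ->.
by congr pair; rewrite /= scaler0.
Qed.

End CkCalculus.

(** * A smooth step function *)

Section SmoothStep.
Context {R : realType}.

Lemma derive_scale1 (W : normedModType R) (f : R^o -> W) (x v : R) :
  differentiable f x -> 'D_v f x = v *: 'D_1 f x.
Proof. by move=> df; rewrite !deriveE// -linearZ /=; congr ('d f x _); rewrite [RHS]mulr1. Qed.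

(** The function x^(-m) exp(-1/x), extended by 0. With the powers the family is closed under
    differentiation up to linear combinations, so all members are proved smooth by one induction. *)
Definition flat (m : nat) (x : R^o) : R^o :=
  if 0 < x then (x^-1) ^+ m * expR (- x^-1) else 0.

Lemma flat_ge0 m x : 0 <= flat m x.
Proof.
rewrite /flat; case: ifPn => // x0.
by rewrite mulr_ge0 ?expR_ge0// exprn_ge0// invr_ge0 ltW.
Qed.

Lemma flat_gt0 m x : 0 < x -> 0 < flat m x.
Proof. by move=> x0; rewrite /flat x0 mulr_gt0 ?expR_gt0// exprn_gt0// invr_gt0. Qed.

Lemma flat_le0 m x : x <= 0 -> flat m x = 0.
Proof. by move=> x0; rewrite /flat ltNge x0. Qed.

(** From exp(y) >= y^(m+1) / (m+1)! at y = 1/x. *)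
Lemma flat_le m x : 0 < x -> flat m x <= (m.+1)`!%:R * x.
Proof.
move=> x0; rewrite /flat x0.
have y0 : 0 < x^-1 by rewrite invr_gt0.
have /(le_trans _) h := expR_ge1Dxn m (ltW y0).
rewrite expRN ler_pdivrMr ?expR_gt0//.
have : (x^-1) ^+ m.+1 / (m.+1)`!%:R <= expR x^-1 by apply: h; rewrite lerDr.
rewrite ler_pdivrMr ?ltr0n ?fact_gt0// exprS => h2.
have xn0 : x != 0 by rewrite gt_eqF.
rewrite -[leLHS](mulVKf xn0) (_ : _ * _ * _ = x * (expR x^-1 * (m.+1)`!%:R)).
  by rewrite ler_pM2l.
by ring.
Qed.

Lemma is_derive_flat m x :
  is_derive x (1 : R^o) (flat m) (flat m.+2 x - m%:R * flat m.+1 x).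
Proof.
have [x0|x0|x0] := ltgtP x 0.
- apply: (near_eq_is_derive (f := cst 0)).
    near=> y; rewrite flat_le0//; apply: ltW; near: y; exact: lt_nbhsl.
  by rewrite !flat_le0 ?ltW// mulr0 subr0; exact: is_derive_cst.
- have h : is_derive x (1 : R^o) (fun y : R^o => (y^-1) ^+ m * expR (- y^-1) : R^o)
      (flat m.+2 x - m%:R * flat m.+1 x).
    have x0' : x != 0 by rewrite gt_eqF.
    have dinv : is_derive x (1 : R^o) (fun y : R^o => y^-1 : R^o) (- x ^- 2).
      apply: DeriveDef; first exact: derivableV.
      by rewrite deriveV// derive_id scaler1.
    have dN : is_derive x (1 : R^o) (fun y : R^o => - y^-1 : R^o) (x ^- 2).
      by rewrite -[x ^- 2]opprK; exact: is_deriveN.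
    have dX : is_derive x (1 : R^o) (fun y : R^o => (y^-1) ^+ m : R^o)
        (- m%:R * x^-1 ^+ m.+1).
      rewrite (_ : (fun y : R^o => (y^-1) ^+ m : R^o) =
                   ((fun y : R^o => y^-1) : R^o -> R) ^+ m); last first.
        by apply/funext => y; rewrite exprfctE.
      apply: is_derive_eq; rewrite /GRing.scale/= -exprVn.
      case: m => [|m] /=; first by rewrite oppr0 !mul0r.
      by rewrite [in RHS]exprS [in RHS]exprS expr2; ring.
    have dE : is_derive x (1 : R^o) (fun y : R^o => expR (- y^-1) : R^o)
        (expR (- x^-1) * x ^- 2).
      exact: (@is_derive1_comp _ expR (fun y => - y^-1)).
    have := is_deriveM dX dE.
    move=> /is_derive_eq; apply.
    rewrite /flat x0 /GRing.scale/= -exprVn expr2 !exprS.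
    by set y := x^-1; set z := y ^+ m; ring.
  apply: near_eq_is_derive h.
  by near=> y; rewrite /flat ifT//; near: y; exact: lt_nbhsr.
- rewrite x0 !flat_le0// mulr0 subr0.
  apply: is_derive_eq; last reflexivity.
  have H : (h^-1 *: (flat m (h *: 1 + 0) - flat m 0)) @[h --> 0^'] --> (0 : R^o).
    apply/cvgr0Pnorm_le => e e0; near=> h.
    rewrite [flat m 0]flat_le0// subr0 addr0.
    have -> : h *: (1 : R^o) = h by rewrite [LHS]mulr1.
    have [h0|h0] := leP h 0; first by rewrite flat_le0// scaler0 normr0 ltW.
    (* The difference quotient at 0 is the next member of the family, and the linear bound [flat_le]
       makes it tend to 0. *)
    have -> : h^-1 *: flat m h = flat m.+1 h.
      by rewrite /flat h0 exprS -mulrA.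
    rewrite ger0_norm ?flat_ge0// (le_trans (flat_le _ h0))//.
    rewrite -ler_pdivlMl ?ltr0n ?fact_gt0//.
    rewrite -[h]gtr0_norm//; near: h; apply: dnbhs0_le.
    by rewrite mulr_gt0// invr_gt0 ltr0n fact_gt0.
  by apply: DeriveDef; [apply/cvg_ex; exists 0|exact/cvg_lim].
Unshelve. all: by end_near. Qed.

Lemma smooth_flat m : smooth_open setT (flat m).
Proof.
have df m' x : differentiable (flat m') x.
  by apply/derivable1_diffP; have [] := is_derive_flat m' x.
move=> k; elim: k m => [|k IH] m.
  by move=> x _; exact: differentiable_continuous.
split=> [x _|v] //.
apply: (@Ck_eq _ _ _ _ _ (fun x => cst v x *:
    (flat m.+2 x + cst (- m%:R) x *: flat m.+1 x))); first exact: openT.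
  move=> x _; rewrite derive_scale1//; congr (_ *: _).
  by have [_ ->] := is_derive_flat m x; rewrite /GRing.scale/= mulNr.
apply: CkZ; [exact: openT|exact: Ck_cst|].
apply: (@CkD _ _ _ _ _ (flat m.+2) (fun x => cst (- m%:R) x *: flat m.+1 x)).
- exact: openT.
- exact: IH.
by apply: CkZ; [exact: openT|exact: Ck_cst|exact: IH].
Qed.

Lemma smooth_inv : smooth_open [set x : R^o | x != 0] (GRing.inv : R^o -> R^o).
Proof.
have oN : open [set x : R^o | x != 0].
  exact: open_neq.
elim=> [|k IH]; first by move=> x /= x0; exact: inv_continuous.
split=> [x /= x0|v]; first exact: differentiable_Rinv.
apply: (@Ck_eq _ _ _ _ _ (fun x : R^o => cst (- v : R^o) x *: (x^-1 *: (x^-1 : R^o)))) => //.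
  move=> x /= x0; rewrite deriveE; last exact: differentiable_Rinv.
  by rewrite diff_Rinv// /GRing.scale/= -exprVn expr2 mulNr mulNr mulrC.
by apply: CkZ => //; [exact: Ck_cst|exact: (CkZ oN IH IH)].
Qed.

(** The usual smooth transition from 0 on x <= 0 to 1 on x >= 1; the two constant stretches are what
    lets a reparametrised isotopy rest near a junction. *)
Definition step (x : R^o) : R^o :=
  flat 0 x *: (flat 0 x + flat 0 (1 - x))^-1.

Lemma step_denom_gt0 (x : R) : 0 < flat 0 x + flat 0 (1 - x).
Proof.
have [x0|x0] := ltP 0 x; first by rewrite ltr_pwDl ?flat_gt0// flat_ge0.
by rewrite ltr_wpDl ?flat_ge0// flat_gt0// subr_gt0 (le_lt_trans x0).
Qed.

Lemma smooth_affine (a d : R) :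
  smooth_open setT (fun x : R^o => a + d * x : R^o).
Proof.
move=> k; apply: (@CkD _ _ _ _ _ (cst a) (fun x : R^o => cst (d : R^o) x *: x));
  [exact: openT|exact: Ck_cst|].
apply: CkZ; [exact: openT|exact: Ck_cst|].
by apply: (@Ck_linear _ _ _ _ _ (idfun : {linear R^o -> R^o})) => x; exact: cvg_id.
Qed.

Lemma smooth_step : smooth_open setT step.
Proof.
have s1 : smooth_open setT (fun x : R^o => flat 0 (1 - x)).
  apply: (@smooth_open_comp _ _ _ _ _ setT (fun x : R^o => 1 - x : R^o)).
  - exact: has_coordinates_R.
  - exact: openT.
  - exact: openT.
  - by [].
  - rewrite (_ : (fun _ => _) = (fun x : R^o => 1 + -1 * x : R^o)); last first.
      by apply/funext => x; rewrite mulN1r.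
    exact: smooth_affine.
  - exact: smooth_flat.
move=> k; apply: CkZ; [exact: openT|exact: smooth_flat|].
apply: (@Ck_comp _ _ _ _ k setT [set x : R^o | x != 0]
  (fun x : R^o => flat 0 x + flat 0 (1 - x) : R^o) (GRing.inv : R^o -> R^o)).
- exact: has_coordinates_R.
- exact: openT.
- exact: open_neq.
- by move=> x _ /=; rewrite gt_eqF// step_denom_gt0.
- by apply: CkD; [exact: openT|exact: smooth_flat|exact: s1].
- exact: smooth_inv.
Qed.

Lemma step_le0 x : x <= 0 -> step x = 0.
Proof. by move=> x0; rewrite /step flat_le0// scale0r. Qed.

Lemma step_ge1 x : 1 <= x -> step x = 1.
Proof.
move=> x1; rewrite /step [flat 0 (1 - x)]flat_le0 ?subr_le0// addr0.
by rewrite [LHS]mulfV// gt_eqF// flat_gt0// (lt_le_trans ltr01).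
Qed.

Lemma flat_ndecr (x y : R) : x <= y -> flat 0 x <= flat 0 y.
Proof.
move=> xy; have [x0|x0] := leP x 0; first by rewrite flat_le0// flat_ge0.
have y0 : 0 < y by rewrite (lt_le_trans x0).
by rewrite /flat x0 y0 !expr0 !mul1r ler_expR lerN2 lef_pV2.
Qed.

Lemma step_ndecr (x y : R) : x <= y -> step x <= step y.
Proof.
move=> xy; rewrite /step /GRing.scale/=.
(* After cross-multiplication a common product cancels, and only the monotonicity of [flat 0]
   remains. *)
rewrite ler_pdivrMr ?step_denom_gt0// mulrAC ler_pdivlMr ?step_denom_gt0//.
rewrite !mulrDr lerD ?[_ * flat 0 y]mulrC//.
apply: ler_pM; rewrite ?flat_ge0 ?flat_ndecr//.
by rewrite lerD2l lerN2.
Qed.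

Lemma step_ge0 x : 0 <= step x.
Proof.
by have [x0|x0] := leP x 0; [rewrite step_le0|rewrite -(step_le0 (lexx 0)) step_ndecr// ltW].
Qed.

Lemma step_le1 x : step x <= 1.
Proof.
by have [x0|x0] := leP 1 x; [rewrite step_ge1|rewrite -(step_ge1 (lexx 1)) step_ndecr// ltW].
Qed.

End SmoothStep.

(** * Smooth families on a manifold *)

Section ManifoldBasics.
Context {R : realType} {m : nat} {M : closedManifold R m}.
Local Notation E := 'rV[R]_m.
Implicit Types (i j l : chart_index M) (x y : M).

Lemma imgP i (v : E) : (chart i @` dom i) v ->
  dom i (chart_inv i v) /\ chart i (chart_inv i v) = v.
Proof. by move=> [x xi <-]; rewrite chartK. Qed.

Lemma nbhs_dom i x : dom i x -> nbhs x (dom i).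
Proof. by move=> xi; apply: open_nbhs_nbhs; split=> //; exact: dom_open. Qed.

Lemma img_chart i x : dom i x -> (chart i @` dom i) (chart i x).
Proof. by move=> xi; exists x. Qed.

Lemma nbhs_img i (v : E) : (chart i @` dom i) v -> nbhs v (chart i @` dom i).
Proof. by move=> vi; apply: open_nbhs_nbhs; split=> //; exact: chart_image_open. Qed.

Lemma chart_cvg i x : dom i x -> chart i @ x --> chart i x.
Proof. exact: chart_continuous. Qed.

Lemma chart_inv_cvg i x : dom i x -> chart_inv i @ chart i x --> x.
Proof.
move=> xi; have := @chart_inv_continuous _ _ _ i _ (img_chart xi).
by rewrite /prop_for /continuous_at chartK.
Qed.

Lemma nbhs_chart_inv i x (A : set M) : dom i x -> nbhs x A ->
  \forall v \near chart i x, (chart i @` dom i) v /\ A (chart_inv i v).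
Proof.
move=> xi xA; near=> v; split; near: v; first exact: nbhs_img (img_chart xi).
exact: (chart_inv_cvg xi xA).
Unshelve. all: by end_near. Qed.

(** The representative of a composite factors through two representatives only where a single chart
    contains the intermediate points, so the claim is localised around each x. *)
Lemma smooth_map_comp (phi psi : M -> M) :
  smooth_map phi -> smooth_map psi -> smooth_map (psi \o phi).
Proof.
move=> [cphi sphi] [cpsi spsi]; split=> [x|i j].
  by apply: continuous_comp; [exact: cphi|exact: cpsi].
apply: smooth_on_local => _ [x [xi xj] <-].
pose l := chart_at (phi x).
exists [set v | (chart i @` dom i) v /\ dom l (phi (chart_inv i v))].
  apply: (@nbhs_chart_inv i x (phi @^-1` dom l)) => //.
  by apply: cphi; apply: nbhs_dom; exact: chart_at_dom.
set A := _ `&` _.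
have AP v : A v -> [/\ dom i (chart_inv i v), dom l (phi (chart_inv i v)),
    dom j (psi (phi (chart_inv i v))) & chart i (chart_inv i v) = v].
  by move=> [[y [yi yj] <-] [_ yl]]; rewrite chartK// in yl *.
apply: (@smooth_on_eq _ _ _ _ (local_rep l j psi \o local_rep i l phi)).
  by move=> v /AP[vi vl vj vK]; rewrite /local_rep /= chartK.
apply: (smooth_on_comp (B := chart l @` (dom l `&` psi @^-1` dom j))).
- exact: has_coordinates_rV.
- move=> v /AP[vi vl vj vK]; rewrite /local_rep /=; exists (phi (chart_inv i v)) => //.
- apply: smooth_on_sub (sphi i l) => v /AP[vi vl vj vK].
  by exists (chart_inv i v).
- exact: spsi.
Qed.

Lemma smooth_fun_comp (phi : M -> M) (f : M -> R) :
  smooth_map phi -> smooth_fun f -> smooth_fun (f \o phi).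
Proof.
move=> [cphi sphi] sf i.
apply: smooth_on_local => _ [x xi <-].
pose l := chart_at (phi x).
exists [set v | (chart i @` dom i) v /\ dom l (phi (chart_inv i v))].
  apply: (@nbhs_chart_inv i x (phi @^-1` dom l)) => //.
  by apply: cphi; apply: nbhs_dom; exact: chart_at_dom.
set A := _ `&` _.
have AP v : A v -> [/\ dom i (chart_inv i v), dom l (phi (chart_inv i v))
    & chart i (chart_inv i v) = v].
  by move=> [[y yi <-] [_ yl]]; rewrite chartK// in yl *.
apply: (@smooth_on_eq _ _ _ _ ((f \o chart_inv l : E -> R^o) \o local_rep i l phi)).
  by move=> v /AP[vi vl vK]; rewrite /local_rep /= chartK.
apply: (smooth_on_comp (B := chart l @` dom l)).
- exact: has_coordinates_rV.
- move=> v /AP[vi vl vK]; exact: img_chart.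
- apply: smooth_on_sub (sphi i l) => v /AP[vi vl vK].
  by exists (chart_inv i v).
- exact: sf.
Qed.

Lemma smooth_funD (f g : M -> R) :
  smooth_fun f -> smooth_fun g -> smooth_fun (f \+ g).
Proof. by move=> sf sg i; exact: smooth_onD (sf i) (sg i). Qed.

Lemma smooth_funN (f : M -> R) : smooth_fun f -> smooth_fun (fun x => - f x).
Proof.
move=> sf i.
pose L : {linear R^o -> R^o} := -%R.
apply: (@smooth_on_eq _ _ _ _ (L \o (f \o chart_inv i : E -> R^o))) => //.
apply: smooth_on_linear_comp (sf i); exact: opp_continuous.
Qed.

Lemma smooth_fun_continuous (f : M -> R) : smooth_fun f -> continuous f.
Proof.
move=> sf x; pose i := chart_at x.
have xi : dom i x := chart_at_dom x.
have cf := smooth_on_open_continuous (sf i) (nbhs_img (img_chart xi)).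
have : (f \o chart_inv i) \o chart i @ x --> f x.
  move: cf; rewrite /prop_for /continuous_at /= chartK// => cf.
  exact: (cvg_comp _ _ (chart_cvg xi) cf).
apply: cvg_trans; apply: near_eq_cvg; have := nbhs_dom xi.
by apply: filterS => y yi /=; rewrite chartK.
Qed.

Lemma continuous_familyP (T : topologicalType) (F : R -> M -> T) :
  continuous_family F <-> forall t x (U : set T), t \in `[0, 1] ->
    nbhs (F t x) U -> \forall p \near (t, x), p.1 \in `[0, 1] -> U (F p.1 p.2).
Proof.
split=> [/subspace_continuousP cF t x U t01 UF|cF].
  have : \forall p \near within (`[0, 1] `*` [set: M]) (nbhs (t, x)),
    U (F p.1 p.2) := cF (t, x) (conj t01 I) U UF.
  by rewrite near_withinE; apply: filterS => -[s y] /= h s01; apply: h.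
apply/subspace_continuousP => -[t x] [/= t01 _] U UF.
have h := cF t x U t01 UF.
suff : \forall p \near within (`[0, 1] `*` [set: M]) (nbhs (t, x)),
    U (F p.1 p.2) by [].
by rewrite near_withinE; apply: filterS h => -[s y] /= h [s01 _]; exact: h.
Qed.

Lemma continuous_family_at (T : topologicalType) (F : R -> M -> T) t :
  continuous_family F -> t \in `[0, 1] -> continuous (F t).
Proof.
move=> /continuous_familyP cF t01 x U /(cF t x U t01)[[A B] /= [tA xB] AB].
apply: filterS xB => y By; apply: (AB (t, y)) => //; split=> //=.
exact: nbhs_singleton.
Qed.

Lemma continuous_family_cst (T : topologicalType) (f : M -> T) :
  continuous f -> continuous_family (fun=> f).
Proof.
move=> cf; apply/continuous_familyP => t x U _ Uf.
have h : (f \o snd) p @[p --> (t, x)] --> f x.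
  exact: (cvg_comp snd f cvg_snd (cf x)).
near=> p => _; near: p; exact: (h U Uf).
Unshelve. all: by end_near. Qed.

Lemma continuous_family_comp (T : topologicalType) (F : R -> M -> T) (G : R -> M -> M) :
  continuous_family F -> continuous_family G ->
  continuous_family (fun t x => F t (G t x)).
Proof.
move=> /continuous_familyP cF /continuous_familyP cG.
apply/continuous_familyP => t x U t01 UF.
have [[A B] /= [tA GB] AB] := cF t (G t x) U t01 UF.
have xB := cG t x B t01 GB.
near=> p => p01; apply: (AB (p.1, G p.1 p.2)) => //; split=> /=.
  by near: p; exact: (cvg_fst tA).
by move: p01; near: p; exact: xB.
Unshelve. all: by end_near. Qed.

Lemma continuous_family_reparam (T : topologicalType) (F : R -> M -> T) (tau : R -> R) :
  continuous_family F -> continuous tau ->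
  (forall t, t \in `[0, 1] -> tau t \in `[0, 1]) ->
  continuous_family (fun t x => F (tau t) x).
Proof.
move=> /continuous_familyP cF ctau t01; apply/continuous_familyP => t x U tI UF.
have [[A B] /= [tA xB] AB] := cF (tau t) x U (t01 _ tI) UF.
near=> p => pI; apply: (AB (tau p.1, p.2)) => /=; last exact: t01.
split; near: p; last exact: (cvg_snd xB).
have : (tau \o fst) p @[p --> (t, x)] --> tau t.
  by apply: continuous_comp; [exact: cvg_fst|exact: ctau].
by move=> /(_ A tA).
Unshelve. all: by end_near. Qed.

Lemma smooth_family_cst (phi : M -> M) : smooth_map phi -> smooth_family (fun=> phi).
Proof.
move=> [cphi sphi]; split; first exact: continuous_family_cst.
move=> i j.
pose sn : {linear (R^o * E)%type -> E} := snd.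
apply: (@smooth_on_comp _ _ _ _ _ _ snd (local_rep i j phi)).
- exact: has_coordinates_rV.
- by move=> p [_]; exact.
- by apply: (@smooth_on_linear _ _ _ _ sn) => p; exact: cvg_snd.
- exact: sphi.
Qed.

Lemma smooth_family_reparam (Phi : R -> M -> M) (tau : R^o -> R^o) :
  smooth_family Phi -> smooth_open setT tau ->
  (forall t, t \in `[0, 1] -> tau t \in `[0, 1]) ->
  smooth_family (fun t => Phi (tau t)).
Proof.
move=> [cPhi sPhi] stau t01; split.
  apply: continuous_family_reparam => // t; exact: smooth_open_continuous stau I.
move=> i j.
pose sn : {linear (R^o * E)%type -> E} := snd.
pose fs : {linear (R^o * E)%type -> R^o} := fst.
apply: (@smooth_on_comp _ _ _ _ _ _ (fun p : R^o * E => (tau p.1, p.2)) _ _ _ _ (sPhi i j)).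
- exact: has_coordinates_pair has_coordinates_R (has_coordinates_rV _).
- by move=> p [/= /t01 ? ?]; split.
- apply: smooth_on_pair.
    apply: (smooth_on_comp (f := fs) (g := tau) (B := setT)) => //.
    + exact: has_coordinates_R.
    + by apply: smooth_on_linear => p; exact: cvg_fst.
    + by apply: smooth_open_on stau; exact: openT.
  by apply: (smooth_on_linear (L := sn)) => p; exact: cvg_snd.
Qed.

Lemma smooth_family_comp (Phi Psi : R -> M -> M) :
  smooth_family Phi -> smooth_family Psi ->
  smooth_family (fun t => Psi t \o Phi t).
Proof.
move=> [cphi sphi] [cpsi spsi]; split.
  exact: (continuous_family_comp cpsi cphi).
move=> i j; apply: smooth_on_local => -[t v] /= [t01 [x [xi xj] xv]].
rewrite -{}xv {v}.
pose l := chart_at (Phi t x).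
pose fs : {linear (R^o * E)%type -> R^o} := fst.
(* The condition on the intermediate point is conditional on the time: nothing is known about Phi
   outside [0,1], while this set has to be a neighbourhood in all of R x E. *)
exists [set p : R^o * E | (chart i @` dom i) p.2 /\
    (p.1 \in `[0, 1] -> dom l (Phi p.1 (chart_inv i p.2)))].
  have lx : nbhs (Phi t x) (dom l) by apply: nbhs_dom; exact: chart_at_dom.
  have [[A B] /= [tA xB] AB] := (continuous_familyP Phi).1 cphi t x _ t01 lx.
  near=> p; split.
    by near: p; apply: (cvg_snd (nbhs_img (img_chart xi))).
  move=> p01; apply: (AB (p.1, chart_inv i p.2)) => //; split=> /=.
    by near: p; exact: (cvg_fst tA).
  near: p.
  have : (chart_inv i \o snd) p @[p --> (t : R^o, chart i x)] --> x.
    apply: (cvg_comp snd _ cvg_snd).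
    exact: chart_inv_cvg.
  by move=> /(_ B xB).
set A := _ `&` _.
have AP p : A p -> [/\ p.1 \in `[0, 1], dom i (chart_inv i p.2),
   dom l (Phi p.1 (chart_inv i p.2)), dom j (Psi p.1 (Phi p.1 (chart_inv i p.2))) &
   chart i (chart_inv i p.2) = p.2].
  case: p => s v [/= [s01 [y [yi yj] yv]] [_ yl]].
  by rewrite -yv chartK//; split=> //; have := yl s01; rewrite -yv chartK.
apply: (@smooth_on_eq _ _ _ _ ((fun q : R^o * E => local_rep l j (Psi q.1) q.2) \o
    (fun p : R^o * E => (p.1, local_rep i l (Phi p.1) p.2)))).
  by move=> p /AP[p01 vi vl vj vK]; rewrite /local_rep /= chartK.
apply: (@smooth_on_comp _ _ _ _ _ _ _ _ _ _ _ (spsi l j)).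
- exact: has_coordinates_pair has_coordinates_R (has_coordinates_rV _).
- move=> p /AP[p01 vi vl vj vK] /=; split=> //; exists (Phi p.1 (chart_inv i p.2)) => //.
- apply: smooth_on_pair.
    by apply: (smooth_on_linear (L := fs)) => p; exact: cvg_fst.
  apply: smooth_on_sub (sphi i l) => p /AP[p01 vi vl vj vK] /=.
  by split=> //; exists (chart_inv i p.2).
Unshelve. all: by end_near. Qed.

Lemma smooth_on_differentiable (V W : normedModType R) (A : set V) (f : V -> W) (x : V) :
  smooth_on A f -> nbhs x A -> differentiable f x.
Proof.
move=> fA nA; have [D1 [oD1 D1x [f1 f1C ff1]]] := fA x (nbhs_singleton nA).
apply: near_eq_differentiable (smooth_open_differentiable f1C D1x).
have : nbhs x D1 by exact: open_nbhs_nbhs.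
by apply: filterS2 nA => y Ay Dy; rewrite ff1.
Qed.

Lemma nbhs_local_dom i j (phi : M -> M) x : continuous phi ->
  dom i x -> dom j (phi x) ->
  nbhs (chart i x) (chart i @` (dom i `&` phi @^-1` dom j)).
Proof.
move=> cphi xi xj.
have : \forall v \near chart i x, (chart i @` dom i) v /\ (phi @^-1` dom j) (chart_inv i v).
  by apply: nbhs_chart_inv => //; apply: cphi; exact: nbhs_dom.
apply: filterS => v [vi vj]; have [vi' vK] := imgP vi.
by exists (chart_inv i v).
Qed.

Lemma local_rep_differentiable i j (phi : M -> M) x : smooth_map phi ->
  dom i x -> dom j (phi x) -> differentiable (local_rep i j phi) (chart i x).
Proof.
move=> [cphi sphi] xi xj; apply: smooth_on_differentiable (sphi i j) _.
exact: nbhs_local_dom.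
Qed.

End ManifoldBasics.

(** * Composition and inversion of homeomorphisms and contactomorphisms *)

Section Homeo.
Context {T : topologicalType}.

(** The inverse is determined by the map, and the remaining fields are proofs. *)
Lemma homeo_eq (phi psi : homeo T) : (forall x, phi x = psi x) -> phi = psi.
Proof.
case: phi psi => f f' cf cf' fK f'K [g g' cg cg' gK g'K] /= fg.
have e : f = g by apply/funext.
have e' : f' = g' by apply/funext => x; rewrite -{1}(g'K x) -e fK.
by subst g g'; congr Homeo; exact: Prop_irrelevance.
Qed.

Definition homeo_comp (phi psi : homeo T) : homeo T :=
  @Homeo T (phi \o psi) (hinv psi \o hinv phi)
    (fun x => continuous_comp (@hfun_continuous _ psi x) (@hfun_continuous _ phi _))
    (fun x => continuous_comp (@hinv_continuous _ phi x) (@hinv_continuous _ psi _))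
    (can_comp (@hfunK _ phi) (@hfunK _ psi))
    (can_comp (@hinvK _ psi) (@hinvK _ phi)).

Definition homeo_inv (phi : homeo T) : homeo T :=
  Homeo (@hinv_continuous _ phi) (@hfun_continuous _ phi)
    (@hinvK _ phi) (@hfunK _ phi).

End Homeo.

Section Contactomorphisms.
Context {R : realType} {n : nat} {M : closedManifold R n.*2.+1}.
Variable alpha : contactForm M.
Local Notation E := 'rV[R]_(n.*2.+1).
Implicit Types (i j l : chart_index M) (x y : M).

Lemma pairingZ (a v : E) (c : R) : pairing a (c *: v) = c * pairing a v.
Proof.
by rewrite /pairing mulr_sumr; apply: eq_bigr => k _; rewrite mxE mulrCA.
Qed.

(** Near [chart i x] the representative of the composite factors through the chart l, and the chain
    rule applies. *)
Lemma derive_local_rep_comp i j l (phi psi : M -> M) x v :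
  smooth_map phi -> smooth_map psi ->
  dom i x -> dom l (phi x) -> dom j (psi (phi x)) ->
  'D_v (local_rep i j (psi \o phi)) (chart i x) =
  'D_('D_v (local_rep i l phi) (chart i x)) (local_rep l j psi) (chart l (phi x)).
Proof.
move=> sphi spsi xi xl xj.
have d1 := local_rep_differentiable sphi xi xl.
have d2 := local_rep_differentiable spsi xl xj.
have e : local_rep i l phi (chart i x) = chart l (phi x) by rewrite /local_rep /= chartK.
transitivity ('D_v (local_rep l j psi \o local_rep i l phi) (chart i x)).
  apply: near_eq_derive; have [cphi _] := sphi.
  have : \forall v \near chart i x, (chart i @` dom i) v /\ (phi @^-1` dom l) (chart_inv i v).
    by apply: nbhs_chart_inv => //; apply: cphi; exact: nbhs_dom.
  apply: filterS => u [ui ul]; have [ui' uK] := imgP ui.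
  by rewrite /local_rep /= chartK.
rewrite -e in d2 *.
rewrite (deriveE v (differentiable_comp d1 d2)) (diff_comp d1 d2) /=.
by rewrite [RHS](deriveE _ d2) (deriveE v d1).
Qed.

Lemma contactomorphism_comp (phi psi : homeo M) (f g : M -> R) :
  contactomorphism alpha phi f -> contactomorphism alpha psi g ->
  contactomorphism alpha (homeo_comp psi phi) (fun x => g (phi x) + f x).
Proof.
move=> [sphi siphi sf ef] [spsi sipsi sg eg]; split.
- exact: smooth_map_comp.
- exact: smooth_map_comp.
- by apply: smooth_funD => //; exact: smooth_fun_comp.
move=> i j x xi xj v; have xl := chart_at_dom (phi x).
rewrite (derive_local_rep_comp v sphi spsi xi xl xj) /=.
by rewrite eg// ef// expRD mulrA.
Qed.

Lemma local_rep_id i x v : dom i x -> 'D_v (local_rep i i idfun) (chart i x) = v.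
Proof.
move=> xi; rewrite -[RHS](derive_id (chart i x) v); apply: near_eq_derive.
apply: filterS (nbhs_img (img_chart xi)) => u ui.
by have [ui' uK] := imgP ui; rewrite /local_rep /=.
Qed.

Lemma contactomorphism_inv (phi : homeo M) (f : M -> R) :
  contactomorphism alpha phi f ->
  contactomorphism alpha (homeo_inv phi) (fun y => - f (hinv phi y)).
Proof.
move=> [sphi siphi sf ef]; split=> //.
  by apply: smooth_funN; exact: (smooth_fun_comp siphi sf).
move=> j i y yj yi v /=.
set x := hinv phi y in yi *; have yx : y = phi x by rewrite /x hinvK.
set w := 'D_v _ _.
have yj' : dom j (phi x) by rewrite -yx.
(* The equation of phi at x is applied to the image w of v under the derivative of the inverse; the
   derivative of phi sends w back to v. *)
have := ef i j x yi yj' w.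
have -> : 'D_w (local_rep i j phi) (chart i x) = v.
  rewrite /w /x -(@derive_local_rep_comp j j i (hinv phi) phi y v)//.
  rewrite (_ : _ \o _ = idfun) ?local_rep_id//.
  by apply/funext => z /=; rewrite hinvK.
by rewrite -yx => ->; rewrite expRN mulKf// gt_eqF// expR_gt0.
Qed.

Lemma has_velocity_near (c1 c2 : R -> E) t v :
  (\forall s \near t, s \in `[0, 1] -> c1 s = c2 s) -> t \in `[0, 1] ->
  has_velocity c1 t v -> has_velocity c2 t v.
Proof.
move=> c12 t01; rewrite /has_velocity; apply: cvg_trans.
have e := nbhs_singleton c12 t01.
apply: near_eq_cvg; rewrite near_withinE; apply: nbhs_dnbhs.
by apply: filterS c12 => s h s01; rewrite e h.
Qed.

Lemma has_velocity_reparam (c : R -> E) (tau : R^o -> R^o) t v :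
  derivable tau t 1 -> (forall s, s \in `[0, 1] -> tau s \in `[0, 1]) ->
  t \in `[0, 1] -> has_velocity c (tau t) v ->
  has_velocity (c \o tau) t ('D_1 tau t *: v).
Proof.
move=> dtau tau01 t01 cv.
(* The difference quotient of c, completed by its limit v: tau may return to the value tau t at
   nearby times, where the plain quotient would divide by 0. *)
pose w u := if u == tau t then v else (u - tau t)^-1 *: (c u - c (tau t)).
have cw u : c u - c (tau t) = (u - tau t) *: w u.
  rewrite /w; case: eqP => [->|/eqP ut]; first by rewrite !subrr scale0r.
  by rewrite scalerA mulfV ?scale1r// subr_eq0.
have wv (e : R) : 0 < e -> \forall u \near tau t, u \in `[0, 1] -> `|v - w u| < e.
  move=> e0; move/cvgrPdist_lt : cv => /(_ e e0).
  rewrite near_withinE /dnbhs near_withinE; apply: filterS => u h u01.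
  rewrite /w; case: eqP => [_|/eqP ut]; first by rewrite subrr normr0.
  exact: h.
rewrite /has_velocity.
have -> : (fun s => (s - t)^-1 *: ((c \o tau) s - (c \o tau) t)) =
          (fun s => ((s - t)^-1 * (tau s - tau t)) *: w (tau s)).
  by apply/funext => s; rewrite /= cw scalerA.
apply: cvgZ; apply/cvgrPdist_lt => e e0; rewrite near_withinE.
  have H : \forall h \near (0 : R), h != 0 ->
      `|'D_1 tau t - h^-1 *: (tau (h *: 1 + t) - tau t)| < e.
    have /cvgrPdist_lt/(_ e e0) : (h^-1 *: (tau (h *: 1 + t) - tau t)) @[h --> 0^'] --> 'D_1 tau t.
      exact: dtau.
    by rewrite /dnbhs near_withinE.
  move: H; rewrite (near_shift t) sub0r /dnbhs near_withinE; apply: filterS => s /= h st s01.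
  have := h; rewrite subr_eq0 => /(_ st).
  by rewrite (_ : (s - t) *: (1 : R^o) = s - t) ?subrK// [LHS]mulr1.
apply: nbhs_dnbhs.
have ctau : tau @ t --> tau t by apply: differentiable_continuous; exact/derivable1_diffP.
have H : \forall s \near t, tau s \in `[0, 1] -> `|v - w (tau s)| < e := ctau _ (wv e e0).
by near=> s => s01; have := tau01 s s01; near: s.
Unshelve. all: by end_near. Qed.

End Contactomorphisms.

(** * Reparametrised and concatenated contact isotopies *)

Section SegmentsDef.
Context {R : realType} {m : nat} {M : closedManifold R m}.
Implicit Types (P Q : R -> homeo M) (H h K k : R -> M -> R) (tau : R^o -> R^o).

(** The right factor makes the piece of P start at the identity. *)
Definition seg_iso P tau : R -> homeo M :=
  fun s => homeo_comp (P (tau s)) (homeo_inv (P (tau 0))).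

Definition seg_ham H tau : R -> M -> R := fun s x => 'D_1 tau s * H (tau s) x.

(** The cocycle rule for conformal factors, applied to P (tau s) after the inverse of P (tau 0). *)
Definition seg_conf P h tau : R -> M -> R := fun s x =>
  h (tau s) (hinv (P (tau 0)) x) - h (tau 0) (hinv (P (tau 0)) x).

Definition cat_iso P Q : R -> homeo M := fun s => homeo_comp (P s) (Q s).

(** For general isotopies K would have to be transported by P and rescaled by its conformal factor;
    the plain sum is right when at every time one of the two is at rest, as in [time_disjoint]. *)
Definition cat_ham H K : R -> M -> R := fun s x => H s x + K s x.

Definition cat_conf h Q k : R -> M -> R := fun s x => h s (Q s x) + k s x.

End SegmentsDef.

Section Segments.
Context {R : realType} {n : nat} {M : closedManifold R n.*2.+1}.
Variable alpha : contactForm M.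
Local Notation E := 'rV[R]_(n.*2.+1).
Implicit Types (P Q : R -> homeo M) (H h K k : R -> M -> R) (tau : R^o -> R^o).

(* Right translation by a fixed diffeomorphism does not change the Hamiltonian:
   this is why no pulled back Hamiltonian occurs in [seg_ham]. *)
Lemma smooth_seg P H h tau : smooth_contact_system alpha P H h ->
  smooth_open setT tau -> (forall t, t \in `[0, 1] -> tau t \in `[0, 1]) ->
  smooth_contact_system alpha (seg_iso P tau) (seg_ham H tau) (seg_conf P h tau).
Proof.
move=> [sP P0 cP vP] stau tau01.
have I0 : (0 : R) \in `[0, 1] by rewrite in_itv /= lexx ler01.
have [s0 s0' _ _] := cP _ (tau01 _ I0).
split.
- apply: (smooth_family_comp (smooth_family_cst s0')).
  exact: (@smooth_family_reparam _ _ _ (fun t x => P t x) tau).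
- by apply/funext => x /=; rewrite hinvK.
- move=> t t01; have := contactomorphism_comp (contactomorphism_inv (cP _ (tau01 _ I0))) (cP _ (tau01 _ t01)).
  exact.
- move=> t x j t01 xj /=.
  have [v cv Hv] := vP _ _ _ (tau01 _ t01) xj.
  exists ('D_1 tau t *: v); last by rewrite pairingZ -Hv.
  apply: (has_velocity_reparam (c := fun s => chart j (P s (hinv (P (tau 0)) x)))) => //.
  apply: diff_derivable; exact: smooth_open_differentiable stau I.
Qed.

(** The two cases are not symmetric. In the first P is the identity, so the composite moves as Q. In
    the second Q rests at a map that need not be the identity, and the composite is a right
    translate of P. *)
Definition time_disjoint P H Q K := forall t : R, t \in `[0, 1] ->
  ((\forall s \near t, s \in `[0, 1] -> forall x, P s x = x) /\ H t = cst 0) \/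
  ((\forall s \near t, s \in `[0, 1] -> forall x, Q s x = Q t x) /\ K t = cst 0).

Lemma smooth_cat P H h Q K k :
  smooth_contact_system alpha P H h -> smooth_contact_system alpha Q K k ->
  time_disjoint P H Q K ->
  smooth_contact_system alpha (cat_iso P Q) (cat_ham H K) (cat_conf h Q k).
Proof.
move=> [sP P0 cP vP] [sQ Q0 cQ vQ] PQ; split.
- exact: (smooth_family_comp sQ sP).
- by apply/funext => x /=; rewrite Q0 P0.
- by move=> t t01; exact: contactomorphism_comp (cQ t t01) (cP t t01).
- move=> t x j t01 xj; rewrite /cat_ham /=.
  have [[Pid ->]|[Qid ->]] := PQ t t01.
    have Pt y : P t y = y by apply: (nbhs_singleton Pid t01).
    rewrite /= Pt in xj *.
    have [v cv Kv] := vQ _ _ _ t01 xj; exists v; last by rewrite add0r.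
    apply: has_velocity_near cv => //.
    by apply: filterS Pid => s hs s01; rewrite hs.
  have [v cv Hv] := vP _ _ _ t01 xj; exists v; last by rewrite addr0.
  apply: has_velocity_near cv => //.
  by apply: filterS Qid => s hs s01; rewrite hs.
Qed.

End Segments.

(** * Joint continuity of Hamiltonians and conformal factors *)

Section FamilyFilters.
Context {R : realType} {m : nat} {M : closedManifold R m}.
Implicit Types (P : R -> homeo M) (x y : M) (t s : R).

Definition fam_nbhs t x : set_system (R * M) :=
  within (`[0, 1] `*` [set: M]) (nbhs (t, x)).

Global Instance fam_nbhs_filter t x : Filter (fam_nbhs t x).
Proof. exact: within_filter. Qed.

Lemma near_fam t x (A : set (R * M)) :
  (\forall p \near (t, x), p.1 \in `[0, 1] -> A p) <-> fam_nbhs t x A.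
Proof.
rewrite /fam_nbhs; split=> h.
  suff : \forall p \near within (`[0, 1] `*` [set: M]) (nbhs (t, x)), A p by [].
  by rewrite near_withinE; apply: filterS h => p /= h [p01 _]; exact: h.
have : \forall p \near within (`[0, 1] `*` [set: M]) (nbhs (t, x)), A p by [].
by rewrite near_withinE; apply: filterS => p h' p01; apply: h'.
Qed.

Lemma continuous_family_cvgP (T : topologicalType) (F : R -> M -> T) :
  continuous_family F <-> forall t x, t \in `[0, 1] ->
    F p.1 p.2 @[p --> fam_nbhs t x] --> F t x.
Proof.
split=> [/subspace_continuousP cF t x t01|cF].
  exact: (cF (t, x) (conj t01 I)).
by apply/subspace_continuousP => -[t x] [/= t01 _]; exact: cF.
Qed.

Lemma fam_nbhs_cvg1 t x : p.1 @[p --> fam_nbhs t x] --> t.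
Proof.
move=> A nA; apply/(near_fam t x (fst @^-1` A)); near=> p => _; near: p.
exact: (cvg_fst nA).
Unshelve. all: by end_near. Qed.

Lemma fam_nbhs_cvg2 t x : p.2 @[p --> fam_nbhs t x] --> x.
Proof.
move=> A nA; apply/(near_fam t x (snd @^-1` A)); near=> p => _; near: p.
exact: (cvg_snd nA).
Unshelve. all: by end_near. Qed.

Lemma fam_nbhs01 t x : \forall p \near fam_nbhs t x, p.1 \in `[0, 1].
Proof. by apply/(near_fam t x [set p | p.1 \in `[0, 1]]); near=> p.
Unshelve. all: by end_near. Qed.

(** Outside an open set V around the preimage x0, the map P t0 misses y0. By compactness of the
    complement of V this persists for all (t, y) near (t0, y0), which forces the preimage of y into
    V. *)
Lemma continuous_family_inv P : continuous_family P ->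
  continuous_family (fun t x => hinv (P t) x).
Proof.
move=> cP; apply/continuous_familyP => t0 y0 U t01 UF.
set x0 := hinv (P t0) y0 in UF *.
have [V [oV Vx VU]] : exists V, [/\ open V, V x0 & V `<=` U].
  by exists U°; split; [exact: open_interior|exact: UF|exact: interior_subset].
have cK : compact (~` V).
  by apply: (subclosed_compact _ (@manifold_compact _ _ M)) => //; rewrite closedC.
move/compact_near_coveringP : cK => /(_ _ (nbhs (t0, y0))
   (fun p z => p.1 \in `[0, 1] -> P p.1 z <> p.2) _) cov.
have : \forall p \near (t0, y0), ~` V `<=` (fun z => p.1 \in `[0, 1] -> P p.1 z <> p.2).
  apply: cov => z Vz.
  have zy : P t0 z != y0.
    by apply/eqP => zy; apply: Vz; have -> : z = x0 by rewrite /x0 -zy hfunK.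
  have := @manifold_hausdorff _ _ M; rewrite open_hausdorff => /(_ _ _ zy).
  move=> [[A B] /=]; rewrite !inE => -[Az By] [oA oB AB0].
  have nA : nbhs (P t0 z) A by exact: open_nbhs_nbhs.
  have nB : nbhs y0 B by exact: open_nbhs_nbhs.
  have [[T1 Z1] /= [tT zZ] TZ] := (continuous_familyP _).1 cP t0 z A t01 nA.
  exists (Z1, T1 `*` B); first by split=> //=; exists (T1, B).
  move=> [z' [t y]] /= [zZ' [/= tT' yB]] tI zy'.
  have : (A `&` B) y by split=> //; rewrite -zy'; exact: (TZ (t, z')).
  by move: AB0 => ->.
apply: filterS => -[t y] /= h tI; apply: VU; apply: contrapT => nV.
by apply: (h (hinv (P t) y) nV tI); rewrite hinvK.
Qed.

End FamilyFilters.

Section JointContinuity.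
Context {R : realType} {n : nat} {M : closedManifold R n.*2.+1}.
Variable alpha : contactForm M.
Local Notation E := 'rV[R]_(n.*2.+1).
Implicit Types (P Q : R -> homeo M) (H h : R -> M -> R).
Implicit Types (i j l : chart_index M) (x y : M) (t s : R).

Lemma cvg_pairing (T : Type) (F : set_system T) (a v : T -> E) (a0 v0 : E) :
  Filter F -> a @ F --> a0 -> v @ F --> v0 ->
  pairing (a p) (v p) @[p --> F] --> pairing a0 v0.
Proof.
move=> FF aa vv; rewrite /pairing.
apply: cvg_big => [|k _]; first exact: add_continuous.
have ca : (a p) 0 k @[p --> F] --> a0 0 k.
  exact: (cvg_comp a (fun w : E => w 0 k) aa (@coord_continuous _ _ _ 0 k a0)).
have cv : (v p) 0 k @[p --> F] --> v0 0 k.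
  exact: (cvg_comp v (fun w : E => w 0 k) vv (@coord_continuous _ _ _ 0 k v0)).
exact: cvgM.
Qed.

Lemma form_cvg j y : dom j y -> form alpha j @ chart j y --> form alpha j (chart j y).
Proof.
move=> yj; exact: (smooth_on_open_continuous (@form_smooth _ _ _ alpha j) (nbhs_img (img_chart yj))).
Qed.

(** Every term of [contact_density] contains a coefficient of the form, so the form cannot vanish at
    a point where the density does not. *)
Lemma form_neq0 i x : dom i x ->
  exists v, pairing (form alpha i (chart i x)) v != 0.
Proof.
move=> xi; have := @form_contact _ _ _ alpha i x xi; apply: contra_neqP => nv.
have a0 k : form alpha i (chart i x) 0 k = 0.
  have [//|nz] := eqVneq (form alpha i (chart i x) 0 k) 0.
  exfalso; apply: nv; exists (delta_mx 0 k).
  rewrite /pairing (bigD1 k)//= mxE !eqxx mulr1 big1 ?addr0// => q qk.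
  by rewrite mxE (negbTE qk) andbF mulr0.
rewrite /contact_density big1 ?mulr0// => s _.
by rewrite a0 mulr0 mul0r.
Qed.

(* Near a point of its domain, a smooth family is in charts the restriction of
   a smooth map defined on an open set of R x R^m. *)
Lemma smooth_family_ext (Phi : R -> M -> M) t0 x0 i j : smooth_family Phi ->
  t0 \in `[0, 1] -> dom i x0 -> dom j (Phi t0 x0) ->
  exists (U : set (R^o * E)) (G : R^o * E -> E),
   [/\ open U, U (t0, chart i x0), smooth_open U G &
     forall p, U p -> p.1 \in `[0, 1] -> [/\ (chart i @` dom i) p.2,
       dom j (Phi p.1 (chart_inv i p.2)) &
       G p = chart j (Phi p.1 (chart_inv i p.2))]].
Proof.
move=> [cPhi sPhi] t01 xi xj.
have [|U [oU Ux [G GU fG]]] := sPhi i j (t0, chart i x0).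
  by split=> //=; exists x0.
have nD : \forall p \near (t0 : R^o, chart i x0), p.1 \in `[0, 1] ->
    (chart i @` dom i) p.2 /\ dom j (Phi p.1 (chart_inv i p.2)).
  have [[A B] /= [tA xB] AB] := (continuous_familyP Phi).1 cPhi t0 x0 _ t01 (nbhs_dom xj).
  near=> p => p01; split.
    by near: p; apply: (cvg_snd (nbhs_img (img_chart xi))).
  apply: (AB (p.1, chart_inv i p.2)) => //; split=> /=.
    by near: p; exact: (cvg_fst tA).
  near: p; have : (chart_inv i \o snd) p @[p --> (t0 : R^o, chart i x0)] --> x0.
    apply: (cvg_comp snd _ cvg_snd); exact: chart_inv_cvg.
  by move=> /(_ B xB).
pose V := [set p : R^o * E | p.1 \in `[0, 1] ->
    (chart i @` dom i) p.2 /\ dom j (Phi p.1 (chart_inv i p.2))].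
exists (U `&` V°), G; split.
- by apply: openI => //; exact: open_interior.
- by split.
- by apply: smooth_open_sub GU => p [].
move=> p [Up Vp] p01; have [pi pj] := interior_subset Vp p01.
split=> //; rewrite -fG//; split=> //=.
by have [pi' pK] := imgP pi; exists (chart_inv i p.2).
Unshelve. all: by end_near. Qed.

Lemma nbhs_slice (U : set (R^o * E)) t (v : E) : open U -> U (t, v) ->
  (\forall u \near v, U (t, u)) /\ (\forall s \near t, U (s, v)).
Proof.
move=> oU Utv; have /= [[A B] /= [tA vB] AB] : nbhs (t : R^o, v) U by exact: open_nbhs_nbhs.
split; [apply: filterS vB => u Bu|apply: filterS tA => s As].
- by apply: AB; split => //=; exact: nbhs_singleton tA.
- by apply: AB; split => //=; exact: nbhs_singleton vB.
Qed.

Lemma derive_slice2 (G : R^o * E -> E) t (u v : E) :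
  'D_v (fun w => G (t, w)) u = 'D_(0, v) G (t, u).
Proof.
rewrite /derive.
have -> : (fun h : R => h^-1 *: ((G \o shift (t : R^o, u)) (h *: (0 : R^o, v)) - G (t, u))) =
  (fun h : R => h^-1 *: (((fun w => G (t, w)) \o shift u) (h *: v) - G (t, u))); last by [].
apply/funext => r; congr (_ *: (G _ - _)); congr pair => /=.
by rewrite scaler0 add0r.
Qed.

Lemma near_chart_fam t x i (U : set (R^o * E)) : dom i x -> open U -> U (t, chart i x) ->
  \forall p \near fam_nbhs t x, U (p.1, chart i p.2).
Proof.
move=> xi oU Ux.
have [[A B] /= [tA vB] AB] : nbhs (t : R^o, chart i x) U by exact: open_nbhs_nbhs.
have c : chart i p.2 @[p --> fam_nbhs t x] --> chart i x.
  exact: (cvg_comp _ _ (@fam_nbhs_cvg2 _ _ M t x) (chart_cvg xi)).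
near=> p; apply: AB; split=> /=; near: p.
  exact: (@fam_nbhs_cvg1 _ _ M t x _ tA).
exact: (c _ vB).
Unshelve. all: by end_near. Qed.

Lemma cvg_chart_fam t x i (W : normedModType R) (U : set (R^o * E)) (f : R^o * E -> W) :
  dom i x -> smooth_open U f -> U (t, chart i x) ->
  f (p.1, chart i p.2) @[p --> fam_nbhs t x] --> f (t, chart i x).
Proof.
move=> xi fU Ux.
have c : (p.1, chart i p.2) @[p --> fam_nbhs t x] --> (t : R^o, chart i x).
  apply: (@cvg_pair _ _ _ (fam_nbhs t x) (nbhs (t : R^o)) (nbhs (chart i x))).
    exact: fam_nbhs_cvg1.
  exact: (cvg_comp _ _ (@fam_nbhs_cvg2 _ _ M t x) (chart_cvg xi)).
exact: (cvg_comp _ f c (smooth_open_continuous fU Ux)).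
Qed.

Lemma cvg_form_fam (Phi : R -> M -> M) t x j : continuous_family Phi ->
  t \in `[0, 1] -> dom j (Phi t x) ->
  form alpha j (chart j (Phi p.1 p.2)) @[p --> fam_nbhs t x] -->
  form alpha j (chart j (Phi t x)).
Proof.
move=> /continuous_family_cvgP cPhi t01 xj.
have c1 := cvg_comp _ (chart j) (cPhi t x t01) (chart_cvg xj).
exact: (cvg_comp _ (form alpha j) c1 (form_cvg xj)).
Qed.

(** A smooth system asserts smoothness of the conformal factor only at each fixed time. Evaluating
    the defining equation on a vector v with alpha(v) nonzero writes e^h as a quotient N / D of
    jointly continuous functions. *)
Lemma smooth_system_conf_continuous P H h :
  smooth_contact_system alpha P H h -> continuous_family h.
Proof.
move=> [sP P0 cP vP]; apply/continuous_family_cvgP => t x t01.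
have xi := chart_at_dom x; have xj := chart_at_dom (P t x).
set i := chart_at x in xi *; set j := chart_at (P t x) in xj *.
have [v v0] := form_neq0 xi.
have [U [G [oU Ux GU GP]]] := smooth_family_ext sP t01 xi xj.
pose N (p : R * M) := pairing (form alpha j (chart j (P p.1 p.2))) ('D_(0, v) G (p.1, chart i p.2)).
pose D (p : R * M) := pairing (form alpha i (chart i p.2)) v.
have key (p : R * M) : p.1 \in `[0, 1] -> dom i p.2 -> U (p.1, chart i p.2) ->
    N p = expR (h p.1 p.2) * D p.
  move=> p01 pi Up; have [_ pj Gp] := GP _ Up p01.
  rewrite /= chartK// in pj Gp.
  have [_ _ _ /(_ i j p.2 pi pj v) <-] := cP _ p01.
  rewrite /N -derive_slice2; congr pairing; apply: near_eq_derive.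
  have [nU _] := nbhs_slice oU Up.
  apply: filterS nU => u Uu; have [_ _ ->] := GP _ Uu p01.
  by [].
have cN : N p @[p --> fam_nbhs t x] --> N (t, x).
  apply: cvg_pairing.
    by apply: (cvg_form_fam (Phi := fun s y => P s y)) => //; case: sP.
  apply: (cvg_chart_fam (f := fun q => 'D_(0, v) G q) xi _ Ux).
  exact: smooth_open_derive.
have cD : D p @[p --> fam_nbhs t x] --> D (t, x).
  apply: (cvg_pairing (a := fun p => form alpha i (chart i p.2)) (v := fun=> v)); last exact: cvg_cst.
  have c1 := cvg_comp _ _ (@fam_nbhs_cvg2 _ _ M t x) (chart_cvg xi).
  exact: (cvg_comp _ (form alpha i) c1 (form_cvg xi)).
have Dn0 : D (t, x) != 0 by exact: v0.
have cND : N p / D p @[p --> fam_nbhs t x] --> N (t, x) / D (t, x).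
  by apply: cvgM => //; apply: cvgV.
have e0 : N (t, x) / D (t, x) = expR (h t x).
  by rewrite (key (t, x))// mulfK.
have cL : ln (N p / D p) @[p --> fam_nbhs t x] --> h t x.
  rewrite -(expRK (h t x)) -e0.
  apply: (cvg_comp _ _ cND); apply: continuous_ln; rewrite e0 ; exact: expR_gt0.
apply: cvg_trans cL; apply: near_eq_cvg; near=> p.
have p01 : p.1 \in `[0, 1] by near: p; exact: fam_nbhs01.
have pi : dom i p.2 by near: p; exact: (@fam_nbhs_cvg2 _ _ M t x _ (nbhs_dom xi)).
have Up : U (p.1, chart i p.2) by near: p; exact: near_chart_fam.
have Dp : D p != 0.
  near: p; apply: (cD [set r | r != 0]).
  by apply: open_nbhs_nbhs; split=> //; exact: open_neq.
by rewrite key// mulfK// expRK.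
Unshelve. all: by end_near. Qed.

Lemma unit_itv_dnbhs_proper t : t \in `[0, 1] -> ProperFilter (within `[0, 1] t^').
Proof.
move=> /[dup] t01; rewrite in_itv /= => /andP[t0 t1].
have FF : Filter (within `[0, 1] t^') by exact: within_filter.
apply: Build_ProperFilter_ex => A.
have -> : within `[0, 1] t^' A <-> \forall s \near t, s != t -> s \in `[0, 1] -> A s.
  rewrite -[within _ _ _]/(\forall s \near within `[0, 1] t^', A s).
  by rewrite near_withinE /dnbhs near_withinE.
move=> /nbhs_ballP[e /= e0 eA].
pose d := Num.min (e / 2) (1 / 2).
have d0 : 0 < d by rewrite lt_min !divr_gt0.
have [de d1] : d <= e / 2 /\ d <= 1 / 2 by split; rewrite ge_min lexx ?orbT.
(* One steps to the right from the left half and to the left otherwise; d <= 1/2 keeps the new time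
   in [0,1]. *)
have [th|th] := leP t (1 / 2).
  exists (t + d); apply: eA.
  - rewrite /ball /= opprD addrA subrr add0r normrN gtr0_norm//; lra.
  - by rewrite -subr_eq0 addrAC subrr add0r gt_eqF.
  - rewrite in_itv /=; apply/andP; split; lra.
exists (t - d); apply: eA.
- rewrite /ball /= opprB addrCA subrr addr0 gtr0_norm//; lra.
- by rewrite -subr_eq0 addrAC subrr add0r oppr_eq0 gt_eqF.
- rewrite in_itv /=; apply/andP; split; lra.
Qed.

Lemma has_velocity_unique (c : R -> E) t v w : t \in `[0, 1] ->
  has_velocity c t v -> has_velocity c t w -> v = w.
Proof.
rewrite /has_velocity => t01 cv cw; have FF := unit_itv_dnbhs_proper t01.
exact: (cvg_unique _ cv cw).
Qed.

Lemma has_velocity_slice (G : R^o * E -> E) t (u : E) : differentiable G (t, u) ->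
  has_velocity (fun s => G (s, u)) t ('D_(1, 0) G (t, u)).
Proof.
move=> dG; apply/cvgrPdist_lt => e e0; rewrite near_withinE.
have H : \forall h \near (0 : R), h != 0 ->
    `|'D_(1, 0) G (t, u) - h^-1 *: (G (h *: (1 : R^o, 0 : E) + (t : R^o, u)) - G (t, u))| < e.
  have /cvgrPdist_lt/(_ e e0) : (h^-1 *: (G (h *: (1 : R^o, 0 : E) + (t : R^o, u)) - G (t, u)))
      @[h --> 0^'] --> 'D_(1, 0) G (t, u).
    exact: (diff_derivable dG).
  by rewrite /dnbhs near_withinE.
move: H; rewrite (near_shift t) sub0r /dnbhs near_withinE; apply: filterS => s /= h st s01.
have := h; rewrite subr_eq0 => /(_ st).
rewrite (_ : (s - t) *: (1 : R^o, 0 : E) + (t : R^o, u) = (s : R^o, u))//.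
by congr pair => /=; rewrite ?scaler0 ?add0r// [_ *: _]mulr1 subrK.
Qed.

Lemma smooth_system_ham_continuous P H h :
  smooth_contact_system alpha P H h -> continuous_family H.
Proof.
move=> [sP P0 cP vP].
(* The velocity gives H only at the moving point P t x; continuity of H itself then follows by
   composing with the inverse family. *)
have cK : continuous_family (fun t x => H t (P t x)).
  apply/continuous_family_cvgP => t x t01.
  have xi := chart_at_dom x; have xj := chart_at_dom (P t x).
  set i := chart_at x in xi *; set j := chart_at (P t x) in xj *.
  have [U [G [oU Ux GU GP]]] := smooth_family_ext sP t01 xi xj.
  pose N (p : R * M) := pairing (form alpha j (chart j (P p.1 p.2))) ('D_(1, 0) G (p.1, chart i p.2)).
  have key (p : R * M) : p.1 \in `[0, 1] -> dom i p.2 -> U (p.1, chart i p.2) ->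
      H p.1 (P p.1 p.2) = N p.
    move=> p01 pi Up; have [_ pj Gp] := GP _ Up p01.
    rewrite /= chartK// in pj Gp.
    have [v cv ->] := vP _ _ _ p01 pj.
    (* At times 0 and 1 the velocity is one-sided; uniqueness identifies it with the time derivative
       of the smooth extension G. *)
    congr pairing; apply: (has_velocity_unique p01 cv).
    have := has_velocity_slice (smooth_open_differentiable GU Up).
    apply: has_velocity_near => //.
    have [_ nU] := nbhs_slice oU Up.
    by apply: filterS nU => s Us s01; have [_ _ ->] := GP _ Us s01; rewrite /= chartK.
  have cN : N p @[p --> fam_nbhs t x] --> N (t, x).
    apply: cvg_pairing.
      by apply: (cvg_form_fam (Phi := fun s y => P s y)) => //; case: sP.
    apply: (cvg_chart_fam (f := fun q => 'D_(1, 0) G q) xi _ Ux).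
    exact: smooth_open_derive.
  rewrite (key (t, x))//; apply: cvg_trans cN; apply: near_eq_cvg; near=> p.
  rewrite [RHS]key//.
  - by near: p; exact: fam_nbhs01.
  - by near: p; exact: (@fam_nbhs_cvg2 _ _ M t x _ (nbhs_dom xi)).
  - by near: p; exact: near_chart_fam.
have cP' := continuous_family_inv (proj1 sP).
have := continuous_family_comp cK cP'.
congr continuous_family; apply/funext => t; apply/funext => x.
by rewrite hinvK.
Unshelve. all: by end_near. Qed.

End JointContinuity.

(** * Uniform convergence of isotopies and conformal factors *)

Section CompactUniform.
Context {R : realType}.

(** Around each point either Q holds or psi is bounded below by half its value; finitely many such
    neighbourhoods cover A, so a small value of psi leaves only the first case. *)
Lemma compact_near_small (T : topologicalType) (A : set T) (psi : T -> R) (Q : set T) :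
  compact A ->
  (forall z, A z -> psi @ within A (nbhs z) --> psi z) ->
  (forall z, A z -> (\forall z' \near within A (nbhs z), Q z') \/ 0 < psi z) ->
  exists2 d, 0 < d & forall z, A z -> psi z < d -> Q z.
Proof.
move=> /compact_near_coveringP cA cpsi alt.
have nF (z : T) (B : set T) : (\forall z' \near within A (nbhs z), B z') ->
    \forall z' \near z, A z' -> B z'.
  by rewrite near_withinE.
have H : \forall d \near 0^'+, A `<=` (fun z => A z -> psi z < d -> Q z).
  apply: cA => z Az; have [/nF nz|pz] := alt z Az.
    exists ([set z' | A z' -> Q z'], setT).
      by split=> //; exact: filterT.
    by move=> [z' d] [/= h _] Az' _; exact: h.
  have nz : \forall z' \near z, A z' -> psi z / 2 < psi z'.
    apply: nF; apply: (cpsi z Az [set r | psi z / 2 < r]); apply: lt_nbhsr.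
    by rewrite ltr_pdivrMr// ltr_pMr// ltr1n.
  exists ([set z' | A z' -> psi z / 2 < psi z'], [set d | d < psi z / 2]).
    by split=> //=; apply: nbhs_right_lt; rewrite divr_gt0.
  move=> [z' d] [/= h zd] Az' zd'; have := lt_trans zd' zd.
  by rewrite ltNge ltW// h.
have [d [Hd d0]] := filter_ex (filterI H (nbhs_right_gt (0 : R))).
by exists d => // z Az; exact: Hd.
Qed.

Lemma compact_small (T : topologicalType) (A : set T) (phi psi : T -> R) (e : R) :
  compact A ->
  (forall z, A z -> phi @ within A (nbhs z) --> phi z) ->
  (forall z, A z -> psi @ within A (nbhs z) --> psi z) ->
  (forall z, A z -> e <= phi z -> 0 < psi z) ->
  exists2 d, 0 < d & forall z, A z -> psi z < d -> phi z < e.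
Proof.
move=> cA cphi cpsi pos; apply: (compact_near_small (Q := [set z | phi z < e]) cA cpsi) => z Az.
have [ze|ze] := ltP (phi z) e; last by right; exact: pos.
by left; apply: (cphi z Az [set r | r < e]); exact: lt_nbhsl.
Qed.

Lemma within_fst (S T : topologicalType) (B : set S) (C : set T) (q : S * T) :
  fst @ within (B `*` C) (nbhs q) --> within B (nbhs q.1).
Proof.
move=> U; rewrite -[nbhs _ U]/(\forall x \near within B (nbhs q.1), U x) near_withinE => nU.
suff : \forall p \near within (B `*` C) (nbhs q), U p.1 by [].
rewrite near_withinE; near=> p => -[Bp _]; move: Bp; near: p.
by case: q nU => a b /= nU; exact: (cvg_fst nU).
Unshelve. all: by end_near. Qed.

Lemma within_snd (S T : topologicalType) (B : set S) (C : set T) (q : S * T) :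
  snd @ within (B `*` C) (nbhs q) --> within C (nbhs q.2).
Proof.
move=> U; rewrite -[nbhs _ U]/(\forall x \near within C (nbhs q.2), U x) near_withinE => nU.
suff : \forall p \near within (B `*` C) (nbhs q), U p.2 by [].
rewrite near_withinE; near=> p => -[_ Cp]; move: Cp; near: p.
by case: q nU => a b /= nU; exact: (cvg_snd nU).
Unshelve. all: by end_near. Qed.

End CompactUniform.

Section UniformFamilies.
Context {R : realType} {m : nat} {M : closedManifold R m}.
Variable P : partitionOfUnity M.
Implicit Types (x y z : M) (s t : R).

Definition pou_coord (k : 'I_(pou_size P)) x : 'rV[R]_m := pou_fun k x *: chart (pou_chart k) x.

(* A metric inducing the topology of M: the distance for the embedding of M
   whose components are the functions p_k and p_k * (chart k). *)
Definition rho x y : R := \sum_(k < pou_size P) (`|pou_fun k x - pou_fun k y| +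
  `|pou_coord k x - pou_coord k y|).

Lemma rho_ge0 x y : 0 <= rho x y.
Proof. by apply: sumr_ge0 => k _; rewrite addr_ge0. Qed.

Lemma rhoxx x : rho x x = 0.
Proof. by rewrite /rho big1// => k _; rewrite !subrr !normr0 addr0. Qed.

Lemma rhoC x y : rho x y = rho y x.
Proof. by apply: eq_bigr => k _; rewrite distrC [X in _ + X]distrC. Qed.

Lemma rho_tri z x y : rho x y <= rho x z + rho z y.
Proof.
rewrite -big_split/=; apply: ler_sum => k _; rewrite addrACA lerD//.
  by rewrite -(subrKA (pou_fun k z)) ler_normD.
by rewrite -(subrKA (pou_coord k z)) ler_normD.
Qed.

(** Some function of the partition is nonzero at x, hence also at y. Both points then lie in the
    corresponding chart, where dividing the coordinate by this common value recovers the chart. *)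
Lemma rho_eq0 x y : rho x y = 0 -> x = y.
Proof.
move=> /eqP; rewrite psumr_eq0 => [/allP xy|k _]; last by rewrite addr_ge0.
have {}xy (k : 'I_(pou_size P)) : pou_fun k x = pou_fun k y /\ pou_coord k x = pou_coord k y.
  have := xy k; rewrite mem_index_enum => /(_ isT) /=.
  rewrite paddr_eq0// !normr_eq0 !subr_eq0 => /andP[/eqP -> /eqP ->].
  by [].
have [k xk] : exists k : 'I_(pou_size P), pou_fun k x != 0.
  apply: contrapT => n0; have := pou_sum1 P x; rewrite big1 => [/esym/eqP|k _].
    by rewrite oner_eq0.
  by apply/eqP/negP => /negP xk; apply: n0; exists k.
have [xyk cxy] := xy k; have yk : pou_fun k y != 0 by rewrite -xyk.
have kdom z : pou_fun k z != 0 -> dom (pou_chart k) z.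
  by move=> zk; apply: (@pou_support _ _ _ P k); exact: subset_closure.
move: cxy; rewrite /pou_coord -xyk => /(scalerI xk) cxy.
by rewrite -(chartK (kdom _ xk)) cxy chartK//; exact: kdom.
Qed.

(** The chart is arbitrary outside its domain, but the support of the cut-off lies in the domain, so
    off the support the product vanishes on a neighbourhood. *)
Lemma pou_coord_continuous k : continuous (pou_coord k).
Proof.
move=> x; have [xk|xk] := pselect (closure [set x | pou_fun k x != 0] x).
  apply: cvgZ; first exact: (smooth_fun_continuous (@pou_smooth _ _ _ P k)).
  by apply: chart_cvg; exact: pou_support xk.
have nx : \forall y \near x, pou_coord k y = 0.
  have : nbhs x (~` closure [set x | pou_fun k x != 0]).
    by apply: open_nbhs_nbhs; split=> //; rewrite openC; exact: closed_closure.
  apply: filterS => y /= yk; rewrite /pou_coord.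
  have [->|y0] := eqVneq (pou_fun k y) 0; first by rewrite scale0r.
  by exfalso; apply: yk; exact: subset_closure.
rewrite /continuous_at (nbhs_singleton nx); apply: cvg_near_cst.
by apply: filterS nx => y ->.
Qed.

Lemma rho_continuous : continuous (fun p : M * M => rho p.1 p.2).
Proof.
move=> [x y]; apply: cvg_big => [|k _]; first exact: add_continuous.
have c1 := @smooth_fun_continuous _ _ _ _ (@pou_smooth _ _ _ P k).
have c2 := @pou_coord_continuous k.
apply: cvgD; apply: cvg_norm; apply: cvgB.
- exact: (@cvg_comp _ _ _ (fst : M * M -> M) (pou_fun k) _ _ _ cvg_fst (c1 x)).
- exact: (@cvg_comp _ _ _ (snd : M * M -> M) (pou_fun k) _ _ _ cvg_snd (c1 y)).
- exact: (@cvg_comp _ _ _ (fst : M * M -> M) (@pou_coord k) _ _ _ cvg_fst (c2 x)).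
- exact: (@cvg_comp _ _ _ (snd : M * M -> M) (@pou_coord k) _ _ _ cvg_snd (c2 y)).
Qed.

Lemma unit_itv_compact : compact (`[0, 1]%classic : set R).
Proof. exact: segment_compact. Qed.

Lemma cylinder_compact : compact (`[0, 1]%classic `*` [set: M] : set (R * M)).
Proof. by apply: compact_setX; [exact: segment_compact|exact: manifold_compact]. Qed.

(** Heine-Cantor: on the compact square of the cylinder [0,1] x M, points with r >= e have positive
    distance |s - t| + rho, and compactness bounds this distance below. *)
Lemma family_uniform (Y : topologicalType) (r : Y -> Y -> R) (F : R -> M -> Y) :
  continuous (fun p : Y * Y => r p.1 p.2) -> (forall z : Y, r z z = 0) ->
  continuous_family F -> forall e, 0 < e -> exists2 d, 0 < d &
    forall s t x y, s \in `[0, 1] -> t \in `[0, 1] -> `|s - t| < d -> rho x y < d ->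
      r (F s x) (F t y) < e.
Proof.
move=> cr r0 /continuous_family_cvgP cF e e0.
pose B : set (R * M) := `[0, 1] `*` [set: M].
pose A : set ((R * M) * (R * M)) := B `*` B.
have cA : compact A by apply: compact_setX; exact: cylinder_compact.
pose phi (q : (R * M) * (R * M)) := r (F q.1.1 q.1.2) (F q.2.1 q.2.2).
pose psi (q : (R * M) * (R * M)) := `|q.1.1 - q.2.1| + rho q.1.2 q.2.2.
have [||| d d0 dP] := @compact_small _ _ A phi psi e cA.
- move=> [[s x] [t y]] [[/= s01 _] [/= t01 _]].
  have c1 := cvg_comp _ _ (@within_fst _ _ B B ((s, x), (t, y))) (cF s x s01).
  have c2 := cvg_comp _ _ (@within_snd _ _ B B ((s, x), (t, y))) (cF t y t01).
  have FF : Filter (within A (nbhs ((s, x), (t, y)))) by exact: within_filter.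
  exact: (cvg_comp _ _ (cvg_pair c1 c2) (cr (F s x, F t y))).
- move=> q _; apply: cvg_within_filter.
  have c1 : (fun q : (R * M) * (R * M) => q.1.1 - q.2.1) @ q --> q.1.1 - q.2.1.
    by apply: cvgB; apply: cvg_comp; [exact: cvg_fst|exact: cvg_fst|exact: cvg_snd|exact: cvg_fst].
  have c2 : (fun q : (R * M) * (R * M) => (q.1.2, q.2.2)) @ q --> (q.1.2, q.2.2).
    by apply: cvg_pair; apply: cvg_comp; [exact: cvg_fst|exact: cvg_snd|exact: cvg_snd|exact: cvg_snd].
  have c3 : (fun q : (R * M) * (R * M) => rho q.1.2 q.2.2) @ q --> rho q.1.2 q.2.2.
    exact: (cvg_comp _ (fun p : M * M => rho p.1 p.2) c2 (@rho_continuous (q.1.2, q.2.2))).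
  exact: (cvgD (cvg_norm c1) c3).
- move=> [[s x] [t y]] _; rewrite /phi /psi /= => er.
  rewrite lt_neqAle addr_ge0 ?rho_ge0// andbT; apply/eqP => /esym/eqP.
  rewrite paddr_eq0 ?rho_ge0// normr_eq0 subr_eq0 => /andP[/eqP st /eqP/rho_eq0 xy].
  by move: er; rewrite st xy r0 leNgt e0.
exists (d / 2); first by rewrite divr_gt0.
move=> s t x y s01 t01 st xy; apply: (dP ((s, x), (t, y))).
  by split; split.
by rewrite /psi /= (splitr d) ltrD.
Qed.

End UniformFamilies.

Section UniformConvergence.
Context {R : realType} {m : nat} {M : closedManifold R m}.
Variable P : partitionOfUnity M.
Local Notation rho := (rho P).
Context {I : Type} (F : set_system I) {FF : Filter F}.

Definition ucv (Y : Type) (r : Y -> Y -> R) (A_ : I -> R -> M -> Y)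
    (A : R -> M -> Y) :=
  forall e, 0 < e -> \forall i \near F,
    forall t x, t \in `[0, 1] -> r (A_ i t x) (A t x) < e.

Definition time_cv (tau_ : I -> R -> R) (tau : R -> R) :=
  forall e, 0 < e -> \forall i \near F,
    forall t, t \in `[0, 1] -> `|tau_ i t - tau t| < e.

Definition time_map (tau : R -> R) := forall t, t \in `[0, 1] -> tau t \in `[0, 1].

Section Metric.
Context {Y : topologicalType} (r : Y -> Y -> R).
Hypothesis cr : continuous (fun p : Y * Y => r p.1 p.2).
Hypothesis r0 : forall z : Y, r z z = 0.
Hypothesis rtri : forall z x y : Y, r x y <= r x z + r z y.

(** The error of A_ is uniform over all points, so the inner map does not matter for it; uniform
    continuity of the limit A absorbs the error of B_. *)
Lemma ucv_comp (A_ : I -> R -> M -> Y) A (B_ : I -> R -> M -> M) B :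
  continuous_family A -> ucv r A_ A -> ucv rho B_ B ->
  ucv r (fun i t x => A_ i t (B_ i t x)) (fun t x => A t (B t x)).
Proof.
move=> cA hA hB e e0; have e20 : 0 < e / 2 by rewrite divr_gt0.
have [d d0 dP] := family_uniform P cr r0 cA e20.
near=> i => t x t01.
have h1 : r (A_ i t (B_ i t x)) (A t (B_ i t x)) < e / 2.
  by move: (B_ i t x) => z; move: t z t01 {x}; near: i; exact: hA.
have h2 : rho (B_ i t x) (B t x) < d.
  by move: t x t01 {h1}; near: i; exact: hB.
have h3 := dP t t _ _ t01 t01.
rewrite subrr normr0 in h3.
by rewrite (le_lt_trans (rtri (A t (B_ i t x)) _ _))// (splitr e) ltrD// h3.
Unshelve. all: by end_near. Qed.

Lemma ucv_reparam (A_ : I -> R -> M -> Y) A tau_ tau :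
  continuous_family A -> ucv r A_ A -> time_cv tau_ tau ->
  (forall i, time_map (tau_ i)) -> time_map tau ->
  ucv r (fun i t => A_ i (tau_ i t)) (fun t => A (tau t)).
Proof.
move=> cA hA htau mtau_ mtau e e0; have e20 : 0 < e / 2 by rewrite divr_gt0.
have [d d0 dP] := family_uniform P cr r0 cA e20.
near=> i => t x t01.
have ti := mtau_ i t t01; have tt := mtau t t01.
have h1 : r (A_ i (tau_ i t) x) (A (tau_ i t) x) < e / 2.
  by move: (tau_ i t) x ti; near: i; exact: hA.
have h2 : `|tau_ i t - tau t| < d.
  by move: t t01 {ti tt h1}; near: i; exact: htau.
have h3 := dP _ _ x x ti tt h2; rewrite rhoxx in h3.
by rewrite (le_lt_trans (rtri (A (tau_ i t) x) _ _))// (splitr e) ltrD// h3.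
Unshelve. all: by end_near. Qed.

End Metric.

Lemma time_cv_at tau_ tau s : s \in `[0, 1] -> time_cv tau_ tau ->
  time_cv (fun i _ => tau_ i s) (fun=> tau s).
Proof. by move=> s01 h e /h; apply: filterS => i hi t _; exact: hi. Qed.

Lemma rho_cts : continuous (fun p : M * M => rho p.1 p.2).
Proof. exact: rho_continuous. Qed.

Definition rdist (a b : R) : R := `|a - b|.

Lemma rdist_cts : continuous (fun p : R * R => rdist p.1 p.2).
Proof. by move=> p; apply: cvg_norm; apply: cvgB; [exact: cvg_fst|exact: cvg_snd]. Qed.

Lemma rdistxx (a : R) : rdist a a = 0.
Proof. by rewrite /rdist subrr normr0. Qed.

Lemma rdist_tri (c a b : R) : rdist a b <= rdist a c + rdist c b.
Proof. by rewrite /rdist -(subrKA c) ler_normD. Qed.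

Lemma ucvD (A_ B_ : I -> R -> M -> R) A B : ucv rdist A_ A -> ucv rdist B_ B ->
  ucv rdist (fun i t x => A_ i t x + B_ i t x) (fun t x => A t x + B t x).
Proof.
move=> hA hB e e0; have e20 : 0 < e / 2 by rewrite divr_gt0.
apply: filterS2 (hA _ e20) (hB _ e20) => i Ai Bi t x t01.
rewrite /rdist opprD addrACA (le_lt_trans (ler_normD _ _))// (splitr e) ltrD//.
  exact: Ai.
exact: Bi.
Qed.

Lemma ucvB (A_ B_ : I -> R -> M -> R) A B : ucv rdist A_ A -> ucv rdist B_ B ->
  ucv rdist (fun i t x => A_ i t x - B_ i t x) (fun t x => A t x - B t x).
Proof.
move=> hA hB; apply: ucvD => // e /hB; apply: filterS => i hi t x t01.
by rewrite /rdist -opprD normrN; exact: hi.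
Qed.

Definition iso_cv (Phi_ : I -> R -> homeo M) (Phi : R -> homeo M) :=
  ucv rho (fun i t x => Phi_ i t x) (fun t x => Phi t x) /\
  ucv rho (fun i t x => hinv (Phi_ i t) x) (fun t x => hinv (Phi t) x).

Lemma iso_cv_cat (A_ B_ : I -> R -> homeo M) (A B : R -> homeo M) :
  continuous_family A -> continuous_family B -> iso_cv A_ A -> iso_cv B_ B ->
  iso_cv (fun i => cat_iso (A_ i) (B_ i)) (cat_iso A B).
Proof.
move=> cA cB [hA hA'] [hB hB']; split.
  exact: (ucv_comp rho_cts (rhoxx P) (@rho_tri _ _ _ P) cA hA hB).
exact: (ucv_comp rho_cts (rhoxx P) (@rho_tri _ _ _ P) (continuous_family_inv cB) hB' hA').
Qed.

Lemma iso_cv_reparam (A_ : I -> R -> homeo M) (A : R -> homeo M) tau_ tau :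
  continuous_family A -> iso_cv A_ A -> time_cv tau_ tau ->
  (forall i, time_map (tau_ i)) -> time_map tau ->
  iso_cv (fun i t => A_ i (tau_ i t)) (fun t => A (tau t)).
Proof.
move=> cA [hA hA'] ht mt_ mt; split.
  exact: (ucv_reparam rho_cts (rhoxx P) (@rho_tri _ _ _ P) cA hA ht mt_ mt).
exact: (ucv_reparam rho_cts (rhoxx P) (@rho_tri _ _ _ P) (continuous_family_inv cA) hA' ht mt_ mt).
Qed.

Lemma iso_cv_inv (A_ : I -> R -> homeo M) (A : R -> homeo M) :
  iso_cv A_ A -> iso_cv (fun i t => homeo_inv (A_ i t)) (fun t => homeo_inv (A t)).
Proof. by case. Qed.

Lemma iso_cv_seg (A_ : I -> R -> homeo M) (A : R -> homeo M)
    (tau_ : I -> R^o -> R^o) (tau : R^o -> R^o) :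
  continuous_family A -> continuous tau -> iso_cv A_ A -> time_cv tau_ tau ->
  (forall i, time_map (tau_ i)) -> time_map tau ->
  iso_cv (fun i => seg_iso (A_ i) (tau_ i)) (seg_iso A tau).
Proof.
have I0 : (0 : R) \in `[0, 1] by rewrite in_itv /= lexx ler01.
move=> cA ctau hA ht mt_ mt.
have hA0 := iso_cv_reparam cA hA (time_cv_at I0 ht) (fun i t _ => mt_ i 0 I0) (fun t _ => mt 0 I0).
have cA0 : continuous_family (fun _ x => A (tau 0) x).
  by apply: continuous_family_cst; exact: hfun_continuous.
apply: (@iso_cv_cat (fun i t => A_ i (tau_ i t)) (fun i t => homeo_inv (A_ i (tau_ i 0)))
  (fun t => A (tau t)) (fun t => homeo_inv (A (tau 0)))).
- exact: (continuous_family_reparam cA).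
- exact: (continuous_family_inv (P := fun=> A (tau 0)) cA0).
- exact: iso_cv_reparam.
- exact: (iso_cv_inv hA0).
Qed.

Lemma conf_cv_seg (A_ : I -> R -> homeo M) (A : R -> homeo M)
    (h_ : I -> R -> M -> R) (h : R -> M -> R)
    (tau_ : I -> R^o -> R^o) (tau : R^o -> R^o) :
  continuous_family A -> continuous_family h -> continuous tau ->
  iso_cv A_ A -> ucv rdist h_ h -> time_cv tau_ tau ->
  (forall i, time_map (tau_ i)) -> time_map tau ->
  ucv rdist (fun i => seg_conf (A_ i) (h_ i) (tau_ i)) (seg_conf A h tau).
Proof.
have I0 : (0 : R) \in `[0, 1] by rewrite in_itv /= lexx ler01.
move=> cA ch ctau hA hh ht mt_ mt.
have [_ hA0] := iso_cv_reparam cA hA (time_cv_at I0 ht) (fun i t _ => mt_ i 0 I0) (fun t _ => mt 0 I0).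
have c1 : continuous_family (fun t => h (tau t)) by exact: continuous_family_reparam.
have u1 := ucv_reparam rdist_cts rdistxx rdist_tri ch hh ht mt_ mt.
have c2 : continuous_family (fun _ : R => h (tau 0)).
  by apply: continuous_family_cst; exact: (continuous_family_at ch (mt 0 I0)).
have u2 := ucv_reparam rdist_cts rdistxx rdist_tri ch hh (time_cv_at I0 ht)
  (fun i t _ => mt_ i 0 I0) (fun t _ => mt 0 I0).
exact: (ucvB (ucv_comp rdist_cts rdistxx rdist_tri c1 u1 hA0)
             (ucv_comp rdist_cts rdistxx rdist_tri c2 u2 hA0)).
Qed.

Lemma conf_cv_cat (B_ : I -> R -> homeo M) (B : R -> homeo M)
    (h_ k_ : I -> R -> M -> R) (h k : R -> M -> R) :
  continuous_family h -> iso_cv B_ B -> ucv rdist h_ h -> ucv rdist k_ k ->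
  ucv rdist (fun i => cat_conf (h_ i) (B_ i) (k_ i)) (cat_conf h B k).
Proof.
move=> ch [hB _] hh hk; apply: ucvD => //.
exact: (ucv_comp rdist_cts rdistxx rdist_tri ch hh hB).
Qed.

Lemma ucv_continuous_family (h_ : I -> R -> M -> R) (h : R -> M -> R) :
  ProperFilter F -> (forall i, continuous_family (h_ i)) -> ucv rdist h_ h ->
  continuous_family h.
Proof.
move=> PF ch hh; apply/continuous_family_cvgP => t x t01.
apply/cvgrPdist_lt => e e0; have e30 : 0 < e / 3 by rewrite divr_gt0.
have [i hi] := filter_ex (hh _ e30).
have /continuous_family_cvgP/(_ t x t01)/cvgrPdist_lt/(_ _ e30) := ch i.
apply: filterS2 (fam_nbhs01 t x) => p p01 hp.
rewrite -(subrKA (h_ i t x)) -[X in _ + X](subrKA (h_ i p.1 p.2)).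
rewrite (le_lt_trans (ler_normD _ _))//.
have -> : e = e / 3 + (e / 3 + e / 3) by field.
rewrite ltrD//; first by rewrite distrC; exact: hi.
rewrite (le_lt_trans (ler_normD _ _))// ltrD//; exact: hi.
Qed.

End UniformConvergence.

(** * The Riemannian distance *)

Section LowerIntegral.
Context {R : realType}.
Local Notation mu := (@lebesgue_measure R).

(* The integral of a nonnegative function that need not be measurable is a
   lower integral. *)
Lemma le_lower_integral (D : set R) (f g : R -> \bar R) :
  (forall x, D x -> 0 <= f x)%E -> (forall x, D x -> f x <= g x)%E ->
  (\int[mu]_(x in D) f x <= \int[mu]_(x in D) g x)%E.
Proof.
move=> f0 fg; rewrite ge0_integralE// ge0_integralE; last first.
  by move=> x Dx; exact: le_trans (f0 _ Dx) (fg _ Dx).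
apply: ereal_sup_le => _ [h hf <-]; exists h => // x.
apply: (le_trans (hf x)); rewrite !patchE; case: ifPn => // xD.
by apply: fg; rewrite inE in xD.
Qed.

(** Differentiability is given in the open interval only. The fundamental theorem of calculus is
    applied on smaller closed intervals, and continuity of f at the end points gives the limit
    case. *)
Lemma abs_increment_le (f f' : R -> R) (a b : R) : a <= b ->
  {within `[a, b], continuous f} ->
  (forall x, x \in `]a, b[ -> is_derive x 1 f (f' x)) ->
  (forall x, x \in `]a, b[ -> {for x, continuous f'}) ->
  (`|f b - f a|%:E <= \int[mu]_(x in `]a, b[) (`|f' x|)%:E)%E.
Proof.
rewrite le_eqVlt => /predU1P[<- _ _ _|ab cf df cdf].
  by rewrite subrr normr0; apply: integral_ge0 => x _; rewrite lee_fin.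
have [_ cfa cfb] := (continuous_within_itvP f ab).1 cf.
have mdf : measurable_fun `]a, b[ f'.
  by apply: measurable_realfun.open_continuous_measurable_fun; [exact: interval_open|move=> x; rewrite inE; exact: cdf].
have sub a' b' : a < a' -> a' < b' -> b' < b ->
    (`|f b' - f a'|%:E <= \int[mu]_(x in `]a, b[) (`|f' x|)%:E)%E.
  move=> aa' a'b' b'b.
  have sab x : x \in `[a', b'] -> x \in `]a, b[.
    by rewrite !in_itv /= => /andP[h1 h2]; rewrite (lt_le_trans aa' h1) (le_lt_trans h2 b'b).
  have cf' : {within `[a', b'], continuous f'}.
    by apply: continuous_in_subspaceT => x; rewrite inE => /sab; exact: cdf.
  have df' : {in `[a', b'], forall x, derivable f x 1} by move=> x /sab/df[].
  have cfx x : x \in `[a', b'] -> {for x, continuous f}.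
    by move=> /df' d; apply: differentiable_continuous; exact/derivable1_diffP.
  have dLR : derivable_oo_LRcontinuous f a' b'.
    split.
    - by move=> x /subset_itv_oo_cc; exact: df'.
    - by apply: cvg_at_right_filter; apply: cfx; rewrite in_itv /= lexx ltW.
    - by apply: cvg_at_left_filter; apply: cfx; rewrite in_itv /= lexx ltW.
  have eqd : {in `]a', b'[, (f^`())%classic =1 f'}.
    by move=> x /subset_itv_oo_cc/sab xab; rewrite derive1E; have [_ ->] := df x xab.
  have H := continuous_FTC2 a'b' cf' dLR eqd.
  have m' : measurable_fun (`[a', b']%classic : set R) (fun x => (f' x)%:E).
    apply/measurable_EFinP; apply: measurable_funS mdf => // x; exact: sab.
  have -> : (`|f b' - f a'|%:E = `|\int[mu]_(x in `[a', b']) (f' x)%:E|)%E.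
    by rewrite H.
  apply: (le_trans (le_abse_integral mu (measurable_itv _) m')).
  apply: ge0_subset_integral => //.
  apply/measurable_EFinP; apply: measurableT_comp => //.
have [L|] := leP (`|f b - f a|%:E)%E (\int[mu]_(x in `]a, b[) (`|f' x|)%:E)%E; first by [].
set J := (\int[mu]_(x in _) _)%E => JL.
have Jfin : J \is a fin_num.
  rewrite ge0_fin_numE; last by apply: integral_ge0 => x _; rewrite lee_fin.
  exact: lt_trans JL (ltry _).
pose l := fine J; have Jl : J = l%:E by rewrite fineK.
rewrite Jl lte_fin in JL.
(* Half of the supposed gap: moving each end point changes f by less than e, which leaves no room
   for the gap. *)
pose e := (`|f b - f a| - l) / 2.
have e0 : 0 < e by rewrite divr_gt0// subr_gt0.
pose c := (a + b) / 2.
have na : \forall x \near a^'+, `|f a - f x| < e by move/cvgrPdist_lt : cfa; exact.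
have nb : \forall x \near b^'-, `|f b - f x| < e by move/cvgrPdist_lt : cfb; exact.
have ac : a < c by rewrite /c; lra.
have cb : c < b by rewrite /c; lra.
have /(@filter_ex _ _ (at_right_proper_filter a))[a' [ha a'a a'c]] : \forall x \near a^'+, [/\ `|f a - f x| < e, a < x & x < c].
  near=> x; split; near: x => //; [exact: nbhs_right_gt|exact: nbhs_right_lt].
have /(@filter_ex _ _ (at_left_proper_filter b))[b' [hb b'b b'c]] : \forall x \near b^'-, [/\ `|f b - f x| < e, x < b & c < x].
  near=> x; split; near: x => //; [exact: nbhs_left_lt|exact: nbhs_left_gt].
have := sub _ _ a'a (lt_trans a'c b'c) b'b; rewrite -/J Jl lee_fin => H.
have : `|f b - f a| < e + l + e.
  have -> : f b - f a = (f b - f b') + (f b' - f a') - (f a - f a') by ring.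
  rewrite (le_lt_trans (ler_normB _ _))// ltrD//.
  by rewrite (le_lt_trans (ler_normD _ _))// ltr_leD.
rewrite /e; lra.
Unshelve. all: by end_near. Qed.

Lemma breakpoints_itv (N : nat) (s : nat -> R) :
  s 0%N = 0 -> s N = 1 -> (forall l, (l < N)%N -> s l < s l.+1) ->
  forall l, (l <= N)%N -> 0 <= s l <= 1.
Proof.
move=> s0 sN ss.
have sle l : (l <= N)%N -> 0 <= s l.
  elim: l => [|l IH] lN; first by rewrite s0.
  by rewrite (le_trans (IH (ltnW lN)))// ltW// ss.
have sle1 l : (l <= N)%N -> s l <= 1.
  move=> lN; rewrite -sN -(subnKC lN).
  have : (l + (N - l) <= N)%N by rewrite subnKC.
  elim: (N - l)%N => [|k IH]; first by rewrite addn0.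
  rewrite addnS => kN; exact: le_trans (IH (ltnW kN)) (ltW (ss _ kN)).
by move=> l lN; rewrite sle// sle1.
Qed.

(** Since phi need not be measurable, the induction over the pieces builds a measurable minorant g
    of phi out of the |f'|. It vanishes beyond the current break point, so the next piece can be
    added without exceeding phi. *)
Lemma piecewise_increment_le (f phi : R -> R) (N : nat) (s : nat -> R) (tau : R) :
  s 0%N = 0 -> s N = 1 -> (forall l, (l < N)%N -> s l < s l.+1) ->
  0 <= tau -> tau <= 1 -> {within `[0, tau], continuous f} ->
  (forall l, (l < N)%N -> exists f' : R -> R, forall x, x \in `]s l, s l.+1[ -> x < tau ->
    [/\ is_derive x 1 f (f' x), {for x, continuous f'} & `|f' x| <= phi x]) ->
  (forall x, x \in `[0, 1] -> 0 <= phi x) ->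
  (`|f tau - f 0|%:E <= \int[mu]_(x in `[0%R, 1%R]) (phi x)%:E)%E.
Proof.
move=> s0 sN ss tau0 tau1 cf df phi0.
have sle l : (l <= N)%N -> 0 <= s l by move=> /(breakpoints_itv s0 sN ss)/andP[].
have sle1 l : (l <= N)%N -> s l <= 1 by move=> /(breakpoints_itv s0 sN ss)/andP[].
(* The subdivision truncated at tau; pieces beyond tau become empty intervals. *)
pose a l := Num.min (s l) tau.
have key l : (l <= N)%N -> exists g : R -> \bar R, [/\ measurable_fun setT g,
    (forall x : R, 0 <= g x)%E, (forall x : R, (x \in `[0, 1])%R -> g x <= (phi x)%:E)%E,
    (forall x : R, a l < x -> g x = 0%E) &
    (`|f (a l) - f 0|%:E <= \int[mu]_(x in `[0%R, 1%R]) g x)%E].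
  elim: l => [|l IH] lN.
    exists (cst 0%E); split=> //.
    by rewrite /a s0 min_l// subrr normr0 integral0.
  have [g [mg g0 gphi ga gI]] := IH (ltnW lN).
  have [f' f'P] := df l lN.
  have ssl := ss l lN.
  have aS : a l <= a l.+1.
    by rewrite /a le_min !ge_min lexx orbT andbT (ltW ssl).
  have a0 : 0 <= a l by rewrite le_min tau0 sle// ltnW.
  have abP x : x \in `]a l, a l.+1[ -> (x \in `]s l, s l.+1[) /\ (x < tau).
    rewrite !in_itv /= /a lt_min gt_min => /andP[+ /andP[x1 x2]].
    by rewrite x1 x2 (ltNge tau) (ltW x2) orbF => ->.
  have a1 : a l.+1 <= 1 by rewrite ge_min tau1 orbT.
  have atau : a l.+1 <= tau by rewrite ge_min lexx orbT.
  pose h := ((fun x => (`|f' x|)%:E) \_ `]a l, a l.+1[) : R -> \bar R.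
  have mh : measurable_fun setT h.
    apply/(measurable_restrictT _ _).1; first exact: measurable_itv.
    apply/measurable_EFinP; apply: measurableT_comp => //.
    apply: open_continuous_measurable_fun; first exact: interval_open.
    by move=> x; rewrite inE => /abP[xs xt]; have [] := f'P x xs xt.
  have h0 x : (0 <= h x)%E.
    by rewrite /h patchE; case: ifPn => // _; rewrite lee_fin.
  exists (fun x => g x + h x)%E; split.
  - exact: emeasurable_funD.
  - by move=> x; rewrite adde_ge0.
  - move=> x x01; rewrite /h patchE; case: ifPn => [|_]; last by rewrite adde0 gphi.
    rewrite inE => /[dup]/abP[xs xt]; rewrite /= in_itv /= => /andP[xa _].
    by rewrite ga// add0e lee_fin; have [] := f'P x xs xt.
  - move=> x xa; rewrite ga; last exact: le_lt_trans aS xa.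
    rewrite add0e /h patchE; case: ifPn => //; rewrite inE /= in_itv /=.
    by rewrite (lt_gtF xa) andbF.
  - rewrite ge0_integralD//; last 2 first.
    + exact: measurable_funS mg.
    + exact: measurable_funS mh.
    have -> : (\int[mu]_(x in `[0%R, 1%R]) h x = \int[mu]_(x in `]a l, a l.+1[) (`|f' x|)%:E)%E.
      rewrite /h -integral_mkcondr; congr (integral _ _ _).
      apply/seteqP; split=> x; first by case.
      move=> xa; split=> //; move: xa; rewrite /= !in_itv /= => /andP[x1 x2].
      by rewrite (le_trans a0 (ltW x1)) (le_trans (ltW x2)).
    have : (`|f (a l.+1) - f (a l)|%:E <= \int[mu]_(x in `]a l, a l.+1[) (`|f' x|)%:E)%E.
      apply: abs_increment_le => //.
      + apply: continuous_subspaceW cf => x; rewrite /= !in_itv /= => /andP[x1 x2].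
        by rewrite (le_trans a0 x1) (le_trans x2).
      + by move=> x /abP[xs xt]; have [] := f'P x xs xt.
      + by move=> x /abP[xs xt]; have [] := f'P x xs xt.
    move=> H; apply: le_trans (leeD gI H); rewrite -EFinD lee_fin.
    have -> : f (a l.+1) - f 0 = (f (a l) - f 0) + (f (a l.+1) - f (a l)) by ring.
    exact: ler_normD.
have [g [mg g0 gphi _]] := key N (leqnn N).
rewrite /a sN min_r// => /le_trans; apply.
by apply: le_lower_integral => x x01; [exact: g0|exact: gphi].
Qed.

End LowerIntegral.

(** * Curves, their speed and their length *)

Section PathConcatenation.
Context {R : realType} {T : topologicalType}.

Definition path_cat (f g : R -> T) (t : R) : T :=
  if t <= 1 / 2 then f (2 * t) else g (2 * t - 1).

Lemma path_cat_continuous (f g : R -> T) :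
  {within `[0, 1], continuous f} -> {within `[0, 1], continuous g} -> f 1 = g 0 ->
  {within `[0, 1], continuous (path_cat f g)}.
Proof.
move=> /subspace_continuousP cf /subspace_continuousP cg fg.
apply/subspace_continuousP => t /= t01 U.
have -> : nbhs (path_cat f g x @[x --> within `[0, 1]%classic (nbhs t)]) U =
    (\forall s \near within `[0, 1]%classic (nbhs t), U (path_cat f g s)) by [].
rewrite near_withinE => Ut0; have {Ut0} Ut : nbhs (path_cat f g t) U := Ut0.
have c2 : (fun s : R => 2 * s) @ t --> 2 * t by apply: mulrl_continuous.
have c21 : (fun s : R => 2 * s - 1) @ t --> 2 * t - 1 by apply: cvgB => //; exact: cvg_cst.
have nf : t <= 1 / 2 -> \forall s \near t, s \in `[0, 1] -> s <= 1 / 2 -> U (f (2 * s)).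
  move=> th; move: Ut; rewrite /path_cat ifT// => Ut.
  have t2 : 2 * t \in `[0, 1].
    by move: t01; rewrite !in_itv /= => /andP[t0 _]; apply/andP; split; lra.
  have := cf (2 * t) t2 U Ut.
  rewrite -[nbhs _ U]/(\forall s \near within `[0, 1]%classic (nbhs (2 * t)), U (f s)) near_withinE.
  move=> /c2 h; near=> s => s01 sh; have : 2 * s \in `[0, 1].
    by move: s01; rewrite !in_itv /= => /andP[s0 _]; apply/andP; split; lra.
  by near: s.
have ng : 1 / 2 <= t -> \forall s \near t, s \in `[0, 1] -> 1 / 2 <= s -> U (g (2 * s - 1)).
  move=> th; have {}Ut : nbhs (g (2 * t - 1)) U.
    move: Ut; rewrite /path_cat; case: ifPn => // th'.
    have -> : t = 1 / 2 by apply/eqP; rewrite eq_le th th'.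
    by rewrite mulrA mulr1 divff// subrr fg.
  have t2 : 2 * t - 1 \in `[0, 1].
    by move: t01; rewrite !in_itv /= => /andP[_ t1]; apply/andP; split; lra.
  have := cg (2 * t - 1) t2 U Ut.
  rewrite -[nbhs _ U]/(\forall s \near within `[0, 1]%classic (nbhs (2 * t - 1)), U (g s)) near_withinE.
  move=> /c21 h; near=> s => s01 sh; have : 2 * s - 1 \in `[0, 1].
    by move: s01; rewrite !in_itv /= => /andP[_ s1]; apply/andP; split; lra.
  by near: s.
have [th|th|th] := ltgtP t (1 / 2).
- near=> s => s01; rewrite /path_cat; have sh : s < 1 / 2 by near: s; exact: lt_nbhsl.
  by rewrite ltW//; move: s01 (ltW sh); near: s; apply: nf; exact: ltW.
- near=> s => s01; rewrite /path_cat; have sh : 1 / 2 < s by near: s; exact: lt_nbhsr.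
  by rewrite leNgt sh /=; move: s01 (ltW sh); near: s; apply: ng; exact: ltW.
- near=> s => s01; rewrite /path_cat; case: leP => sh.
    by move: s01 sh; near: s; apply: nf; rewrite th.
  by move: s01 (ltW sh); near: s; apply: ng; rewrite th.
Unshelve. all: by end_near. Qed.

End PathConcatenation.

Section Curves.
Context {R : realType} {m : nat} {M : closedManifold R m}.
Variable g : riemannianMetric M.
Local Notation E := 'rV[R]_m.
Implicit Types (i j l : chart_index M) (x y z : M) (c : R -> M) (t : R).

Definition quad i (xi v : E) : R := (v *m gram g i xi *m v^T) 0 0.

Lemma quadZ i xi (a : R) v : quad i xi (a *: v) = a ^+ 2 * quad i xi v.
Proof.
by rewrite /quad linearZ /= -!scalemxAl -scalemxAr !mxE mulrA expr2.
Qed.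

Lemma norm_coord_le (p q : nat) (A : 'M[R]_(p, q)) a b : `|A a b| <= `|A|.
Proof. by rewrite [leRHS]/Num.Def.normr/= mx_normrE; exact: (le_bigmax _ _ (a, b)). Qed.

Lemma quad_le i xi v : `|quad i xi v| <= m%:R ^+ 2 * `|gram g i xi| * `|v| ^+ 2.
Proof.
rewrite /quad mxE; apply: le_trans (ler_norm_sum _ _ _) _.
have -> : m%:R ^+ 2 * `|gram g i xi| * `|v| ^+ 2 =
    \sum_(b < m) (m%:R * (`|v| * `|gram g i xi|)) * `|v|.
  by rewrite sumr_const card_ord -mulr_natl; ring.
apply: ler_sum => b _; rewrite normrM ler_pM// ?mxE ?norm_coord_le//.
apply: le_trans (ler_norm_sum _ _ _) _.
have -> : m%:R * (`|v| * `|gram g i xi|) = \sum_(a < m) (`|v| * `|gram g i xi|).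
  by rewrite sumr_const card_ord mulr_natl.
by apply: ler_sum => a _; rewrite normrM ler_pM// norm_coord_le.
Qed.

(** [speed] uses the chart attached to c t, which changes along the curve; compatibility of the
    metric allows any chart around the point. *)
Lemma speed_chart c t i : dom i (c t) -> c @ t --> c t ->
  differentiable (chart i \o c : R^o -> E) t ->
  speed g c t = Num.sqrt (quad i (chart i (c t)) ('D_1 (chart i \o c : R^o -> E) t)).
Proof.
move=> ci ct dc; rewrite /speed; set j := chart_at (c t).
have cj : dom j (c t) := chart_at_dom (c t).
set v := 'D_1 (chart i \o c : R^o -> E) t.
have dT : differentiable (transition i j) (chart i (c t)).
  have cid : continuous (idfun : M -> M) by move=> y; exact: cvg_id.
  have sT : smooth_on (chart i @` (dom i `&` dom j)) (transition i j).
    exact: chart_compatible.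
  exact: (smooth_on_differentiable sT (nbhs_local_dom cid ci cj)).
have -> : 'D_1 (chart j \o c : R^o -> E) t = 'D_v (transition i j) (chart i (c t)).
  transitivity ('D_1 (transition i j \o (chart i \o c : R^o -> E)) t).
    apply: near_eq_derive; have := ct _ (nbhs_dom ci).
    rewrite -[nbhs _ _]/(\forall s \near t, dom i (c s)).
    by apply: filterS => s si; rewrite /transition /= chartK.
  rewrite (deriveE (1 : R^o) (differentiable_comp dc dT)) (diff_comp dc dT) /=.
  by rewrite [RHS](deriveE _ dT) /v (deriveE (1 : R^o) dc).
by rewrite /quad (gram_compatible g ci cj).
Qed.

Definition regular c t (C : R) := exists i, [/\ dom i (c t), c @ t --> c t,
  differentiable (chart i \o c : R^o -> E) t &
  Num.sqrt (quad i (chart i (c t)) ('D_1 (chart i \o c : R^o -> E) t)) <= C].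

(** A pointwise bound on the speed bounds the length without measurability of the speed, and
    survives concatenation; the finite set F collects the times where the curve may have a
    corner. *)
Definition joined x y (C : R) := exists c (F : set R),
  [/\ finite_set F, piecewise_smooth c, c 0 = x, c 1 = y &
      forall t, t \in `[0, 1] -> ~ F t -> regular c t C].

Lemma riemannian_dist_ge0 x y : 0 <= riemannian_dist g x y.
Proof.
apply: fine_ge0; apply: le_ereal_inf_tmp => _ [c _ <-].
by apply: integral_ge0 => t _; rewrite lee_fin sqrtr_ge0.
Qed.

Lemma joined_inf_length x y C : 0 <= C -> joined x y C ->
  (ereal_inf [set curve_length g c | c in
    [set c | [/\ piecewise_smooth c, c 0%R = x & c 1%R = y]]] <= C%:E)%E.
Proof.
move=> C0 [c [F [fF pc c0 c1 reg]]].
have cF := finite_set_countable fF.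
have mF : measurable F by apply: countable_measurable.
have mF0 : lebesgue_measure F = 0%E by exact: countable_lebesgue_measure0.
have len : (curve_length g c <= C%:E)%E.
  (* A measurable majorant of the speed: infinite at the exceptional times, which form a null
     set. *)
  pose h : R -> \bar R := (cst C%:E \+ (cst +oo \_ F))%E.
  have mh : measurable_fun setT h.
    apply: emeasurable_funD; first exact: measurable_cst.
    by apply/(measurable_restrictT _ _).1 => //; exact: measurable_cst.
  have h0 t : (0 <= h t)%E.
    apply: adde_ge0; first by rewrite lee_fin.
    by rewrite patchE; case: ifPn => //= _; rewrite leey.
  apply: (@le_trans _ _ (\int[lebesgue_measure]_(t in `[0%R, 1%R]) h t)%E).
    apply: le_lower_integral => t t01; first by rewrite lee_fin sqrtr_ge0.
    rewrite /h /= patchE; case: ifPn => [_|]; first by rewrite leey.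
    rewrite notin_setE => Ft; have [i [ci ct dc sC]] := reg t t01 Ft.
    by rewrite adde0 lee_fin (speed_chart ci ct dc).
  have -> : (\int[lebesgue_measure]_(t in `[0%R, 1%R]) h t =
             \int[lebesgue_measure]_(t in `[0%R, 1%R] `\` F) h t)%E.
    by apply: ge0_negligible_integral => //; exact: measurable_funS mh.
  apply: (@le_trans _ _ (\int[lebesgue_measure]_(t in `[0%R, 1%R]) cst C%:E t)%E).
    apply: (@le_trans _ _ (\int[lebesgue_measure]_(t in `[0%R, 1%R] `\` F) cst C%:E t)%E).
      apply: le_lower_integral => t [_ /= Ft]; first by rewrite h0.
      by rewrite /h /= patchE ifF ?adde0//; apply/negbTE; rewrite notin_setE.
    by apply: ge0_subset_integral => //; exact: measurableD.
  by rewrite integral_cst//= lebesgue_measure_itv /= lte_fin ltr01 -EFinD subr0 mule1.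
by apply: ge_ereal_inf; exists (curve_length g c) => //; exists c.
Qed.

(** [fine] would replace an infinite infimum by 0; a joining curve of bounded speed excludes this
    case. *)
Lemma riemannian_distE x y C : 0 <= C -> joined x y C ->
  (riemannian_dist g x y)%:E = ereal_inf [set curve_length g c | c in
    [set c | [/\ piecewise_smooth c, c 0 = x & c 1 = y]]].
Proof.
move=> C0 /(joined_inf_length C0) inf_le.
rewrite /riemannian_dist fineK// ge0_fin_numE; first exact: le_lt_trans inf_le (ltry _).
apply: le_ereal_inf_tmp => _ [c' _ <-].
by apply: integral_ge0 => t _; rewrite lee_fin sqrtr_ge0.
Qed.

Lemma joined_dist x y C : 0 <= C -> joined x y C -> riemannian_dist g x y <= C.
Proof.
by move=> C0 xy; rewrite -lee_fin (riemannian_distE C0 xy); exact: joined_inf_length.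
Qed.

End Curves.

Section JoiningCurves.
Context {R : realType} {m : nat} {M : closedManifold R m}.
Variable g : riemannianMetric M.
Local Notation E := 'rV[R]_m.
Implicit Types (i j l : chart_index M) (x y z : M) (c : R -> M) (t : R).

Lemma affine_cvg (xi v : E) t : (fun s : R^o => xi + s *: v) @ t --> xi + t *: v.
Proof.
by apply: cvgD; [exact: cvg_cst|apply: cvgZ; [exact: cvg_id|exact: cvg_cst]].
Qed.

Lemma is_diff_affine (xi v : E) t :
  differentiable (fun s : R^o => xi + s *: v) t /\
  'D_1 (fun s : R^o => xi + s *: v) t = v.
Proof.
have d1 : differentiable (fun s : R^o => s *: v) t.
  by apply: differentiableZ_fun.
split; first by apply: differentiableD.
rewrite deriveD; [|exact/diff_derivable|exact/diff_derivable].
rewrite derive_cst add0r deriveZ_fun// derive_id derive_cst scaler0 add0r.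
by rewrite scale1r.
Qed.

Lemma smooth_on_affine (A : set R^o) (xi v : E) : smooth_on A (fun s : R^o => xi + s *: v).
Proof.
apply: (@smooth_on_sub _ _ _ setT) => //.
apply: smooth_open_on; first exact: openT.
move=> k; apply: (@CkD _ _ _ _ _ (cst xi) (fun s : R^o => s *: v));
  [exact: openT|exact: Ck_cst|].
apply: CkZ; [exact: openT| |exact: Ck_cst].
by apply: (@Ck_linear _ _ _ _ _ (idfun : {linear R^o -> R^o})) => s; exact: cvg_id.
Qed.

Lemma ball_convex (xi0 xi eta : E) (r t : R) : `|xi - xi0| < r -> `|eta - xi0| < r ->
  t \in `[0, 1] -> `|xi + t *: (eta - xi) - xi0| < r.
Proof.
move=> h1 h2; rewrite in_itv /= => /andP[t0 t1].
have -> : xi + t *: (eta - xi) - xi0 = (1 - t) *: (xi - xi0) + t *: (eta - xi0).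
  apply/matrixP => a b; rewrite !mxE; ring.
apply: le_lt_trans (ler_normD _ _) _; rewrite !normrZ (ger0_norm t0) ger0_norm ?subr_ge0//.
have [->|tn] := eqVneq t 0; first by rewrite subr0 mul1r mul0r addr0.
have tp : 0 < t by rewrite lt_neqAle eq_sym tn.
have -> : r = (1 - t) * r + t * r by ring.
apply: ler_ltD.
  by rewrite ler_wpM2l ?subr_ge0// ltW.
by rewrite ltr_pM2l.
Qed.

(* Straight segments in a chart have small speed. *)
Lemma joined_segment x0 (e : R) : 0 < e -> \forall p \near (x0, x0), joined g p.1 p.2 e.
Proof.
move=> e0; set i := chart_at x0; have xi0 : dom i x0 := chart_at_dom x0.
set u0 := chart i x0.
pose K := `|gram g i u0| + 1.
have K0 : 0 <= K by rewrite addr_ge0.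
have nK : \forall u \near u0, `|gram g i u| < K.
  have cg := smooth_on_open_continuous (@gram_smooth _ _ _ g i) (nbhs_img (img_chart xi0)).
  move/cvgrPdist_lt : cg => /(_ 1 ltr01); apply: filterS => u h.
  rewrite -[gram g i u](subrK (gram g i u0)) (le_lt_trans (ler_normD _ _))//.
  by rewrite /K addrC ltrD2l distrC.
have [r /= r0 rP] : exists2 r, 0 < r & forall u, `|u - u0| < r ->
    (chart i @` dom i) u /\ `|gram g i u| < K.
  have /nbhs_ballP[r r0 rP] : \forall u \near u0, (chart i @` dom i) u /\ `|gram g i u| < K.
    by apply: filterI => //; exact: (nbhs_img (img_chart xi0)).
  by exists r => // u h; apply: rP; rewrite -ball_normE /= distrC.
(* The quadratic form is at most m^2 K |v|^2, and K <= (K + 1)^2 permits taking the square root. *)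
pose B := m%:R * (K + 1).
have B0 : 0 <= B by rewrite mulr_ge0// addr_ge0.
have quadB u v : `|u - u0| < r -> Num.sqrt (quad g i u v) <= B * `|v|.
  move=> h; have Bv : 0 <= B * `|v| by rewrite mulr_ge0.
  rewrite -[leRHS]ger0_norm// -sqrtr_sqr.
  rewrite ler_wsqrtr// (le_trans (ler_norm _))// (le_trans (quad_le _ _ _ _))//.
  rewrite exprMn ler_wpM2r ?exprn_ge0//.
  rewrite /B exprMn ler_wpM2l ?exprn_ge0//.
  rewrite (le_trans (ltW (rP u h).2))//.
  have -> : (K + 1) ^+ 2 = K + (K ^+ 2 + K + 1) by ring.
  by rewrite lerDl !addr_ge0// exprn_ge0.
(* Two points of the d-ball differ by at most 2 d, so the segment has speed at most 2 B d <= e; d <=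
   r keeps it where the bounds hold. *)
pose d := Num.min r (e / (2 * (B + 1))).
have B1 : 0 < B + 1 by rewrite ltr_pwDr.
have d0 : 0 < d by rewrite lt_min r0 divr_gt0// mulr_gt0.
have nd : \forall x \near x0, dom i x /\ `|chart i x - u0| < d.
  apply: filterI; first exact: nbhs_dom.
  move/cvgrPdist_lt : (chart_cvg xi0) => /(_ d d0); apply: filterS => x.
  by rewrite distrC.
have key x y : dom i x /\ `|chart i x - u0| < d -> dom i y /\ `|chart i y - u0| < d ->
    joined g x y e.
  move=> [xi xd] [yi yd].
  pose v := chart i y - chart i x.
  have dr : d <= r by rewrite ge_min lexx.
  have seg t : t \in `[0, 1] -> `|chart i x + t *: v - u0| < r.
    by move=> t01; apply: ball_convex => //; exact: lt_le_trans dr.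
  have ve : B * `|v| <= e.
    have v2 : `|v| <= 2 * d.
      rewrite /v -(subrKA u0) (le_trans (ler_normD _ _))// mulr2n mulrDl mul1r.
      by rewrite lerD// ltW// distrC.
    apply: (@le_trans _ _ ((B + 1) * (2 * d))).
      by rewrite ler_pM// lerDl.
    rewrite mulrA -ler_pdivlMl ?mulr_gt0// mulrC [(B + 1) * 2]mulrC.
    by rewrite ge_min lexx orbT.
  pose c t := chart_inv i (chart i x + t *: v).
  have cc t : t \in `[0, 1] -> c @ t --> c t.
    move=> t01; have [ui _] := rP _ (seg t t01).
    exact: (cvg_comp _ _ (@affine_cvg (chart i x) v t) (@chart_inv_continuous _ _ _ i _ ui)).
  have nc t : t \in `[0, 1] -> \forall s \near t, chart i x + s *: v = (chart i \o c) s.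
    move=> t01; have [ui _] := rP _ (seg t t01).
    have := @affine_cvg (chart i x) v t _ (nbhs_img ui).
    rewrite -[nbhs _ _]/(\forall s \near t, (chart i @` dom i) (chart i x + s *: v)).
    by apply: filterS => s si; rewrite /c /=; have [_ ->] := imgP si.
  exists c, set0; split => //.
  - split.
      by apply/subspace_continuousP => t t01; apply: cvg_within_filter; exact: cc.
    exists 1%N, (fun k : nat => k%:R); split=> // -[|//] _; split; first exact: ltr01.
    move=> j.
    pose af := fun s : R^o => chart i x + s *: v.
    apply: (@smooth_on_comp _ _ _ _ _ (chart i @` (dom i `&` dom j)) af (transition i j)).
    + exact: has_coordinates_rV.
    + move=> t [t01 cj]; have [ui _] := rP _ (seg t t01).
      by have [ci cK] := imgP ui; exists (c t).
    + exact: smooth_on_affine.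
    + exact: chart_compatible.
  - by rewrite /c scale0r addr0 chartK.
  - by rewrite /c scale1r /v addrC subrK chartK.
  - move=> t t01 _; exists i; have [ui _] := rP _ (seg t t01).
    have [ci cK] := imgP ui; have [daf Daf] := is_diff_affine (chart i x) v t.
    split=> //; first exact: cc.
      exact: near_eq_differentiable (nc t t01) daf.
    rewrite -(near_eq_derive _ (nc t t01)) Daf.
    apply: le_trans ve; rewrite /c cK; apply: quadB; exact: seg.
have /= : \forall p \near (x0, x0), (dom i p.1 /\ `|chart i p.1 - u0| < d) /\
   (dom i p.2 /\ `|chart i p.2 - u0| < d).
  by exists ([set x | dom i x /\ `|chart i x - u0| < d], [set x | dom i x /\ `|chart i x - u0| < d]).
by apply: filterS => p [h1 h2]; exact: key.
Qed.

End JoiningCurves.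

Section JoiningCurvesGlobal.
Context {R : realType} {m : nat} {M : closedManifold R m}.
Variable g : riemannianMetric M.
Local Notation E := 'rV[R]_m.
Implicit Types (i j : chart_index M) (x y z : M) (c : R -> M) (t : R).

Lemma smooth_on_rescale (W : normedModType R) (A B : set R^o) (f h : R^o -> W) (a b : R) :
  (forall t, A t -> B (a + b * t) /\ h t = f (a + b * t)) -> smooth_on B f -> smooth_on A h.
Proof.
move=> AB fB; apply: (@smooth_on_eq _ _ _ _ (f \o (fun t : R^o => a + b * t : R^o))).
  by move=> t /AB[_ ->].
apply: (smooth_on_comp (B := B)).
- exact: has_coordinates_R.
- by move=> t /AB[].
- apply: (@smooth_on_sub _ _ _ setT) => //.
  by apply: smooth_open_on; [exact: openT|exact: smooth_affine].
- exact: fB.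
Qed.

Lemma piecewise_smooth_cat c1 c2 : piecewise_smooth c1 -> piecewise_smooth c2 ->
  c1 1 = c2 0 -> piecewise_smooth (path_cat c1 c2).
Proof.
move=> [cc1 [N1 [s1 [s10 s1N ss1]]]] [cc2 [N2 [s2 [s20 s2N ss2]]]] c12.
split; first exact: path_cat_continuous.
have b1 := breakpoints_itv s10 s1N (fun l h => (ss1 l h).1).
have b2 := breakpoints_itv s20 s2N (fun l h => (ss2 l h).1).
pose s (k : nat) := if (k <= N1)%N then s1 k / 2 else 1 / 2 + s2 (k - N1)%N / 2.
(* At the junction k = N1 the two formulas for s agree. *)
have sE k : (N1 <= k)%N -> s k = 1 / 2 + s2 (k - N1)%N / 2.
  move=> Nk; rewrite /s; case: ifPn => // kN.
  have -> : k = N1 by apply/eqP; rewrite eqn_leq kN.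
  by rewrite subnn s20 s1N mul0r addr0.
exists (N1 + N2)%N, s; split.
- by rewrite /s s10 mul0r.
- by rewrite sE ?leq_addr// addKn s2N; lra.
move=> k kN; have [kN1|kN1] := ltnP k N1.
  have [sk sm] := ss1 k kN1.
  have Ek : s k = s1 k / 2 by rewrite /s ltnW.
  have Ek1 : s k.+1 = s1 k.+1 / 2 by rewrite /s kN1.
  rewrite Ek Ek1; split; first by lra.
  move=> j; apply: (smooth_on_rescale (a := 0) (b := 2) _ (sm j)) => t [+ tj].
  rewrite in_itv /= => /andP[t1 t2].
  have /andP[_ h1] := b1 k.+1 kN1.
  have th : t <= 1 / 2 by lra.
  have E : path_cat c1 c2 t = c1 (0 + 2 * t) by rewrite /path_cat th add0r.
  rewrite E in tj; split; last by rewrite /comp E.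
  by split=> //; rewrite in_itv /= add0r; apply/andP; split; lra.
have kN2 : (k - N1 < N2)%N by rewrite ltn_subLR.
have [sk sm] := ss2 _ kN2.
rewrite sE// sE; last exact: leqW.
rewrite subSn//; split; first by lra.
move=> j; apply: (smooth_on_rescale (a := -1) (b := 2) _ (sm j)) => t [+ tj].
rewrite in_itv /= => /andP[t1 t2].
have /andP[h0 _] := b2 (k - N1)%N (ltnW kN2).
have th : 1 / 2 <= t by lra.
have E : path_cat c1 c2 t = c2 (-1 + 2 * t).
  rewrite /path_cat [-1 + _]addrC; case: ifPn => // th'.
  have -> : t = 1 / 2 by apply/eqP; rewrite eq_le th' th.
  by rewrite mulrA mulr1 divff// subrr.
rewrite E in tj; split; last by rewrite /comp E.
by split=> //; rewrite in_itv /=; apply/andP; split; lra.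
Qed.

Lemma regular_rescale c c' (a b t C : R) : 0 < b ->
  (\forall s \near t, c' s = c (a + b * s)) -> regular g c (a + b * t) C ->
  regular g c' t (b * C).
Proof.
move=> b0 cc' [i [ci ct dc sC]].
have e := nbhs_singleton cc'.
pose af := fun s : R^o => a + b * s : R^o.
have caf : af @ t --> af t.
  exact: (smooth_open_continuous (smooth_affine a b) (x := t) I).
have daf : differentiable af t by exact: (smooth_open_differentiable (smooth_affine a b) I).
have Daf : 'D_1 af t = b.
  have d2 : derivable (fun s : R^o => b *: s) t 1.
    by apply: derivableZ; exact: derivable_id.
  rewrite (deriveD (derivable_cst (a : R^o) (t : R^o) (1 : R^o)) d2) derive_cst add0r.
  rewrite (@deriveZ _ _ _ (id : R^o -> R^o) b t 1); last exact: derivable_id.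
  by rewrite derive_id [LHS]mulr1.
have near_c : \forall s \near t, ((chart i \o c : R^o -> E) \o af) s = (chart i \o c') s.
  by apply: filterS cc' => s /= ->.
have dcaf : differentiable ((chart i \o c : R^o -> E) \o af) t.
  exact: differentiable_comp.
exists i; rewrite e; split=> //.
- have : c \o af @ t --> c (a + b * t) by exact: (cvg_comp af c caf ct).
  apply: cvg_trans; apply: near_eq_cvg; apply: filterS cc' => s -> //.
- exact: near_eq_differentiable near_c dcaf.
rewrite -(near_eq_derive _ near_c) (deriveE (1 : R^o) dcaf) (diff_comp daf dc) /=.
rewrite -(deriveE (1 : R^o) daf) Daf.
have -> : 'd (chart i \o c : R^o -> E) (af t) b = b *: 'D_1 (chart i \o c : R^o -> E) (af t).
  rewrite (deriveE (1 : R^o) dc) -linearZ /=; congr ('d _ _ _).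
  by rewrite [RHS]mulr1.
by rewrite quadZ sqrtrM ?sqr_ge0// sqrtr_sqr gtr0_norm// ler_pM2l.
Qed.

(** Each half is run through at double speed. *)
Lemma joined_trans y x z C : joined g x y C -> joined g y z C -> joined g x z (2 * C).
Proof.
move=> [c1 [F1 [fF1 pc1 c10 c11 reg1]]] [c2 [F2 [fF2 pc2 c20 c21 reg2]]].
have c12 : c1 1 = c2 0 by rewrite c11 c20.
(* The exceptional times of both curves, rescaled, together with the junction, where the velocity
   may jump. *)
pose F := [set u / 2 | u in F1] `|` [set (u + 1) / 2 | u in F2] `|` [set 1 / 2].
exists (path_cat c1 c2), F; split.
- rewrite /F !finite_setU; split; last exact: finite_set1.
  by split; exact: finite_image.
- exact: piecewise_smooth_cat.
- by rewrite /path_cat ifT ?mulr0// divr_ge0.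
- rewrite /path_cat ifF; last by apply/negbTE; rewrite -ltNge; lra.
  by have -> : 2 * 1 - 1 = 1 :> R by ring.
move=> t; rewrite in_itv /= => /andP[t0 t1] nF.
have [th|th|th] := ltgtP t (1 / 2).
- apply: (@regular_rescale c1 _ 0 2) => //.
    near=> s; rewrite /path_cat ifT ?add0r//; apply: ltW; near: s; exact: lt_nbhsl.
  apply: reg1; first by rewrite in_itv /= add0r; apply/andP; split; lra.
  rewrite add0r => F1t; apply: nF; left; left; exists (2 * t) => //; lra.
- apply: (@regular_rescale c2 _ (-1) 2) => //.
    near=> s; rewrite /path_cat ifF; first by rewrite addrC.
    apply/negbTE; rewrite -ltNge; near: s; exact: lt_nbhsr.
  apply: reg2; first by rewrite in_itv /=; apply/andP; split; lra.
  move=> F2t; apply: nF; left; right; exists (-1 + 2 * t) => //; lra.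
- by exfalso; apply: nF; right.
Unshelve. all: by end_near. Qed.

Lemma joinedW x y C D : C <= D -> joined g x y C -> joined g x y D.
Proof.
move=> CD [c [F [fF pc c0 c1 reg]]]; exists c, F; split=> // t t01 Ft.
by have [i [h1 h2 h3 h4]] := reg t t01 Ft; exists i; split=> //; exact: le_trans CD.
Qed.

Lemma joined_ex_trans y x z : (exists C, joined g x y C) -> (exists C, joined g y z C) ->
  exists C, joined g x z C.
Proof.
move=> [C xy] [D yz]; exists (2 * Num.max C D).
apply: (@joined_trans y); [apply: joinedW xy|apply: joinedW yz]; by rewrite le_max lexx ?orbT.
Qed.

Lemma joined_near x : \forall y \near x, joined g x y 1 /\ joined g y x 1.
Proof.
have [[A B] /= [xA xB] AB] := joined_segment g x ltr01.
have nAB : nbhs x (A `&` B) by apply: filterI.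
apply: filterS nAB => y [Ay By]; split.
  by apply: (AB (x, y)); split=> //; exact: nbhs_singleton xA.
by apply: (AB (y, x)); split=> //; exact: nbhs_singleton xB.
Qed.

(** The set of points joined to x is open and closed by [joined_near], and M is connected. *)
Lemma joined_all x y : exists C, joined g x y C.
Proof.
pose A := [set y | exists C, joined g x y C].
suff AT : A = [set: M] by have : A y by rewrite AT.
have := @manifold_connected _ _ M; apply.
- exists x; have [h _] := nbhs_singleton (joined_near x); by exists 1.
- exists A; last by rewrite setTI.
  rewrite openE => z Az; have := joined_near z; apply: filterS => w [zw _].
  by apply: (joined_ex_trans (y := z)) => //; exists 1.
- exists A; last by rewrite setTI.
  move=> z /(_ _ (joined_near z))[w [Aw [_ wz]]].
  by apply: (joined_ex_trans (y := w)) => //; exists 1.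
Qed.

Lemma joined_bounded : exists2 C, 0 < C & forall x y, joined g x y C.
Proof.
have cM := @manifold_compact _ _ M.
have : compact ([set: M] `*` [set: M]) by apply: compact_setX.
move=> /compact_near_coveringP/(_ _ (+oo : set_system R) (fun C p => joined g p.1 p.2 C)) cov.
have H : \forall C \near +oo, [set: M] `*` [set: M] `<=` (fun p => joined g p.1 p.2 C).
  apply: cov => -[x y] _ /=.
  have [C xy] := joined_all x y.
  (* For a near x and b near y the curve runs a, x, y, b. It takes two concatenations, each doubling
     the bound; hence the factor 4. *)
  exists ([set p | joined g p.1 x 1 /\ joined g y p.2 1], [set D | 4 * Num.max C 1 <= D]).
    split => /=; last by apply: nbhs_pinfty_ge; exact: num_real.
    exists ([set a | joined g a x 1], [set b | joined g y b 1]); last by move=> p [].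
    split=> /=.
      by have := joined_near x; apply: filterS => z [].
    by have := joined_near y; apply: filterS => z [].
  move=> [[a b] D] [/= [ax yb] CD].
  have m1 : 1 <= Num.max C 1 by rewrite le_max lexx orbT.
  have mC : C <= Num.max C 1 by rewrite le_max lexx.
  apply: (joinedW CD).
  have -> : 4 * Num.max C 1 = 2 * (2 * Num.max C 1) by ring.
  apply: (@joined_trans y); last by apply: joinedW yb; rewrite (le_trans m1)// ler_peMl//; lra.
  by apply: (@joined_trans x); [apply: joinedW ax|apply: joinedW xy].
have /filter_ex[C [CP C0]] : \forall C \near +oo, ([set: M] `*` [set: M] `<=` (fun p => joined g p.1 p.2 C)) /\ 0 < C.
  by apply: filterI => //; apply: nbhs_pinfty_gt; exact: num_real.
by exists C => // x y; exact: (CP (x, y)).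
Qed.

End JoiningCurvesGlobal.

(** * A lower bound for the Riemannian distance *)

Section LowerBound.
Context {R : realType} {m : nat} {M : closedManifold R m}.
Variables (g : riemannianMetric M) (P : partitionOfUnity M).
Local Notation E := 'rV[R]_m.
Local Notation rho := (rho P).
Implicit Types (i j : chart_index M) (x y z : M) (c : R -> M) (t : R).

Lemma cvg_quadratic (T : Type) (F : set_system T) (G : T -> 'M[R]_m) (v : T -> E)
    (G0 : 'M[R]_m) (v0 : E) :
  Filter F -> G @ F --> G0 -> v @ F --> v0 ->
  (v p *m G p *m (v p)^T) 0 0 @[p --> F] --> (v0 *m G0 *m v0^T) 0 0.
Proof.
move=> FF cG cv.
have cv' a : (v p) 0 a @[p --> F] --> v0 0 a.
  exact: (cvg_comp v (fun w : E => w 0 a) cv (@coord_continuous _ _ _ 0 a v0)).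
have cG' a b : (G p) a b @[p --> F] --> G0 a b.
  exact: (cvg_comp G (fun w : 'M[R]_m => w a b) cG (@coord_continuous _ _ _ a b G0)).
under eq_fun do rewrite mxE.
rewrite mxE; apply: cvg_big => [|b _]; first exact: add_continuous.
rewrite mxE; under eq_fun do rewrite !mxE.
apply: cvgM; last by rewrite mxE; exact: cv'.
by apply: cvg_big => [|a _]; [exact: add_continuous|exact: cvgM].
Qed.

(** The form is positive on the compact unit sphere, uniformly for base points near x0; homogeneity
    extends the bound to all vectors. *)
Lemma quad_lower i x0 : dom i x0 -> exists2 k : R, 0 < k &
  \forall u \near chart i x0, forall v : E, k * `|v| <= Num.sqrt (quad g i u v).
Proof.
move=> xi; set u0 := chart i x0.
have cg := smooth_on_open_continuous (@gram_smooth _ _ _ g i) (nbhs_img (img_chart xi)).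
pose S := [set v : E | `|v| = 1].
have cS : compact S.
  apply: bounded_closed_compact.
    by exists 1; split; [exact: num_real|move=> r r1 v /= ->; exact: ltW].
  have -> : S = (fun v : E => `|v|) @^-1` [set 1] by [].
  by apply: preimage_closed; [move=> v _; exact: norm_continuous|exact: closed_eq].
move/compact_near_coveringP : cS => /(_ _ (filter_prod (nbhs u0) (0^'+))
  (fun q v => S v -> q.2 < quad g i q.1 v) _) cov.
have H : \forall q \near filter_prod (nbhs u0) (0^'+),
    S `<=` (fun v => S v -> q.2 < quad g i q.1 v).
  apply: cov => v Sv.
  have vn0 : v != 0 by apply/eqP => v0; move: Sv; rewrite /S /= v0 normr0 => /eqP; rewrite eq_sym oner_eq0.
  have q0 : 0 < quad g i u0 v by exact: gram_posdef.
  have cq : quad g i p.1 p.2 @[p --> (u0, v)] --> quad g i u0 v.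
    apply: cvg_quadratic; last exact: cvg_snd.
    exact: (cvg_comp fst (gram g i) cvg_fst cg).
  have : \forall p \near (u0, v), quad g i u0 v / 2 < quad g i p.1 p.2.
    apply: (cq [set r | quad g i u0 v / 2 < r]); apply: lt_nbhsr.
    by rewrite ltr_pdivrMr// ltr_pMr// ltr1n.
  move=> [[A B] /= [uA vB] AB].
  exists (B, A `*` [set d | d < quad g i u0 v / 2]).
    split=> //=; exists (A, [set d | d < quad g i u0 v / 2]) => //; split=> //=.
    by apply: nbhs_right_lt; rewrite divr_gt0.
  move=> [w [u d]] [/= Bw [Au du]] _; apply: (lt_trans du); exact: (AB (u, w)).
have [[A B] /= [uA dB] AB] := H.
have /filter_ex[d [Bd d0]] : \forall d \near 0^'+, B d /\ 0 < d.
  by apply: filterI => //; exact: nbhs_right_gt.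
exists (Num.sqrt d); first by rewrite sqrtr_gt0.
apply: filterS uA => u Au v.
have [->|vn0] := eqVneq v 0; first by rewrite normr0 mulr0 sqrtr_ge0.
have nv : 0 < `|v| by rewrite normr_gt0.
pose w := `|v|^-1 *: v.
have Sw : S w by rewrite /S /w /= normrZ normfV normr_id mulVf// gt_eqF.
have -> : v = `|v| *: w by rewrite /w scalerA divff ?scale1r// gt_eqF.
rewrite quadZ sqrtrM ?sqr_ge0// sqrtr_sqr normrZ normr_id.
have -> : `|w| = 1 by exact: Sw.
rewrite mulr1 mulrC ler_wpM2l// ler_wsqrtr// ltW//.
exact: (AB (u, d)).
Qed.

Lemma exit_time c (B : set M) : open B -> {within `[0, 1], continuous c} ->
  B (c 0) -> ~ B (c 1) -> exists tau, [/\ 0 < tau, tau <= 1, ~ B (c tau) &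
    forall t, 0 <= t -> t < tau -> B (c t)].
Proof.
move=> oB /subspace_continuousP cc B0 B1.
pose T := [set t | t \in `[0, 1] /\ ~ B (c t)].
have T1 : T 1 by split=> //; rewrite in_itv /= ler01 lexx.
have hT : has_inf T.
  by split; [exists 1|exists 0 => t [+ _]; rewrite in_itv /= => /andP[]].
have tau0 : 0 <= inf T.
  by apply: lb_le_inf; [exists 1|move=> t [+ _]; rewrite in_itv /= => /andP[]].
have tau1 : inf T <= 1 by apply: ge_inf => //; case: hT.
have nB : ~ B (c (inf T)).
  move=> BT; have tI : inf T \in `[0, 1] by rewrite in_itv /= tau0.
  have := cc _ tI B (open_nbhs_nbhs (conj oB BT)).
  rewrite -[nbhs _ B]/(\forall s \near within `[0, 1]%classic (nbhs (inf T)), B (c s)) near_withinE.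
  move=> /nbhs_ballP[e /= e0 eP].
  have [s [sI Bs] st] := inf_adherent e0 hT.
  have Ts : inf T <= s by apply: ge_inf; [case: hT|split].
  apply: Bs; apply: eP => //; rewrite /ball /= ler0_norm ?subr_le0//.
  by rewrite opprB ltrBlDl.
exists (inf T); split=> //.
  by rewrite lt_neqAle tau0 andbT; apply/eqP => T0; apply: nB; rewrite -T0.
move=> t t0 tT; apply: contrapT => nBt.
have Tt : T t by split=> //; rewrite in_itv /= t0 (le_trans (ltW tT)).
by move: tT; rewrite ltNge ge_inf//; case: hT.
Qed.

Lemma coord_norm_gt (v : E) (r : R) : 0 < r -> r < `|v| -> exists k, r < `|v 0 k|.
Proof.
move=> r0 rv; have v0 : mx_norm v != 0 by rewrite gt_eqF// (lt_trans r0).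
have [[a k] /= vk] := mx_norm_neq0 v0.
by exists k; move: rv; rewrite [ltRHS]/Num.Def.normr/= vk (ord1 a).
Qed.

(** If rho x y >= e, then y lies outside a coordinate ball B around x0. A curve from x to y must
    leave B; up to the exit one coordinate changes by more than r, at a rate of at most speed / k,
    so the length is at least k r. *)
Lemma dist_lower x0 (e : R) : 0 < e -> exists2 d, 0 < d &
  \forall x \near x0, forall y, riemannian_dist g x y < d -> rho x y < e.
Proof.
move=> e0; set i := chart_at x0; have xi0 : dom i x0 := chart_at_dom x0.
set u0 := chart i x0.
have [k k0 nk] := quad_lower xi0.
have e20 : 0 < e / 2 by rewrite divr_gt0.
have nrho : \forall u \near u0, rho x0 (chart_inv i u) < e / 2.
  have : (fun u => rho x0 (chart_inv i u)) @ u0 --> (0 : R).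
    have c1 : (fun u => (x0, chart_inv i u)) @ u0 --> (x0, x0).
      apply: (@cvg_pair _ _ _ (nbhs u0) (nbhs x0) (nbhs x0)); first exact: cvg_cst.
      exact: (chart_inv_cvg xi0).
    rewrite -[X in _ --> X](rhoxx P x0).
    exact: (cvg_comp _ (fun p : M * M => rho p.1 p.2) c1 (@rho_continuous _ _ _ P (x0, x0))).
  by move=> /(_ [set s | s < e / 2]); apply; exact: lt_nbhsl.
have [r0 /= r00 r0P] : exists2 r, 0 < r & forall u, `|u - u0| < r ->
    [/\ (chart i @` dom i) u, forall v, k * `|v| <= Num.sqrt (quad g i u v) &
        rho x0 (chart_inv i u) < e / 2].
  have /nbhs_ballP[r r1 rP] : \forall u \near u0, [/\ (chart i @` dom i) u,
      forall v, k * `|v| <= Num.sqrt (quad g i u v) & rho x0 (chart_inv i u) < e / 2].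
    near=> u; split; near: u => //; exact: (nbhs_img (img_chart xi0)).
  by exists r => // u h; apply: rP; rewrite -ball_normE /= distrC.
(* The curve starts within r of u0 and leaves at 2 r, so it covers at least r; and 2 r < r0 keeps
   the closed ball inside the region of the estimates. *)
pose r := r0 / 3.
have rp : 0 < r by rewrite divr_gt0.
have r2 : 2 * r < r0 by rewrite /r; lra.
pose B := [set z | dom i z /\ `|chart i z - u0| < 2 * r].
have oB : open B.
  rewrite openE => z [zi zr]; apply: filterI; first exact: nbhs_dom.
  have : (fun w => `|chart i w - u0|) @ z --> `|chart i z - u0|.
    by apply: cvg_norm; apply: cvgB; [exact: chart_cvg|exact: cvg_cst].
  by move=> /(_ [set s | s < 2 * r]); apply; exact: lt_nbhsl.
(* At the exit time the curve is only in the closure of B. As the image of a compact coordinate ball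
   K is closed, so this point still lies in the chart. *)
pose K := [set z | dom i z /\ `|chart i z - u0| <= 2 * r].
have cK : closed K.
  apply: compact_closed; first exact: manifold_hausdorff.
  pose D := [set u : E | `|u - u0| <= 2 * r].
  have DP u : D u -> (chart i @` dom i) u by move=> Du; have [] := r0P u (le_lt_trans Du r2).
  have -> : K = chart_inv i @` D.
    apply/seteqP; split=> z.
      by move=> [zi zr]; exists (chart i z) => //; rewrite chartK.
    by move=> [u Du <-]; have [ui uK] := imgP (DP u Du); split=> //; rewrite uK.
  apply: continuous_compact.
    apply/subspace_continuousP => u Du; apply: cvg_within_filter.
    exact: (@chart_inv_continuous _ _ _ i _ (DP u Du)).
  apply: bounded_closed_compact.
    exists (2 * r + `|u0|); split; first exact: num_real.
    move=> s sr u /= Du; apply: ltW; apply: le_lt_trans sr.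
    by rewrite -(subrK u0 u) (le_trans (ler_normD _ _))// lerD2r.
  have -> : D = (fun u : E => `|u - u0|) @^-1` [set s | s <= 2 * r] by [].
  apply: preimage_closed; last exact: closed_le.
  move=> u _; have cu : (fun w : E => w - u0) @ u --> u - u0.
    apply: (@cvgB _ _ _ (nbhs u) _ idfun (cst u0)); first exact: cvg_id.
    exact: cvg_cst.
  exact: (cvg_norm cu).
exists (k * r); first by rewrite mulr_gt0.
have nW : \forall x \near x0, dom i x /\ `|chart i x - u0| < r.
  apply: filterI; first exact: nbhs_dom.
  move/cvgrPdist_lt : (chart_cvg xi0) => /(_ r rp); apply: filterS => x.
  by rewrite distrC.
apply: filterS nW => x [xi xr] y dxy; rewrite ltNge; apply/negP => xy; move: dxy.
apply/negP; rewrite -leNgt.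
have Bx : B x by split=> //; rewrite (lt_le_trans xr)//; lra.
have rhoB z : B z -> rho x0 z < e / 2.
  move=> [zi zr]; have [_ _] := r0P _ (lt_trans zr r2); by rewrite chartK.
have nBy : ~ B y.
  move=> By; move: xy; rewrite leNgt => /negP; apply.
  by rewrite (le_lt_trans (rho_tri P x0 x y))// (splitr e) ltrD ?rhoB// rhoC rhoB.
suff H c : piecewise_smooth c -> c 0 = x -> c 1 = y -> ((k * r)%:E <= curve_length g c)%E.
  have [C C0 jC] := joined_bounded g.
  rewrite -lee_fin (riemannian_distE (ltW C0) (jC x y)).
  by apply: le_ereal_inf_tmp => _ [c' [pc' c'0 c'1] <-]; exact: H.
move=> [cc [N [s [s0 sN ss]]]] c0 c1.
rewrite -c0 in Bx; rewrite -c1 in nBy.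
have [tau [tau0 tau1 nBtau Btau]] := exit_time oB cc Bx nBy.
have /subspace_continuousP cc' := cc.
have Ktau t : 0 <= t -> t <= tau -> K (c t).
  have BK z : B z -> K z by move=> [h1 /ltW h2].
  move=> t0; rewrite le_eqVlt => /predU1P[->|tt]; last exact/BK/Btau.
  apply: contrapT => nK.
  have tI : tau \in `[0, 1] by rewrite in_itv /= ltW.
  have oK : open (~` K) by rewrite openC.
  have := cc' _ tI (~` K) (open_nbhs_nbhs (conj oK nK)).
  rewrite -[nbhs _ _]/(\forall s \near within `[0, 1]%classic (nbhs tau), ~ K (c s)) near_withinE.
  move=> /nbhs_ballP[e1 /= e10 eP].
  pose s1 := Num.max 0 (tau - e1 / 2).
  have s1t : s1 < tau by rewrite gt_max tau0 /=; lra.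
  have s10 : 0 <= s1 by rewrite le_max lexx.
  have s1e : tau - e1 / 2 <= s1 by rewrite le_max lexx orbT.
  apply: (eP s1); last exact/BK/Btau.
    by rewrite /ball /= ger0_norm; lra.
  by rewrite /= in_itv /= s10 (le_trans (ltW s1t)).
have Kt := Ktau tau (ltW tau0) (lexx _).
have ctau2 : 2 * r <= `|chart i (c tau) - u0|.
  by rewrite leNgt; apply/negP => h; apply: nBtau; split=> //; case: Kt.
(* The norm of a row is the maximum of its entries, so a single coordinate carries the displacement
   and only a real function of time has to be estimated. *)
have [q qr] : exists q, r < `|(chart i (c tau) - chart i (c 0)) 0 q|.
  apply: coord_norm_gt => //; rewrite c0.
  have : `|chart i (c tau) - u0| <= `|chart i (c tau) - chart i x| + `|chart i x - u0|.
    by rewrite -(subrKA (chart i x)) ler_normD.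
  lra.
pose L0 (v : E) : R^o := k * v 0 q.
have L0lin : linear L0 by move=> a u v; rewrite /L0 !mxE mulrDr mulrCA.
pose L : {linear E -> R^o} := HB.pack L0 (GRing.isLinear.Build _ _ _ _ _ L0lin).
have cL : continuous L.
  move=> v; apply: (@continuous_comp _ _ _ (fun w : E => w 0 q) ( *%R k)).
    exact: coord_continuous.
  exact: mulrl_continuous.
pose f t : R := L (chart i (c t)).
have ftau : k * r <= `|f tau - f 0|.
  rewrite /f -linearB /= /L0 normrM gtr0_norm// ler_wpM2l ?(ltW k0)//.
  exact: ltW.
have int01 t : 0 < t -> t < tau -> c @ t --> c t.
  move=> t0 tt; have t1 : t < 1 by exact: lt_le_trans tau1.
  have tI : t \in `[0, 1] by rewrite in_itv /= !ltW.
  have nI : \forall s \near t, s \in `]0, 1[ by apply: near_in_itvoo; rewrite in_itv /= t0.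
  move=> U Uc; have := cc' t tI U Uc.
  rewrite -[nbhs _ _]/(\forall s \near within `[0, 1]%classic (nbhs t), U (c s)) near_withinE.
  by apply: filterS2 nI => z zI; apply; exact: subset_itv_oo_cc.
apply: (@le_trans _ _ (`|f tau - f 0|%:E)%E); first by rewrite lee_fin.
apply: (piecewise_increment_le s0 sN (fun l h => (ss l h).1)) => //.
- exact: ltW.
- apply/subspace_continuousP => t /=; rewrite in_itv /= => /andP[t0 tt].
  have tI : t \in `[0, 1] by rewrite in_itv /= t0 (le_trans tt).
  have [ci _] := Ktau t t0 tt.
  apply: (cvg_comp _ L _ (cL (chart i (c t)))).
  apply: (cvg_comp c (chart i) _ (chart_cvg ci)).
  move=> U Uc; have := cc' t tI U Uc.
  rewrite -[nbhs _ _]/(\forall z \near within `[0, 1]%classic (nbhs t), U (c z)) near_withinE => h.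
  suff : \forall z \near within `[0, tau]%classic (nbhs t), U (c z) by [].
  rewrite near_withinE; apply: filterS h => z h zt; apply: h; move: zt.
  by rewrite /= !in_itv /= => /andP[-> /= h]; exact: le_trans tau1.
- move=> l lN; have [_ sm] := ss l lN.
  exists (fun t => L ('D_1 (chart i \o c : R^o -> E) t)) => t tl tt.
  have t0 : 0 < t.
    have /andP[h _] := breakpoints_itv s0 sN (fun l h => (ss l h).1) (ltnW lN).
    by move: tl; rewrite in_itv /= => /andP[h1 _]; exact: le_lt_trans h1.
  have [ci _] := Ktau t (ltW t0) (ltW tt).
  have ct := int01 t t0 tt.
  have [|U [oU Ut [G GU fG]]] := sm i t; first by split => //; exact: subset_itv_oo_cc.
  have nG : \forall s \near t, G s = (chart i \o c) s.
    have nU : nbhs t U by exact: open_nbhs_nbhs.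
    have nI : \forall z \near t, z \in `]s l, s l.+1[ by exact: near_in_itvoo.
    have nD := ct _ (nbhs_dom ci).
    near=> z; rewrite fG//; first by near: z.
    split; first by apply: subset_itv_oo_cc; near: z.
    by near: z.
  have dG := smooth_open_differentiable GU Ut.
  have dc := near_eq_differentiable nG dG.
  have dLc : differentiable (L \o (chart i \o c : R^o -> E)) t.
    by apply: differentiable_comp => //; exact: linear_differentiable.
  split.
  + have -> : L ('D_1 (chart i \o c : R^o -> E) t) = 'D_1 (L \o (chart i \o c : R^o -> E)) t.
      rewrite (deriveE (1 : R^o) dLc) (diff_comp dc (linear_differentiable _ cL)).
      have dLE := @diff_lin _ _ _ L ((chart i \o c) t) cL.
      by rewrite (deriveE (1 : R^o) dc) -[in LHS]dLE.
    by apply: derivableP; exact: diff_derivable.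
  + have cDG : (fun z : R^o => 'D_(1 : R^o) G z) @ t --> 'D_(1 : R^o) G t.
      exact: (smooth_open_continuous (smooth_open_derive (1 : R^o) GU) Ut).
    rewrite /prop_for /continuous_at.
    apply: (cvg_comp _ L _ (cL _)).
    rewrite -(near_eq_derive _ nG); apply: cvg_trans cDG; apply: near_eq_cvg.
    by apply: filterS (near_join nG) => z; exact: near_eq_derive.
  + rewrite (speed_chart g ci ct dc).
    apply: le_trans (_ : k * `|'D_1 (chart i \o c : R^o -> E) t| <= _).
      by rewrite /= /L0 normrM gtr0_norm// ler_wpM2l ?(ltW k0)// norm_coord_le.
    have [_ h _] := r0P (chart i (c t)) (le_lt_trans (Ktau t (ltW t0) (ltW tt)).2 r2).
    exact: h.
- by move=> t _; exact: sqrtr_ge0.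
Unshelve. all: by end_near. Qed.

End LowerBound.

(** * Uniform equivalence of the Riemannian distance and [rho] *)

Section RiemannianUniformity.
Context {R : realType} {m : nat} {M : closedManifold R m}.
Variables (g : riemannianMetric M) (P : partitionOfUnity M).
Local Notation rho := (rho P).
Local Notation dist := (riemannian_dist g).

(** Compactness of M makes the local constants of [dist_lower] uniform. *)
Lemma dist_rho (e : R) : 0 < e -> exists2 d, 0 < d &
  forall x y : M, dist x y < d -> rho x y < e.
Proof.
move=> e0; have cM := @manifold_compact _ _ M.
move/compact_near_coveringP : cM => /(_ _ (0^'+)
  (fun d x => forall y, dist x y < d -> rho x y < e) _) cov.
have H : \forall d \near 0^'+, [set: M] `<=` (fun x => forall y, dist x y < d -> rho x y < e).
  apply: cov => x _; have [d d0 nx] := dist_lower g P x e0.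
  exists ([set z | forall y, dist z y < d -> rho z y < e], [set d' | d' < d]).
    by split=> //=; exact: nbhs_right_lt.
  by move=> [z d'] [/= h dd] y zy; apply: h; exact: lt_trans dd.
have /filter_ex[d [Hd d0]] : \forall d \near 0^'+,
    ([set: M] `<=` (fun x => forall y, dist x y < d -> rho x y < e)) /\ 0 < d.
  by apply: filterI => //; exact: nbhs_right_gt.
by exists d => // x y; exact: Hd.
Qed.

(** Near the diagonal short chart segments join the points; away from it [rho] is bounded below by
    compactness. *)
Lemma rho_dist (e : R) : 0 < e -> exists2 d, 0 < d &
  forall x y : M, rho x y < d -> dist x y < e.
Proof.
move=> e0; have e20 : 0 < e / 2 by rewrite divr_gt0.
have cMM : compact ([set: M] `*` [set: M]).
  by apply: compact_setX; exact: manifold_compact.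
have [||d d0 dP] := @compact_near_small _ _ _ (fun p => rho p.1 p.2) [set p | dist p.1 p.2 < e] cMM.
- by move=> p _; apply: cvg_within_filter; exact: rho_continuous.
- move=> [x y] _; have [xy|] := ltP 0 (rho x y); first by right.
  left; have -> : y = x.
    by apply/esym/(@rho_eq0 _ _ _ P); apply/eqP; rewrite eq_le rho_ge0 andbT.
  rewrite near_withinE; apply: filterS (joined_segment g x e20) => p jp _ /=.
  apply: le_lt_trans (joined_dist (ltW e20) jp) _.
  by rewrite ltr_pdivrMr// ltr_pMr// ltr1n.
- by exists d => // x y xy; exact: (dP (x, y)).
Qed.

(** [sup] takes a default value on unbounded sets; this bound makes the suprema in [homeo_dist] and
    [isotopy_dist] genuine. *)
Lemma dist_bounded : exists2 C, 0 < C & forall x y : M, dist x y <= C.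
Proof.
have [C C0 jC] := joined_bounded g; exists C => // x y.
exact: joined_dist (ltW C0) (jC x y).
Qed.

Lemma sup_dist_le (phi psi : M -> M) (e : R) : (forall x, dist (phi x) (psi x) <= e) ->
  sup [set dist (phi x) (psi x) | x in [set: M]] <= e.
Proof.
move=> H; have [x0 _] := @manifold_nonempty _ _ M.
by apply: ge_sup => [|_ [x _ <-]//]; exists (dist (phi x0) (psi x0)); exists x0.
Qed.

Lemma dist_le_sup (phi psi : M -> M) x :
  dist (phi x) (psi x) <= sup [set dist (phi x) (psi x) | x in [set: M]].
Proof.
apply: ub_le_sup; last by exists x.
by have [C _ dC] := dist_bounded; exists C => _ [z _ <-].
Qed.

Lemma sup_dist_ge0 (phi psi : M -> M) :
  0 <= sup [set dist (phi x) (psi x) | x in [set: M]].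
Proof.
have [x0 _] := @manifold_nonempty _ _ M.
exact: le_trans (riemannian_dist_ge0 _ _ _) (dist_le_sup phi psi x0).
Qed.

End RiemannianUniformity.

Section IsotopyDistance.
Context {R : realType} {n : nat} {M : closedManifold R n.*2.+1}.
Variables (g : riemannianMetric M) (P : partitionOfUnity M).
Local Notation rho := (rho P).
Local Notation dist := (riemannian_dist g).

Lemma homeo_dist_ge0 (phi psi : homeo M) : 0 <= homeo_dist g phi psi.
Proof. by rewrite addr_ge0 ?sup_dist_ge0. Qed.

Lemma homeo_dist_ge (phi psi : homeo M) x :
  dist (phi x) (psi x) <= homeo_dist g phi psi /\
  dist (hinv phi x) (hinv psi x) <= homeo_dist g phi psi.
Proof.
split.
  by rewrite -[leLHS]addr0 lerD ?sup_dist_ge0//; exact: (@dist_le_sup _ _ _ g phi psi x).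
by rewrite -[leLHS]add0r lerD ?sup_dist_ge0//; exact: (@dist_le_sup _ _ _ g (hinv phi) (hinv psi) x).
Qed.

Lemma homeo_dist_le_isotopy (Phi Psi : R -> homeo M) t : t \in `[0, 1] ->
  homeo_dist g (Phi t) (Psi t) <= isotopy_dist g Phi Psi.
Proof.
move=> t01; apply: ub_le_sup; last by exists t.
have [C _ dC] := dist_bounded g; exists (C + C) => _ [s _ <-].
by rewrite lerD// sup_dist_le.
Qed.

Lemma isotopy_dist_ge0 (Phi Psi : R -> homeo M) : 0 <= isotopy_dist g Phi Psi.
Proof.
have I0 : (0 : R) \in `[0, 1] by rewrite in_itv /= lexx ler01.
exact: le_trans (homeo_dist_ge0 _ _) (homeo_dist_le_isotopy Phi Psi I0).
Qed.

Lemma isotopy_dist_le (Phi Psi : R -> homeo M) e :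
  (forall t x, t \in `[0, 1] -> dist (Phi t x) (Psi t x) <= e) ->
  (forall t x, t \in `[0, 1] -> dist (hinv (Phi t) x) (hinv (Psi t) x) <= e) ->
  isotopy_dist g Phi Psi <= e + e.
Proof.
move=> h1 h2; have I0 : (0 : R) \in `[0, 1] by rewrite in_itv /= lexx ler01.
apply: ge_sup => [|_ [t t01 <-]].
  by exists (homeo_dist g (Phi 0) (Psi 0)); exists 0.
by rewrite lerD// sup_dist_le// => x; [exact: h1|exact: h2].
Qed.

Section Filter.
Context {I : Type} (F : set_system I) {FF : Filter F}.

Lemma iso_cv_dist (Phi_ : I -> R -> homeo M) (Phi : R -> homeo M) : iso_cv P F Phi_ Phi -> forall e, 0 < e ->
  \forall i \near F, isotopy_dist g (Phi_ i) Phi < e /\ isotopy_dist g Phi (Phi_ i) < e.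
Proof.
move=> [h1 h2] e e0; have e30 : 0 < e / 3 by rewrite divr_gt0.
have [d d0 dP] := rho_dist g P e30.
have lt3 : e / 3 + e / 3 < e by lra.
apply: filterS2 (h1 d d0) (h2 d d0) => i hi hi'; split; apply: le_lt_trans lt3;
  apply: isotopy_dist_le => t x t01; apply: ltW; apply: dP; rewrite ?[rho (Phi t x) _]rhoC
  ?[rho (hinv (Phi t) x) _]rhoC; by [exact: hi|exact: hi'].
Qed.

Lemma dist_iso_cv (Phi_ : I -> R -> homeo M) (Phi : R -> homeo M) :
  (forall e, 0 < e -> \forall i \near F, isotopy_dist g (Phi_ i) Phi < e) ->
  iso_cv P F Phi_ Phi.
Proof.
move=> h; split=> e e0; have [d d0 dP] := dist_rho g P e0; apply: filterS (h d d0) => i hi t x t01.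
  apply: dP; apply: le_lt_trans hi; apply: le_trans (homeo_dist_le_isotopy _ _ t01).
  by have [] := homeo_dist_ge (Phi_ i t) (Phi t) x.
apply: dP; apply: le_lt_trans hi; apply: le_trans (homeo_dist_le_isotopy _ _ t01).
by have [] := homeo_dist_ge (Phi_ i t) (Phi t) x.
Qed.

(** The limit stands last in the definition of a topological system but first in [tcds_dist]; both
    orders are reduced to [rho], which is symmetric. *)
Lemma dist_iso_cv_sym (Phi_ : I -> R -> homeo M) (Phi : R -> homeo M) :
  (forall e, 0 < e -> \forall i \near F, isotopy_dist g Phi (Phi_ i) < e) ->
  iso_cv P F Phi_ Phi.
Proof.
move=> h; split=> e e0; have [d d0 dP] := dist_rho g P e0; apply: filterS (h d d0) => i hi t x t01;
  rewrite rhoC.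
  apply: dP; apply: le_lt_trans hi; apply: le_trans (homeo_dist_le_isotopy _ _ t01).
  by have [] := homeo_dist_ge (Phi t) (Phi_ i t) x.
apply: dP; apply: le_lt_trans hi; apply: le_trans (homeo_dist_le_isotopy _ _ t01).
by have [] := homeo_dist_ge (Phi t) (Phi_ i t) x.
Qed.

End Filter.

End IsotopyDistance.

(** * The norm on Hamiltonians *)

Section IteratedIntegral.
Context {R : realType}.
Local Notation mu := (@lebesgue_measure R).

Lemma mx_norm_le (p q : nat) (A : 'M[R]_(p, q)) (C : R) : 0 <= C ->
  (forall a b, `|A a b| <= C) -> `|A| <= C.
Proof.
by move=> C0 AC; rewrite [leLHS]/Num.Def.normr/= mx_normrE (bigmax_le _ C0).
Qed.

Definition cons_row (m : nat) (x : R) (v : 'rV[R]_m) : 'rV[R]_m.+1 :=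
  row_mx (x%:M : 'M[R]_1) v.

Lemma cons_rowB m x x' (v v' : 'rV[R]_m) :
  cons_row x v - cons_row x' v' = cons_row (x - x') (v - v').
Proof.
apply/matrixP => a b; rewrite /cons_row !mxE.
by case: (fintype.split (b : 'I_(1 + m))) => k; rewrite !mxE ?mulrnBl.
Qed.

Lemma norm_cons_row_le m x (v : 'rV[R]_m) (C : R) :
  `|x| <= C -> `|v| <= C -> `|cons_row x v| <= C.
Proof.
move=> xC vC; apply: mx_norm_le => [|a b]; first exact: le_trans xC.
rewrite /cons_row mxE; case: (fintype.split (b : 'I_(1 + m))) => k.
  by rewrite !mxE (ord1 a) (ord1 k) eqxx mulr1n.
exact: le_trans (norm_coord_le v a k) vC.
Qed.

Lemma norm_cons_row_ge m x (v : 'rV[R]_m) :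
  `|x| <= `|cons_row x v| /\ `|v| <= `|cons_row x v|.
Proof.
split.
  have := norm_coord_le (row_mx (x%:M : 'M[R]_1) v) 0 (lshift m (ord0 : 'I_1)).
  by rewrite row_mxEl mxE eqxx mulr1n.
apply: mx_norm_le => // a b; rewrite (ord1 a).
have := norm_coord_le (row_mx (x%:M : 'M[R]_1) v) 0 (rshift 1 b).
by rewrite row_mxEr.
Qed.

Lemma cons_row_cvg m (T : Type) (F : set_system T) (f : T -> R) (h : T -> 'rV[R]_m) x v :
  Filter F -> f @ F --> x -> h @ F --> v ->
  cons_row (f t) (h t) @[t --> F] --> cons_row x v.
Proof.
move=> FF /cvgrPdist_le fx /cvgrPdist_le hv; apply/cvgrPdist_le => e e0.
by apply: filterS2 (fx e e0) (hv e e0) => t h1 h2; rewrite cons_rowB norm_cons_row_le.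
Qed.

Lemma continuous_mull (T : topologicalType) (c : R) (F : T -> R) :
  continuous F -> continuous (fun v => c * F v).
Proof. by move=> cF v; apply: (cvg_comp F ( *%R c) (cF v)); exact: mulrl_continuous. Qed.

Lemma continuous_addr (T : topologicalType) (F G : T -> R) :
  continuous F -> continuous G -> continuous (fun v => F v + G v).
Proof. by move=> cF cG v; exact: cvgD (cF v) (cG v). Qed.

Definition supported m (K : R) (F : 'rV[R]_m -> R) := forall v, K < `|v| -> F v = 0.

Lemma Rintegral_supported (K : R) (f : R -> R) : (forall x, K < `|x| -> f x = 0) ->
  \int[mu]_x f x = \int[mu]_(x in `[(- K)%R, K]) f x.
Proof.
move=> f0; rewrite [RHS]Rintegral_mkcond; apply: eq_Rintegral => x _.
rewrite patchE; case: ifPn => //; rewrite notin_setE /= in_itv /= => /negP xK.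
by apply: f0; rewrite ltNge; apply/negP; rewrite ler_norml => h; rewrite h in xK.
Qed.

(** Uniformity in v comes from compactness of the ball of radius K; outside it both values
    vanish. *)
Lemma iterated_integral_cvg m (K : R) (F : 'rV[R]_m.+1 -> R) (x0 : R) :
  0 <= K -> continuous F -> supported K F ->
  forall e, 0 < e -> \forall x \near x0, forall v, `|F (cons_row x v) - F (cons_row x0 v)| <= e.
Proof.
move=> K0 cF sF e e0.
have cB : compact [set v : 'rV[R]_m | `|v| <= K].
  apply: bounded_closed_compact.
    by exists K; split; [exact: num_real|move=> r Kr v /= /le_trans; apply; exact: ltW].
  apply: (@preimage_closed _ _ (fun v : 'rV[R]_m => `|v|) [set s | s <= K]).
    by move=> v _; exact: norm_continuous.
  exact: closed_le.
move/compact_near_coveringP : cB => /(_ _ (nbhs x0)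
  (fun x v => `|F (cons_row x v) - F (cons_row x0 v)| <= e) _) cov.
have H : \forall x \near x0, [set v : 'rV[R]_m | `|v| <= K] `<=`
    (fun v => `|F (cons_row x v) - F (cons_row x0 v)| <= e).
  apply: cov => v _.
  have e20 : 0 < e / 2 by rewrite divr_gt0.
  have c1 : F (cons_row p.1 p.2) @[p --> (x0, v)] --> F (cons_row x0 v).
    apply: (cvg_comp _ F _ (cF (cons_row x0 v))).
    by apply: cons_row_cvg; [exact: cvg_fst|exact: cvg_snd].
  move/cvgrPdist_lt : c1 => /(_ _ e20)[[A B] /= [xA vB] AB].
  exists (B, A); first by split.
  move=> [w x] [/= Bw Ax].
  have h1 := AB (x, w) (conj Ax Bw).
  have h2 := AB (x0, w) (conj (nbhs_singleton xA) Bw).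
  rewrite /= in h1 h2; rewrite (splitr e) -(subrKA (F (cons_row x0 v))).
  by rewrite (le_trans (ler_normD _ _))// lerD ?ltW// distrC.
apply: filterS H => x h v; have [vK|vK] := leP `|v| K; first exact: h.
rewrite !sF ?subrr ?normr0 ?(ltW e0)//.
- by have [_] := norm_cons_row_ge x0 v; exact: lt_le_trans.
- by have [_] := norm_cons_row_ge x v; exact: lt_le_trans.
Qed.

(** The three claims need one joint induction: additivity in dimension m + 1 requires integrable
    section integrals, their integrability comes from continuity in the first coordinate, and this
    continuity from linearity and the bound in dimension m. *)
Lemma iterated_integral_spec m (K : R) : 0 <= K ->
  [/\ forall F G : 'rV[R]_m -> R, continuous F -> continuous G ->
        supported K F -> supported K G ->
        iterated_integral (fun v => F v + G v) = iterated_integral F + iterated_integral G,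
      forall c (F : 'rV[R]_m -> R), continuous F -> supported K F ->
        iterated_integral (fun v => c * F v) = c * iterated_integral F &
      forall C (F : 'rV[R]_m -> R), continuous F -> supported K F ->
        (forall v, `|F v| <= C) -> `|iterated_integral F| <= (2 * K) ^+ m * C].
Proof.
move=> K0; elim: m => [|m [addII scaleII boundII]].
  by split=> //= C F _ _ FC; rewrite expr0 mul1r.
pose sec (F : 'rV[R]_m.+1 -> R) x := fun v : 'rV[R]_m => F (cons_row x v).
have csec (F : 'rV[R]_m.+1 -> R) x : continuous F -> continuous (sec F x).
  move=> cF; suff H (v : 'rV[R]_m) : sec F x @ v --> sec F x v by exact: H.
  have c : cons_row x w @[w --> v] --> cons_row x v.
    by apply: (@cons_row_cvg m _ (nbhs v) (fun=> x) idfun x v); [exact: cvg_cst|exact: cvg_id].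
  exact: (cvg_comp _ F c (cF (cons_row x v))).
have ssec (F : 'rV[R]_m.+1 -> R) x : supported K F -> supported K (sec F x).
  by move=> sF v vK; apply: sF; have [_] := norm_cons_row_ge x v; exact: lt_le_trans.
have IIS (F : 'rV[R]_m.+1 -> R) : iterated_integral F = \int[mu]_x iterated_integral (sec F x) by [].
have zero_sec (F : 'rV[R]_m.+1 -> R) x : supported K F -> K < `|x| -> iterated_integral (sec F x) = 0.
  move=> sF Kx; have -> : sec F x = (fun v => 0 * (fun _ => 0) v).
    apply/funext => v; rewrite mul0r; apply: sF.
    by have [+ _] := norm_cons_row_ge x v; exact: lt_le_trans.
  rewrite scaleII ?mul0r//; exact: (@cst_continuous 'rV[R]_m R 0).
have IIK (F : 'rV[R]_m.+1 -> R) : supported K F ->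
    iterated_integral F = \int[mu]_(x in `[(- K)%R, K]) iterated_integral (sec F x).
  by move=> sF; rewrite IIS; apply: Rintegral_supported => x; exact: zero_sec.
have cII (F : 'rV[R]_m.+1 -> R) : continuous F -> supported K F -> continuous (fun x => iterated_integral (sec F x)).
  move=> cF sF x0; apply/cvgrPdist_le => e e0.
  (* The 1 avoids dividing by zero, since K may be 0. *)
  have D0 : 0 < (2 * K) ^+ m + 1 by rewrite ltr_pwDr// exprn_ge0// mulr_ge0.
  have e1 : 0 < e / ((2 * K) ^+ m + 1) by rewrite divr_gt0.
  apply: filterS (iterated_integral_cvg x0 K0 cF sF e1) => x h.
  have -> : iterated_integral (sec F x0) - iterated_integral (sec F x) =
      iterated_integral (fun v => sec F x0 v + (-1) * sec F x v).
    rewrite addII ?scaleII ?mulN1r//; try by [exact: csec|exact: ssec].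
    - by apply: continuous_mull; exact: csec.
    - by move=> v vK; rewrite ssec ?mulr0.
  apply: (@le_trans _ _ ((2 * K) ^+ m * (e / ((2 * K) ^+ m + 1)))).
    apply: boundII.
    - apply: continuous_addr; first exact: csec.
      by apply: continuous_mull; exact: csec.
    - by move=> v vK; rewrite !ssec ?mulr0 ?addr0.
    - by move=> v; rewrite mulN1r distrC; exact: h.
  by rewrite mulrCA ger_pMr// ler_pdivrMr// mul1r lerDl.
have intII (F : 'rV[R]_m.+1 -> R) : continuous F -> supported K F ->
    mu.-integrable `[(- K)%R, K] (EFin \o (fun x => iterated_integral (sec F x))).
  move=> cF sF; apply: continuous_compact_integrable; first exact: segment_compact.
  by apply: continuous_subspaceT; exact: cII.
split.
- move=> F G cF cG sF sG.
  rewrite !IIK//; last by move=> v vK; rewrite sF ?sG ?addr0.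
  rewrite -RintegralD//; last 2 first.
  + exact: intII.
  + exact: intII.
  apply: eq_Rintegral => x _; rewrite -addII//; try by [exact: csec|exact: ssec].
- move=> c F cF sF.
  rewrite !IIK//; last by move=> v vK; rewrite sF ?mulr0.
  rewrite -RintegralZl//; last exact: intII.
  apply: eq_Rintegral => x _; rewrite -scaleII//; [exact: csec|exact: ssec].
- move=> C F cF sF FC; rewrite IIK//.
  have C0 : 0 <= C by exact: le_trans (FC 0).
  apply: (le_trans (le_normr_Rintegral _ (intII F cF sF))) => //.
  have iabs : mu.-integrable `[(- K)%R, K] (EFin \o (fun x => `|iterated_integral (sec F x)|)).
    apply: continuous_compact_integrable; first exact: segment_compact.
    apply: continuous_subspaceT => x.
    by apply: cvg_norm; exact: cII.
  apply: (@le_trans _ _ (\int[mu]_(x in `[(- K)%R, K]) ((2 * K) ^+ m * C))).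
    apply: le_Rintegral => //.
      by apply: continuous_compact_integrable; [exact: segment_compact|apply: continuous_subspaceT => x; exact: cvg_cst].
    by move=> x _; apply: boundII; [exact: csec|exact: ssec|move=> v; exact: FC].
  rewrite Rintegral_cst//= lebesgue_measure_itv /= lte_fin.
  case: ltP => KK /=; last first.
    by rewrite mulr0 mulr_ge0// exprn_ge0// mulr_ge0.
  by rewrite opprK (_ : K + K = 2 * K) ?exprSr; [rewrite mulrAC|ring].
Qed.

End IteratedIntegral.

Section HamiltonianNorm.
Context {R : realType} {n : nat} {M : closedManifold R n.*2.+1}.
Variables (alpha : contactForm M) (P : partitionOfUnity M).
Local Notation E := 'rV[R]_(n.*2.+1).
Implicit Types (f h : M -> R).

Lemma smooth_on_derive_continuous (V W : normedModType R) (A : set V) (f : V -> W) (x v : V) :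
  smooth_on A f -> nbhs x A -> {for x, continuous (fun y => 'D_v f y)}.
Proof.
move=> fA nA; have [D1 [oD1 D1x [f1 f1C ff1]]] := fA x (nbhs_singleton nA).
have nE : \forall y \near x, f1 y = f y.
  have : nbhs x D1 by exact: open_nbhs_nbhs.
  by apply: filterS2 nA => y Ay Dy; rewrite ff1.
have c1 := smooth_open_continuous (smooth_open_derive v f1C) D1x.
rewrite /prop_for /continuous_at -(near_eq_derive _ nE); apply: cvg_trans c1.
by apply: near_eq_cvg; apply: filterS (near_join nE) => y; exact: near_eq_derive.
Qed.

Lemma density_continuous i (v : E) : (chart i @` dom i) v ->
  {for v, continuous (contact_density (form alpha i))}.
Proof.
move=> vi; have nv := nbhs_img vi; have sa := @form_smooth _ _ _ alpha i.
have ca := smooth_on_open_continuous sa nv.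
have cc k : (form alpha i u) 0 k @[u --> v] --> (form alpha i v) 0 k.
  exact: (cvg_comp (form alpha i) (fun w : E => w 0 k) ca (@coord_continuous _ _ _ 0 k _)).
pose c (k : 'I_n.*2.+1) (w : E) : R^o := w 0 k.
have clin k : linear (c k) by move=> a u w; rewrite /c !mxE.
pose cL k : {linear E -> R^o} := HB.pack (c k) (GRing.isLinear.Build _ _ _ _ _ (clin k)).
have cd k (w : E) : (fun u => 'D_w (fun y => (form alpha i y) 0 k : R^o) u) @ v -->
    'D_w (fun y => (form alpha i y) 0 k : R^o) v.
  have s1 : smooth_on (chart i @` dom i) (cL k \o form alpha i).
    by apply: smooth_on_linear_comp sa; exact: coord_continuous.
  have s2 := smooth_on_derive_continuous (v := w) s1 nv.
  exact: s2.
suff key (G : set_system E) : Filter G ->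
    (forall k, (form alpha i u) 0 k @[u --> G] --> (form alpha i v) 0 k) ->
    (forall k w, 'D_w (fun y => (form alpha i y) 0 k : R^o) u @[u --> G] -->
      'D_w (fun y => (form alpha i y) 0 k : R^o) v) ->
    contact_density (form alpha i) u @[u --> G] --> contact_density (form alpha i) v.
  exact: (key (nbhs v) _ cc (fun k w => cd k w)).
move=> FG ccG cdG; rewrite /contact_density.
apply: cvgM; first exact: cvg_cst.
apply: cvg_big => [|s _]; first exact: add_continuous.
apply: cvgM; first by apply: cvgM; [exact: cvg_cst|exact: ccG].
apply: cvg_big => [|l _]; first exact: mul_continuous.
by apply: cvgB; exact: cdG.
Qed.

Definition summand (k : 'I_(pou_size P)) (f : M -> R) (v : E) : R :=
  if v \in chart (pou_chart k) @` dom (pou_chart k)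
  then pou_fun k (chart_inv (pou_chart k) v) * f (chart_inv (pou_chart k) v) *
    `|contact_density (form alpha (pou_chart k)) v| else 0.

Lemma contact_integralE f : contact_integral alpha P f = \sum_k iterated_integral (summand k f).
Proof. by []. Qed.

Let supp (k : 'I_(pou_size P)) := closure [set x | pou_fun k x != 0].

Let supp_img k : compact (chart (pou_chart k) @` supp k).
Proof.
apply: continuous_compact.
  apply/subspace_continuousP => x xs; apply: cvg_within_filter.
  exact: (chart_cvg (@pou_support _ _ _ P k x xs)).
by apply: (subclosed_compact _ (@manifold_compact _ _ M)) => //; exact: closed_closure.
Qed.

Let summand_out k f v : ~ (chart (pou_chart k) @` supp k) v -> summand k f v = 0.
Proof.
move=> vS; rewrite /summand; case: ifPn => //; rewrite inE => vi.
have [vi' vK] := imgP vi.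
have [->|nz] := eqVneq (pou_fun k (chart_inv (pou_chart k) v)) 0; first by rewrite !mul0r.
by exfalso; apply: vS; exists (chart_inv (pou_chart k) v) => //; exact: subset_closure.
Qed.

(** The cut-off at the edge of the chart image does no harm: the summand vanishes off the image of
    the support, which is compact and contained in the open chart image. *)
Lemma summand_continuous k f : continuous f -> continuous (summand k f).
Proof.
move=> cf; set i := pou_chart k.
suff H (v : E) : summand k f @ v --> summand k f v by exact: H.
have [vi|vi] := pselect ((chart i @` dom i) v).
  have [vi' vK] := imgP vi.
  have cinv : chart_inv i @ v --> chart_inv i v := @chart_inv_continuous _ _ _ i _ vi.
  have c1 := cvg_comp _ (pou_fun k) cinv (smooth_fun_continuous (@pou_smooth _ _ _ P k) (x := _)).
  have c2 := cvg_comp _ f cinv (cf _).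
  have FF : Filter (nbhs v) := nbhs_filter v.
  have c3 : `|contact_density (form alpha i) u| @[u --> v] --> `|contact_density (form alpha i) v|.
    exact: (cvg_comp _ Num.norm (density_continuous vi) (@norm_continuous _ R^o _)).
  have c4 (G : set_system E) (a b c : E -> R) (a0 b0 c0 : R) : Filter G -> a @ G --> a0 -> b @ G --> b0 ->
      c @ G --> c0 -> a u * b u * c u @[u --> G] --> a0 * b0 * c0.
    by move=> FG ca cb cc; apply: cvgM => //; exact: cvgM.
  have nE : \forall u \near v, ((pou_fun k \o chart_inv i) \* (f \o chart_inv i) \*
      (fun u => `|contact_density (form alpha i) u|)) u = summand k f u.
    by apply: filterS (nbhs_img vi) => u ui; rewrite /summand ifT ?inE.
  have -> : summand k f v = pou_fun k (chart_inv i v) * f (chart_inv i v) *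
      `|contact_density (form alpha i) v| by rewrite /summand ifT ?inE.
  exact: (cvg_trans (near_eq_cvg nE) (c4 _ _ _ _ _ _ _ FF c1 c2 c3)).
have nS : ~ (chart i @` supp k) v.
  by move=> [x xs xv]; apply: vi; exists x => //; exact: pou_support xs.
have hE : hausdorff_space E by exact: norm_hausdorff.
have cS := compact_closed hE (@supp_img k).
have nv : nbhs v (~` (chart i @` supp k)) by apply: open_nbhs_nbhs; split=> //; rewrite openC.
have nE : \forall u \near v, summand k f u = summand k f v.
  by apply: filterS nv => u uS; rewrite (summand_out _ nS) summand_out.
exact: (cvg_near_cst _ (FF := nbhs_filter v) nE).
Qed.

Lemma summand_supported : exists2 K, 0 <= K & forall k f, supported K (summand k f).
Proof.
have bk k : exists K : R, forall v, (chart (pou_chart k) @` supp k) v -> `|v| <= K.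
  have [K [_ KP]] := compact_bounded (@supp_img k).
  by exists (K + 1) => v; apply: KP; rewrite ltrDl.
pose K k := sval (cid (bk k)).
exists (\sum_k `|K k|); first by apply: sumr_ge0.
move=> k f v Kv; apply: summand_out => /(svalP (cid (bk k))); rewrite -/(K k) => vK.
move: Kv; rewrite ltNge => /negP; apply; apply: (le_trans vK).
rewrite (bigD1 k)//= (le_trans (ler_norm _))// lerDl; exact: sumr_ge0.
Qed.

Lemma contact_integralD f h : continuous f -> continuous h ->
  contact_integral alpha P (fun x => f x + h x) =
  contact_integral alpha P f + contact_integral alpha P h.
Proof.
move=> cf ch; rewrite !contact_integralE -big_split; apply: eq_bigr => k _.
suff : iterated_integral (summand k (fun x => f x + h x)) =
    iterated_integral (summand k f) + iterated_integral (summand k h) by [].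
have [K K0 sK] := summand_supported.
have [addII _ _] := iterated_integral_spec n.*2.+1 K0.
rewrite -(addII _ _ (@summand_continuous k f cf) (@summand_continuous k h ch) (sK k f) (sK k h)).
congr (iterated_integral _); apply/funext => v; rewrite /summand; case: ifP => _.
  by rewrite mulrDr mulrDl.
by rewrite addr0.
Qed.

Lemma contact_integralZ c f : continuous f ->
  contact_integral alpha P (fun x => c * f x) = c * contact_integral alpha P f.
Proof.
move=> cf; rewrite !contact_integralE mulr_sumr; apply: eq_bigr => k _.
have [K K0 sK] := summand_supported.
have [_ scaleII _] := iterated_integral_spec n.*2.+1 K0.
rewrite -(scaleII c _ (@summand_continuous k f cf) (sK k f)).
congr (iterated_integral _); apply/funext => v; rewrite /summand; case: ifP => _.
  by ring.
by rewrite mulr0.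
Qed.

Lemma contact_integral_bound : exists2 C, 0 <= C & forall f e, continuous f ->
  (forall x, `|f x| <= e) -> `|contact_integral alpha P f| <= C * e.
Proof.
have [K K0 sK] := summand_supported.
have [_ _ boundII] := iterated_integral_spec n.*2.+1 K0.
have bk k : exists D : R, 0 <= D /\ forall v, `|summand k (fun=> 1) v| <= D.
  have c1 := @summand_continuous k (fun=> 1) (fun x => cvg_cst _).
  have cB : compact (summand k (fun=> 1) @` (chart (pou_chart k) @` supp k)).
    apply: continuous_compact (@supp_img k).
    by apply/subspace_continuousP => x _; apply: cvg_within_filter; exact: c1.
  have [D [_ DP]] := compact_bounded cB.
  exists `|D + 1|; split=> // v; have [vS|vS] := pselect ((chart (pou_chart k) @` supp k) v).
    by apply: le_trans (ler_norm _); apply: (DP (D + 1)); [rewrite ltrDl|exists v].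
  by rewrite summand_out// normr0.
pose D k := sval (cid (bk k)).
have DP k : 0 <= D k /\ forall v, `|summand k (fun=> 1) v| <= D k := svalP (cid (bk k)).
exists (\sum_k (2 * K) ^+ n.*2.+1 * D k).
  by apply: sumr_ge0 => k _; rewrite !mulr_ge0 ?exprn_ge0 ?mulr_ge0//; case: (DP k).
move=> f e cf fe; rewrite contact_integralE mulr_suml.
apply: le_trans (ler_norm_sum _ _ _) _; apply: ler_sum => k _.
rewrite -mulrA; apply: boundII; [exact: summand_continuous|exact: sK|move=> v].
apply: (@le_trans _ _ (`|summand k (fun=> 1) v| * e)).
  rewrite /summand; case: ifPn => _; last by rewrite normr0 mul0r.
  by rewrite mulr1 mulrAC normrM ler_wpM2l.
have [x0 _] := @manifold_nonempty _ _ M.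
by rewrite ler_wpM2r; [| exact: le_trans (fe x0)|case: (DP k)].
Qed.

Let osc f := sup (range f) - inf (range f).

Lemma range_bounded f : continuous f -> has_sup (range f) /\ has_inf (range f).
Proof.
move=> cf; have cT : {within [set: M], continuous f} by apply/subspace_continuousP => x _; apply: cvg_within_filter; exact: cf.
have cR : compact (range f) := continuous_compact cT (@manifold_compact _ _ M).
have [x0 _] := @manifold_nonempty _ _ M.
have ne : range f !=set0 by exists (f x0); exists x0.
have [K [_ KP]] := compact_bounded cR; have K1 : K < K + 1 by rewrite ltrDl.
split; split=> //; [exists (K + 1)|exists (- (K + 1))] => _ [x _ <-].
  by apply: le_trans (ler_norm _) _; apply: (KP _ K1); exists x.
by rewrite lerNl; apply: le_trans (ler_norm _) _; rewrite normrN; apply: (KP _ K1); exists x.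
Qed.

Lemma osc_le f C : (forall x y, f x - f y <= C) -> osc f <= C.
Proof.
move=> fC; have [x0 _] := @manifold_nonempty _ _ M.
have ne : range f !=set0 by exists (f x0); exists x0.
rewrite /osc lerBlDr addrC; apply: ge_sup => // _ [x _ <-].
rewrite -lerBlDr; apply: lb_le_inf => // _ [y _ <-].
by have := fC x y; lra.
Qed.

Lemma le_osc f x y : continuous f -> f x - f y <= osc f.
Proof.
move=> /range_bounded[[_ hs] [_ hi]].
by apply: lerB; [apply: ub_le_sup => //; exists x|apply: ge_inf => //; exists y].
Qed.

Local Notation hn := (ham_norm alpha P).

Lemma ham_norm_ge0 f : continuous f -> 0 <= hn f.
Proof.
move=> cf; have [x0 _] := @manifold_nonempty _ _ M.
by rewrite addr_ge0//; have := le_osc x0 x0 cf; rewrite subrr.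
Qed.

Lemma ham_normD f h : continuous f -> continuous h ->
  hn (fun x => f x + h x) <= hn f + hn h.
Proof.
move=> cf ch; rewrite /ham_norm addrACA lerD//.
  by apply: osc_le => x y; have := le_osc x y cf; have := le_osc x y ch; rewrite /osc; lra.
by rewrite contact_integralD// mulrDl ler_normD.
Qed.

Lemma ham_normZ c f : continuous f -> hn (fun x => c * f x) <= `|c| * hn f.
Proof.
move=> cf; rewrite /ham_norm mulrDr lerD//; last first.
  by rewrite contact_integralZ// -mulrA normrM.
apply: osc_le => x y; rewrite -mulrBr (le_trans (ler_norm _))// normrM ler_wpM2l//.
rewrite ler_norml (le_osc x y cf) andbT lerNl opprB; exact: le_osc.
Qed.

Lemma ham_norm_bound : exists2 C, 0 < C & forall f e, continuous f ->
  (forall x, `|f x| <= e) -> hn f <= C * e.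
Proof.
have [C C0 CP] := contact_integral_bound.
pose D := `|(contact_integral alpha P (fun=> 1))^-1|.
(* The oscillation of f is at most 2 e, and its mean value at most C D e. *)
exists (2 + C * D); first by rewrite ltr_wpDr ?mulr_ge0 ?normr_ge0.
move=> f e cf fe; rewrite /ham_norm mulrDl lerD//.
  apply: osc_le => x y; have := fe x; have := fe y.
  by rewrite !ler_norml => /andP[h1 h2] /andP[h3 h4]; lra.
by rewrite normrM mulrAC ler_wpM2r// CP.
Qed.

End HamiltonianNorm.

(** * Change of time under the integral *)

Section TimeChange.
Context {R : realType}.
Local Notation mu := (@lebesgue_measure R).
Import HBNNSimple.
Local Notation D := (`[0%R, 1%R]%classic : set R).
Variables (tau : R -> R) (e : R).
Let tau' : R -> R := fun t => 'D_1 (tau : R^o -> R^o) t.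
Hypothesis dtau : forall t, derivable (tau : R^o -> R^o) t 1.
Hypothesis ctau' : continuous tau'.
Hypothesis e1 : `|e| = 1.
Hypothesis mono : forall t, `|tau' t| = e * tau' t.

Let ctau : continuous tau.
Proof. by move=> t; apply: differentiable_continuous; apply/derivable1_diffP; exact: dtau. Qed.

Let mtau : measurable_fun setT tau := continuous_measurable_fun ctau.

Let w (t : R) : \bar R := (`|tau' t|)%:E.

Let w0 t : (0 <= w t)%E. Proof. by rewrite lee_fin. Qed.

Let mw : measurable_fun setT w.
Proof.
apply/measurable_EFinP; apply: measurableT_comp => //; exact: continuous_measurable_fun.
Qed.

Let mind A : measurable A -> measurable_fun setT (fun t => (\1_A (tau t))%:E : \bar R).
Proof.
move=> mA; apply/measurable_EFinP.
have m1 : measurable_fun setT (\1_A : R -> R) by exact: measurable_indic.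
exact: (measurableT_comp m1 mtau).
Qed.

(** |tau'| is the derivative of e tau, where e is the sign of the monotone time change; increasing
    and decreasing tau are treated at once. *)
Lemma integral_speed_itv (s t : R) : s <= t ->
  (\int[mu]_(x in `[s, t]) w x <= (`|tau t - tau s|)%:E)%E.
Proof.
rewrite le_eqVlt => /predU1P[->|st].
  by rewrite set_itv1 integral_set1 lee_fin.
have F' x : derive1 (fun x => e * tau x) x = `|tau' x|.
  by rewrite derive1E mono (deriveZ (f := tau : R^o -> R^o) e (@dtau x)).
have dF x : derivable ((fun x => e * tau x) : R^o -> R^o) x 1.
  by apply: (@derivableZ _ _ _ (tau : R^o -> R^o) e x 1); exact: dtau.
rewrite (@continuous_FTC2 _ (fun x => `|tau' x|) (fun x => e * tau x) s t st).
- by rewrite -EFinB lee_fin -mulrBr (le_trans (ler_norm _))// normrM e1 mul1r.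
- apply: continuous_subspaceT => x; apply: cvg_norm; exact: ctau'.
- have cF : continuous (fun x => e * tau x) by move=> x; apply: cvgM; [exact: cvg_cst|exact: ctau].
  split; [by move=> x _; exact: dF|apply: cvg_at_right_filter; exact: cF|apply: cvg_at_left_filter; exact: cF].
- by move=> x _; rewrite F'.
Qed.

(** The times sent into the interval lie between their infimum and their supremum. By continuity tau
    maps these two into [a, b], and the variation between them is the difference of the two
    values. *)
Lemma speed_measure_itv (a b : R) : a <= b ->
  (\int[mu]_(t in D) (w t * (\1_(`]a, b]%classic) (tau t))%:E) <= (b - a)%:E)%E.
Proof.
move=> ab; pose T := D `&` tau @^-1` `]a, b]%classic.
have TE t : D t -> ~ T t -> (\1_(`]a, b]%classic) (tau t) : R) = 0.
  by move=> Dt nT; rewrite indicE memNset// => tt; exact: nT.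
have [T0|/set0P T0] := eqVneq T set0.
  by rewrite integral0_eq ?lee_fin ?subr_ge0// => t Dt; rewrite TE ?mule0// T0.
have T01 t : T t -> 0 <= t <= 1 by case=> + _; rewrite /= in_itv.
have uT : has_ubound T by exists 1 => t /T01/andP[].
have lT : has_lbound T by exists 0 => t /T01/andP[].
have cl (h : R -> R) : continuous h -> closed (h @^-1` `[a, b]%classic).
  by move=> ch; apply: closed_comp => [x _|]; [exact: ch|exact: itv_closed].
have Tab t : T t -> tau t \in `[a, b].
  by case=> _ /=; rewrite !in_itv/= => /andP[/ltW -> ->].
have sT : (tau (sup T)) \in `[a, b].
  have c1 := closure_sup T0 uT.
  by have := closure_subset (Tab : T `<=` tau @^-1` `[a, b]%classic) c1; rewrite -(closure_id _).1//; exact: cl.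
have iT : (tau (inf T)) \in `[a, b].
  have c1 : closure (-%R @` T) (sup (-%R @` T)).
    by apply: closure_sup; [case: T0 => t Tt; exists (- t), t|apply/has_lb_ubN].
  have sub : -%R @` T `<=` (fun x => tau (- x)) @^-1` `[a, b]%classic.
    by move=> _ [t Tt <-] /=; rewrite opprK; exact: Tab.
  have := closure_subset sub c1; rewrite -(closure_id _).1//; apply: cl => x.
  by apply: continuous_comp; [exact: opp_continuous|exact: ctau].
have le_iT t : T t -> inf T <= t <= sup T.
  by move=> Tt; apply/andP; split; [exact: ge_inf|exact: ub_le_sup].
have ist : inf T <= sup T.
  by have [t /le_iT /andP[]] := T0; exact: le_trans.
apply: (@le_trans _ _ (\int[mu]_(t in D) (w \_ `[inf T, sup T]) t)%E).
  apply: ge0_le_integral => //.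
  - by move=> t _; rewrite mule_ge0// lee_fin.
  - by apply: emeasurable_funM; apply: measurable_funTS => //; exact: mind.
  - by apply: measurable_funTS; apply/(measurable_restrictT _ _).1; [|exact: measurable_funTS].
  move=> t Dt; have [Tt|nT] := pselect (T t); last by rewrite TE// mule0; exact: erestrict_ge0.
  by rewrite patchE ifT ?inE/= ?in_itv/= ?le_iT// indicE mem_set ?mule1//; case: Tt.
rewrite -integral_mkcondr (setIidr _); last first.
  move=> t /=; rewrite !in_itv/= => /andP[t1 t2]; apply/andP; split.
    by apply: le_trans t1; apply: lb_le_inf => // t' /T01/andP[].
  by apply: (le_trans t2); apply: ge_sup => // t' /T01/andP[].
apply: le_trans (integral_speed_itv ist) _.
by move: sT iT; rewrite lee_fin !in_itv/= => /andP[? ?] /andP[? ?]; rewrite ler_norml; lra.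
Qed.

(** Lebesgue measure is an infimum over countable covers by half-open intervals, and each interval
    of a cover obeys [speed_measure_itv]. *)
Lemma speed_measure (A : set R) : measurable A ->
  (\int[mu]_(t in D) (w t * (\1_A (tau t))%:E) <= mu A)%E.
Proof.
move=> mA; apply: le_ereal_inf_tmp => _ [F [mF AF] <-].
have mF' k : measurable (F k : set R).
  by have [x _ <-] := mF k; exact: measurable_itv.
apply: (@le_trans _ _ (\int[mu]_(t in D) (\sum_(k <oo) (w t * (\1_(F k) (tau t))%:E)))%E).
  apply: ge0_le_integral => //.
  - by move=> t _; rewrite mule_ge0// lee_fin.
  - by apply: emeasurable_funM; apply: measurable_funTS => //; exact: mind.
  - apply: ge0_emeasurable_sum => [k t _ _|k _]; first by rewrite mule_ge0// lee_fin.
    by apply: emeasurable_funM; apply: measurable_funTS => //; exact: mind.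
  move=> t _; have [At|At] := pselect (A (tau t)); last first.
    by rewrite indicE memNset// mule0 nneseries_ge0// => k _ _; rewrite mule_ge0// lee_fin.
  have [k _ Fk] := AF _ At; rewrite indicE mem_set// mule1.
  apply: (@le_trans _ _ (\sum_(0 <= i < k.+1) (w t * (\1_(F i) (tau t))%:E))%E); last first.
    by apply: nneseries_lim_ge => j _ _; rewrite mule_ge0// lee_fin.
  rewrite big_nat_recr//= [X in (_ + _ * X)%E](_ : _ = 1%E) ?mule1; last by rewrite indicE mem_set.
  by rewrite leeDr// sume_ge0// => j _; rewrite mule_ge0// lee_fin.
rewrite integral_nneseries//; last 2 first.
- by move=> k; apply: emeasurable_funM; apply: measurable_funTS => //; exact: mind.
- by move=> k t _; rewrite mule_ge0// lee_fin.
apply: lee_nneseries => [k _ _|k _]; first by apply: integral_ge0 => t _; rewrite mule_ge0// lee_fin.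
have [[a b] _ <-] := mF k => /=.
rewrite [leRHS](_ : _ = wlength idfun `]a, b]%classic)// wlength_itv/= lte_fin.
have [ab|ba] := ltP a b; first by rewrite -EFinB; exact: (speed_measure_itv (ltW ab)).
rewrite integral0_eq// => t _; rewrite set_itv_ge ?indic0 ?mule0//.
by rewrite bnd_simp -leNgt.
Qed.

(** Linearity and monotone convergence reduce the claim to indicator functions. Equality fails in
    general because tau may cover only a part of [0,1]. *)
Lemma time_change_le (N : R -> \bar R) : measurable_fun setT N -> (forall t, 0 <= N t)%E ->
  (forall t, t \in `[0, 1] -> tau t \in `[0, 1]) ->
  (\int[mu]_(t in D) (w t * N (tau t)) <= \int[mu]_(t in D) N t)%E.
Proof.
move=> mN N0 tD.
(* Restricting N changes nothing at the times tau t, and the right-hand integral then runs over the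
   whole line, as [speed_measure] requires. *)
pose N1 := N \_ D.
have mN1 : measurable_fun setT N1 by apply/(measurable_restrictT _ _).1; [|exact: measurable_funTS].
have N10 t : (0 <= N1 t)%E by apply: erestrict_ge0.
rewrite [leRHS]integral_mkcond.
have -> : (\int[mu]_(t in D) (w t * N (tau t)) = \int[mu]_(t in D) (w t * N1 (tau t)))%E.
  apply: eq_integral => t tt; rewrite /N1 patchE ifT//; move: tt; rewrite !inE/= => /tD.
  by [].
pose f := nnsfun_approx measurableT mN1.
have cf t : (f k t)%:E @[k --> \oo] --> N1 t by apply: cvg_nnsfun_approx.
have mwf k : measurable_fun setT (fun t => w t * (f k (tau t))%:E)%E.
  apply: emeasurable_funM => //; apply/measurable_EFinP.
  by apply: (measurableT_comp (f := f k)).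
have -> : (\int[mu]_(t in D) (w t * N1 (tau t)) =
    \int[mu]_(t in D) limn (fun k => w t * (f k (tau t))%:E))%E.
  apply: eq_integral => t _; apply/esym; apply: cvg_lim => //.
  by apply: cvgeZl => //; exact: cf.
rewrite monotone_convergence//; last 3 first.
- by move=> k; apply: measurable_funTS; exact: mwf.
- by move=> k t _; rewrite mule_ge0// lee_fin.
- move=> t _ k l kl; rewrite lee_pmul ?lee_fin//.
  by have /lefP := nd_nnsfun_approx measurableT mN1 kl; exact.
apply: lime_le.
  apply: ereal_nondecreasing_is_cvgn => k l kl; apply: ge0_le_integral => //.
  - by move=> t _; rewrite mule_ge0// lee_fin.
  - by apply: measurable_funTS; exact: mwf.
  - by apply: measurable_funTS; exact: mwf.
  move=> t _; rewrite lee_pmul ?lee_fin//.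
  by have /lefP := nd_nnsfun_approx measurableT mN1 kl; exact.
near=> k.
have mf : measurable_fun setT (fun x : R => (f k x)%:E : \bar R) by apply/measurable_EFinP.
apply: (@le_trans _ _ (\int[mu]_t (f k t)%:E)%E); last first.
  apply: ge0_le_integral => //.
  - by move=> t _; rewrite lee_fin.
  move=> t _; rewrite /f nnsfun_approxE.
  by apply: (le_approx (D := setT)) => // x _; exact: N10.
pose s := finmap.enum_fset (fset_set (f k @` setT)).
have s0 (i : 'I_(size s)) : 0 <= s`_i.
  have fin : finite_set (f k @` setT) by exact: fimfunP.
  have : (s`_i : R) \in s by apply: mem_nth.
  by rewrite in_fset_set// inE => -[t _ <-].
pose A (i : 'I_(size s)) := f k @^-1` [set s`_i].
have mA i : measurable (A i) by exact: measurable_sfunP.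
have fE t : (f k t)%:E = (\sum_(i < size s) ((s`_i)%:E * (\1_(A i) t)%:E))%E.
  by rewrite fimfunEord -sumEFin; apply: eq_bigr => i _; rewrite EFinM.
have si t (i : 'I_(size s)) : (0 <= (s`_i)%:E * (\1_(A i) t)%:E)%E by rewrite mule_ge0 ?lee_fin.
have -> : (\int[mu]_(t in D) (w t * (f k (tau t))%:E) = \int[mu]_(t in D)
    \sum_(i < size s) (w t * ((s`_i)%:E * (\1_(A i) (tau t))%:E)))%E.
  by apply: eq_integral => t _; rewrite fE ge0_sume_distrr// => i _; exact: si.
have -> : (\int[mu]_t (f k t)%:E =
    \int[mu]_t \sum_(i < size s) ((s`_i)%:E * (\1_(A i) t)%:E))%E.
  by apply: eq_integral => t _; rewrite fE.
have mi (i : 'I_(size s)) : measurable_fun setT (fun t => (\1_(A i) (tau t))%:E : \bar R) by exact: mind.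
have mj (i : 'I_(size s)) : measurable_fun setT (fun t : R => (\1_(A i) t)%:E : \bar R).
  by apply/measurable_EFinP; exact: measurable_indic.
rewrite !ge0_integral_sum//.
- apply: lee_sum => i _; rewrite ge0_integralZl_EFin//.
  under eq_integral do rewrite muleCA.
  rewrite ge0_integralZl_EFin//.
  + have -> : (\int[mu]_t (\1_(A i) t)%:E = mu (A i))%E by rewrite (@integral_indic _ _ _ mu setT measurableT (A i) (mA i)) setIT.
    by apply: lee_wpmul2l; [rewrite lee_fin|exact: speed_measure].
  + by move=> t _; rewrite mule_ge0// lee_fin.
  + by apply: measurable_funTS; apply: emeasurable_funM => //; exact: mi.
  + exact: mj.
- by move=> i; apply: measurable_funeM; exact: mj.
- move=> i; apply: measurable_funTS; apply: emeasurable_funM => //.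
  by apply: measurable_funeM; exact: mi.
- by move=> i t _; rewrite mule_ge0.
Unshelve. all: by end_near.
Qed.

End TimeChange.

(** * Bochner measurable Hamiltonians *)

Section FiniteSteps.
Context {R : realType}.
Local Notation D := (`[0%R, 1%R]%classic : set R).

(** Simple functions with values in an arbitrary type: measurability is stated for the fibres, so Y
    carries no sigma-algebra. *)
Definition finite_steps (Y : Type) (S : R -> Y) :=
  finite_set (S @` D) /\ forall y, measurable (D `&` [set t | S t = y]).

Lemma finite_steps_comp (Y Z : Type) (phi : Y -> Z) (S : R -> Y) :
  finite_steps S -> finite_steps (fun t => phi (S t)).
Proof.
move=> [fS mS]; split.
  have -> : (fun t => phi (S t)) @` D = phi @` (S @` D) by rewrite -image_comp.
  exact: finite_image.
move=> z.
have -> : D `&` [set t | phi (S t) = z] =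
    \bigcup_(y in (S @` D) `&` [set y | phi y = z]) (D `&` [set t | S t = y]).
  apply/seteqP; split=> [t [Dt tz]|t [y [_ yz] [Dt ty]]].
    by exists (S t); split=> //; exists t.
  by split=> //=; rewrite ty.
apply: fin_bigcup_measurable => [|y _]; last exact: mS.
by apply: sub_finite_set fS; exact: subIsetl.
Qed.

Lemma finite_steps_pair (Y Z : Type) (S : R -> Y) (T : R -> Z) :
  finite_steps S -> finite_steps T -> finite_steps (fun t => (S t, T t)).
Proof.
move=> [fS mS] [fT mT]; split.
  apply: sub_finite_set (finite_setX fS fT) => _ [t Dt <-].
  by split; exists t.
move=> [y z].
have -> : D `&` [set t | (S t, T t) = (y, z)] =
    (D `&` [set t | S t = y]) `&` (D `&` [set t | T t = z]).
  apply/seteqP; split=> [t [Dt [Sy Tz]]|t [[Dt Sy] [_ Tz]]] //.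
  by split=> //=; rewrite Sy Tz.
by apply: measurableI; [exact: mS|exact: mT].
Qed.

Lemma finite_steps_measurable (Y : Type) (phi : Y -> R) (S : R -> Y) :
  finite_steps S -> measurable_fun D (fun t => phi (S t)).
Proof.
move=> /(finite_steps_comp phi)[fS mS] _ B mB.
have -> : D `&` (fun t => phi (S t)) @^-1` B =
    \bigcup_(r in ((fun t => phi (S t)) @` D) `&` B) (D `&` [set t | phi (S t) = r]).
  apply/seteqP; split=> [t [Dt tB]|t [r [_ rB] [Dt tr]]].
    by exists (phi (S t)); split=> //; exists t.
  by split=> //=; rewrite tr.
apply: fin_bigcup_measurable => [|y _]; last exact: mS.
by apply: sub_finite_set fS; exact: subIsetl.
Qed.

Lemma finite_steps_reparam (Y : Type) (S : R -> Y) (tau : R -> R) :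
  finite_steps S -> continuous tau -> time_map tau -> finite_steps (fun t => S (tau t)).
Proof.
move=> [fS mS] ctau tD; split.
  by apply: sub_finite_set fS => _ [t Dt <-]; exists (tau t) => //; exact: tD.
move=> y; have mtau : measurable_fun setT tau := continuous_measurable_fun ctau.
have -> : D `&` [set t | S (tau t) = y] = D `&` (setT `&` tau @^-1` (D `&` [set t | S t = y])).
  apply/seteqP; split=> [t [Dt ty]|t [Dt [_ [_ ty]]]] //.
  by split=> //; split=> //; split=> //; exact: tD.
by apply: measurableI => //; apply: mtau => //; exact: mS.
Qed.

(** Rounding down to a multiple of 1 / (k + 1). It turns bounded continuous functions into simple
    ones, keeps [0,1] invariant, and fixes 0 exactly, which matters where tau' vanishes. *)
Definition quant (k : nat) (x : R) : R := (Num.floor (k.+1%:R * x))%:~R / k.+1%:R.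

Lemma quant_close k (x : R) : `|quant k x - x| <= k.+1%:R^-1.
Proof.
have k0 : (0 : R) < k.+1%:R by [].
pose z : R := (Num.floor (k.+1%:R * x))%:~R.
have z1 : z <= k.+1%:R * x by exact: ge_floor.
have z2 : k.+1%:R * x < z + 1 by have := floorD1_gt (k.+1%:R * x); rewrite intrD.
have -> : quant k x - x = (z - k.+1%:R * x) / k.+1%:R.
  by rewrite /quant mulrBl -/z; congr (_ - _); rewrite mulrAC mulfV ?mul1r ?gt_eqF.
rewrite normrM normfV (ger0_norm (ltW k0)) ler_pdivrMr// mulVf ?gt_eqF// ler_norml.
by apply/andP; split; lra.
Qed.

Lemma quant_cvg (e : R) : 0 < e -> \forall k \near \oo, forall x, `|quant k x - x| < e.
Proof.
move=> e0; have := near_infty_natSinv_lt (PosNum e0).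
by apply: filterS => k ke x; exact: le_lt_trans (quant_close k x) ke.
Qed.

Lemma quant0 k : quant k 0 = 0.
Proof. by rewrite /quant mulr0 floor0 mul0r. Qed.

Lemma quant_itv k (x : R) : x \in `[0, 1] -> quant k x \in `[0, 1].
Proof.
rewrite !in_itv/= => /andP[x0 x1]; have k0 : (0 : R) < k.+1%:R by [].
rewrite /quant divr_ge0 ?ler0z ?floor_ge0 ?mulr_ge0//=.
by rewrite ler_pdivrMr// mul1r (le_trans (ge_floor _))// ler_piMr// ltW.
Qed.

Lemma finite_steps_quant k (f : R -> R) (C : R) : continuous f ->
  (forall t, t \in `[0, 1] -> `|f t| <= C) -> finite_steps (fun t => quant k (f t)).
Proof.
move=> cf fC; apply: (finite_steps_comp (fun z : int => z%:~R / k.+1%:R)).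
have k0 : (0 : R) < k.+1%:R by [].
have cg : continuous (fun t => k.+1%:R * f t).
  by move=> t; apply: cvgM; [exact: cvg_cst|exact: cf].
have mg : measurable_fun setT (fun t => k.+1%:R * f t) := continuous_measurable_fun cg.
split; last first.
  move=> z.
  have -> : D `&` [set t | Num.floor (k.+1%:R * f t) = z] =
      D `&` (setT `&` (fun t => k.+1%:R * f t) @^-1` `[z%:~R, (z + 1)%:~R[%classic).
    apply/seteqP; split=> [t [Dt /= tz]|t [Dt [_ /=]]].
      by split=> //; split=> //=; rewrite in_itv/= -tz ge_floor floorD1_gt.
    by rewrite in_itv/= => /floor_def.
  by apply: measurableI => //; apply: mg => //; exact: measurable_itv.
pose N := (Num.truncn (k.+1%:R * `|C| + 1)).+1.
have NC : k.+1%:R * `|C| + 1 < N%:R :> R by exact: truncnS_gt.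
apply: sub_finite_set (finite_image (fun i : nat => i%:Z - N%:Z) (finite_II (N + N).+1)).
move=> _ [t Dt <-]; pose y := k.+1%:R * f t.
have [y1 y2] : - (N%:R - 1) <= y /\ y <= N%:R - 1.
  apply/andP; rewrite -ler_norml normrM (ger0_norm (ltW k0)).
  have := fC t Dt => h.
  have : k.+1%:R * `|f t| <= k.+1%:R * `|C|.
    by apply: ler_wpM2l; [exact: ltW|exact: le_trans h (ler_norm _)].
  by lra.
have f1 : - N%:Z <= Num.floor y.
  rewrite floor_ge_int; first by rewrite intrN/=; lra.
have f2 : Num.floor y <= N%:Z.
  by rewrite -(ler_int R) (le_trans (ge_floor _))//; lra.
exists (absz (Num.floor y + N%:Z)); last by rewrite gez0_abs ?addrK// -lerBlDr sub0r.
rewrite /=; lia.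
Qed.

End FiniteSteps.

Section Hamiltonians.
Context {R : realType} {n : nat} {M : closedManifold R n.*2.+1}.
Variables (alpha : contactForm M) (P : partitionOfUnity M).
Local Notation mu := (@lebesgue_measure R).
Local Notation D := (`[0%R, 1%R]%classic : set R).
Local Notation hn := (ham_norm alpha P).
Implicit Types (H G K : R -> M -> R) (tau : R -> R).

Lemma unit_itv_bounded (f : R -> R) : continuous f ->
  exists2 L, 0 <= L & forall t, t \in `[0, 1] -> `|f t| <= L.
Proof.
move=> cf; have cw : {within `[0, 1 : R], continuous f} by exact: continuous_subspaceT.
have [L [_ LP]] := compact_bounded (continuous_compact cw unit_itv_compact).
have L1 : L < L + 1 by rewrite ltrDl.
exists `|L + 1| => // t tt; apply: le_trans (ler_norm _); apply: (LP _ L1).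
by exists t.
Qed.

Definition dt tau : R -> R := fun t => 'D_1 (tau : R^o -> R^o) t.

(** The last clause expresses monotonicity, with e the sign of the derivative; constant time changes
    are included. *)
Definition time_ok tau := [/\ smooth_open setT (tau : R^o -> R^o), time_map tau &
  exists2 e, `|e| = 1 & forall t, `|dt tau t| = e * dt tau t].

Lemma time_ok_continuous tau : time_ok tau -> [/\ forall t, derivable (tau : R^o -> R^o) t 1,
  continuous tau & continuous (dt tau)].
Proof.
move=> [st _ _]; have dtau t : derivable (tau : R^o -> R^o) t 1.
  by apply/derivable1_diffP; exact: (smooth_open_differentiable st).
split=> // t; first exact: (smooth_open_continuous st).
exact: (smooth_open_continuous (smooth_open_derive (1 : R^o) st)).
Qed.

(* Strong measurability in C^0(M); simple functions are handled through
   [finite_steps]. *)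
Definition strong_meas H := exists (S : nat -> R -> M -> R) (Z : set R),
  [/\ forall k, finite_steps (S k), forall k t, t \in `[0, 1] -> continuous (S k t),
      measurable Z /\ mu Z = 0%E & forall t, t \in `[0, 1] -> ~ Z t ->
        forall e, 0 < e -> \forall k \near \oo, forall x, `|S k t x - H t x| < e].

Lemma uniform_cvgP (T : choiceType) (f_ : nat -> T -> R) (f : T -> R) :
  {uniform, f_ @ \oo --> f} <->
  forall e, 0 < e -> \forall k \near \oo, forall x, `|f_ k x - f x| < e.
Proof.
split=> [fc e e0|fc A /uniform_nbhs [E [entE EA]]].
  apply: (fc [set h : T -> R | forall x, `|h x - f x| < e]).
  apply/uniform_nbhs; exists [set p | ball p.1 e p.2]; split; first exact: (entourage_ball _ (PosNum e0)).
  by move=> h /= hE x; rewrite distrC; exact: hE.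
move: entE; rewrite -entourage_ballE => -[e /= e0 eE].
have := fc e e0; apply: filterS => k fk; apply: EA => x _; apply: eE => /=.
by rewrite /ball/= distrC; exact: fk.
Qed.

Lemma L1_C0P H : L1_C0 alpha P H <->
  [/\ forall t, t \in `[0, 1] -> continuous (H t), strong_meas H &
      (ham_norm1oo alpha P H < +oo)%E].
Proof.
split=> -[cH sH fH]; split=> //.
  have [S SS [Z [mZ Z0 sZ]]] := sH; exists S, Z; split=> //.
  - by move=> k; have [s1 _ s2] := SS k.
  - by move=> k; have [_ s1 _] := SS k.
  move=> t tt nZ; apply/uniform_cvgP; have [//|nt] := pselect ({uniform, S ^~ t @ \oo --> H t}).
  by exfalso; apply: nZ; apply: sZ => /(_ tt).
have [S [Z [fS cS [mZ Z0] SH]]] := sH; exists S.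
  by move=> k; have [f1 f2] := fS k; split=> //; exact: cS.
exists Z; split=> // t /= /not_implyP[tt nt]; apply: contrapT => nZ; apply: nt.
by apply/uniform_cvgP; exact: SH.
Qed.

(* Real numbers are used as bounds for a measurable majorant of the norm:
   the integral in [ham_norm1oo] is a lower integral, hence not subadditive in
   general. *)
Definition norm_le H (e : R) := (forall t, t \in `[0, 1] -> continuous (H t)) /\
  exists N : R -> \bar R, [/\ measurable_fun setT N, forall t, (0 <= N t)%E,
    forall t, t \in `[0, 1] -> ((hn (H t))%:E <= N t)%E & (\int[mu]_(t in D) N t <= e%:E)%E].

Lemma norm_le_eq H G e : (forall t, t \in `[0, 1] -> H t = G t) -> norm_le H e -> norm_le G e.
Proof.
move=> HG [cH [N [mN N0 HN Ne]]]; split=> [t tt|]; first by rewrite -HG//; exact: cH.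
by exists N; split=> // t tt; rewrite -HG//; exact: HN.
Qed.

Lemma norm_leD H G a b : norm_le H a -> norm_le G b ->
  norm_le (fun t x => H t x + G t x) (a + b).
Proof.
move=> [cH [N [mN N0 HN Na]]] [cG [L [mL L0 GL Lb]]]; split.
  by move=> t tt; apply: continuous_addr; [exact: cH|exact: cG].
exists (fun t => N t + L t)%E; split.
- exact: emeasurable_funD.
- by move=> t; rewrite adde_ge0.
- move=> t tt; apply: (@le_trans _ _ ((hn (H t))%:E + (hn (G t))%:E)%E); last first.
    by apply: leeD; [exact: HN|exact: GL].
  by rewrite -EFinD lee_fin; apply: ham_normD; [exact: cH|exact: cG].
rewrite ge0_integralD//; [|exact: measurable_funTS|exact: measurable_funTS].
by rewrite EFinD leeD.
Qed.

Lemma norm_le_ham H e : norm_le H e -> (ham_norm1oo alpha P H <= e%:E)%E.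
Proof.
move=> [cH [N [mN N0 HN Ne]]]; apply: le_trans Ne; apply: le_lower_integral => t tt.
  by rewrite lee_fin; apply: ham_norm_ge0; exact: cH.
exact: HN.
Qed.

Lemma integral_unit_cst (c : R) : (\int[mu]_(t in D) c%:E = c%:E)%E.
Proof. by rewrite integral_cst//= lebesgue_measure_itv /= lte_fin ltr01 oppr0 adde0 mule1. Qed.

Lemma norm_le_sup : exists2 C, 0 < C & forall H e,
  (forall t, t \in `[0, 1] -> continuous (H t)) ->
  (forall t x, t \in `[0, 1] -> `|H t x| <= e) -> norm_le H (C * e).
Proof.
have [C C0 CP] := ham_norm_bound alpha P; exists C => // H e cH He; split=> //.
have [x0 _] := @manifold_nonempty _ _ M.
have z01 : 0 \in `[0, 1 : R] by rewrite in_itv/= lexx ler01.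
have e0 : 0 <= e := le_trans (normr_ge0 _) (He 0 x0 z01).
exists (fun=> (C * e)%:E); split=> //.
- by move=> t; rewrite lee_fin mulr_ge0// ltW.
- move=> t tt; rewrite lee_fin; apply: CP; first exact: cH.
  by move=> x; exact: He.
by rewrite integral_unit_cst.
Qed.

Lemma norm_leN H e : norm_le H e -> norm_le (fun t x => - H t x) e.
Proof.
move=> [cH [N [mN N0 HN Ne]]]; split.
  by move=> t tt x; apply: cvgN; exact: cH.
exists N; split=> // t tt; apply: le_trans (HN t tt); rewrite lee_fin.
have := ham_normZ alpha P (-1) (cH t tt); rewrite normrN normr1 mul1r.
by under eq_fun do rewrite mulN1r.
Qed.

(** If N is a majorant for H, then |tau'| N(tau) is one for the segment, and [time_change_le] bounds
    its integral. *)
Lemma norm_le_seg H a tau : time_ok tau -> norm_le H a -> norm_le (seg_ham H tau) a.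
Proof.
move=> tok [cH [N [mN N0 HN Ne]]]; have [dtau ctau cdt] := time_ok_continuous tok.
have [_ tD [e e1 sgn]] := tok; split.
  by move=> t tt; apply: continuous_mull; exact: cH (tD _ tt).
exists (fun t => (`|dt tau t|)%:E * N (tau t))%E; split.
- apply: emeasurable_funM.
    apply/measurable_EFinP; apply: measurableT_comp => //; exact: continuous_measurable_fun.
  exact: (measurableT_comp mN (continuous_measurable_fun ctau)).
- by move=> t; rewrite mule_ge0// lee_fin.
- move=> t tt; apply: (@le_trans _ _ ((`|dt tau t|)%:E * (hn (H (tau t)))%:E)%E).
    by rewrite -EFinM lee_fin; apply: ham_normZ; exact: cH (tD _ tt).
  by apply: lee_wpmul2l; [rewrite lee_fin|exact: HN (tD _ tt)].
by apply: le_trans Ne; exact: (time_change_le dtau cdt e1 sgn).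
Qed.

Lemma continuous_bounded (f : M -> R) : continuous f ->
  exists2 B, 0 <= B & forall x, `|f x| <= B.
Proof.
move=> cf; have [[_ [u uf]] [_ [l lf]]] := range_bounded cf.
exists (Num.max `|u| `|l|) => [|x]; first by rewrite le_max normr_ge0.
have h1 : f x <= u by apply: uf; exists x.
have h2 : l <= f x by apply: lf; exists x.
rewrite ler_norml lerNl !le_max; apply/andP; split; apply/orP.
  by right; apply: (@le_trans _ _ (- l)); [rewrite lerN2|rewrite -normrN ler_norm].
by left; apply: le_trans h1 (ler_norm _).
Qed.

Lemma strong_measD H G : strong_meas H -> strong_meas G ->
  strong_meas (fun t x => H t x + G t x).
Proof.
move=> [S [Z [fS cS [mZ Z0] SH]]] [T [Y [fT cT [mY Y0] TG]]].
exists (fun k t x => S k t x + T k t x), (Z `|` Y); split.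
- move=> k.
  exact: (finite_steps_comp (fun q => fun x => q.1 x + q.2 x) (finite_steps_pair (fS k) (fT k))).
- by move=> k t tt; apply: continuous_addr; [exact: cS|exact: cT].
- split; first exact: measurableU.
  by apply: null_set_setU.
move=> t tt /not_orP[nZ nY] e e0.
have e2 : 0 < e / 2 by rewrite divr_gt0.
have := TG t tt nY _ e2; have := SH t tt nZ _ e2; apply: filterS2 => k hS hT x.
rewrite opprD addrACA [e]splitr (le_lt_trans (ler_normD _ _))// ltrD//.
Qed.

Lemma strong_measN H : strong_meas H -> strong_meas (fun t x => - H t x).
Proof.
move=> [S [Z [fS cS mZ SH]]]; exists (fun k t x => - S k t x), Z; split=> //.
- by move=> k; exact: (finite_steps_comp (fun q => fun x => - q x) (fS k)).
- by move=> k t tt x; apply: cvgN; exact: cS.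
move=> t tt nZ e e0; have := SH t tt nZ e e0; apply: filterS => k hS x.
by rewrite -opprD normrN.
Qed.

(** Sampling K at quantised times gives simple functions, which converge by uniform continuity on
    the compact cylinder. *)
Lemma strong_meas_continuous K : continuous_family K -> strong_meas K.
Proof.
move=> cK; exists (fun k t => K (quant k t)), set0; split.
- move=> k; apply: (finite_steps_comp K).
  apply: (@finite_steps_quant _ k id 1) => [t|t]; first exact: cvg_id.
  by rewrite in_itv/= => /andP[t0 t1]; rewrite ger0_norm.
- move=> k t tt; exact: (continuous_family_at cK (quant_itv k tt)).
- by split; [exact: measurable0|exact: measure0].
move=> t tt _ e e0.
have [d d0 dP] := family_uniform P rdist_cts rdistxx cK e0.
have := quant_cvg d0; apply: filterS => k kd x.
by apply: dP => //; [exact: quant_itv|rewrite rhoxx].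
Qed.

(** The times sent into the exceptional null set Z need not form a null set, for tau may rest at a
    point of Z. But tau' vanishes at almost all of them, and there the segment has Hamiltonian 0. *)
Lemma strong_meas_seg H tau : time_ok tau -> (forall t, t \in `[0, 1] -> continuous (H t)) ->
  strong_meas H -> strong_meas (seg_ham H tau).
Proof.
move=> tok cH [S [Z [fS cS [mZ Z0] SH]]].
have [dtau ctau cdt] := time_ok_continuous tok; have [_ tD [e e1 sgn]] := tok.
have [L L0 LP] := unit_itv_bounded cdt.
(* The integral of w is at most the measure of Z, that is 0; so for almost every t either tau'
   vanishes or tau t avoids Z. *)
pose w (t : R) : \bar R := ((`|dt tau t|)%:E * (\1_Z (tau t))%:E)%E.
have mI : measurable_fun setT (fun t : R => (\1_Z t)%:E : \bar R).
  by apply/measurable_EFinP; exact: measurable_indic.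
have mw : measurable_fun D w.
  apply: measurable_funTS; apply: emeasurable_funM.
    apply/measurable_EFinP; apply: measurableT_comp => //; exact: continuous_measurable_fun.
  exact: (measurableT_comp mI (continuous_measurable_fun ctau)).
have w0 : (\int[mu]_(t in D) `|w t| = 0)%E.
  apply/eqP; rewrite eq_le integral_ge0 ?andbT//.
  have -> : (\int[mu]_(t in D) `|w t| = \int[mu]_(t in D) w t)%E.
    by apply: eq_integral => t _; rewrite gee0_abs// mule_ge0// lee_fin.
  apply: (@le_trans _ _ (\int[mu]_(t in D) (\1_Z t)%:E)%E).
    by apply: (time_change_le dtau cdt e1 sgn) => // t; rewrite lee_fin.
  have mD : measurable D by exact: measurable_itv.
  rewrite (@integral_indic _ _ _ mu D mD Z mZ) -Z0.
  by apply: le_measure; [rewrite inE; exact: measurableI|rewrite inE|exact: subIsetl].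
have [Y [mY Y0 YP]] := (ae_eq_integral_abs mu (measurable_itv _) mw).1 w0.
exists (fun k t x => quant k (dt tau t) * S k (tau t) x), Y; split=> //.
- move=> k; exact: (finite_steps_comp (fun q => fun x => q.1 * q.2 x)
    (finite_steps_pair (finite_steps_quant k cdt LP) (finite_steps_reparam (fS k) ctau tD))).
- by move=> k t tt; apply: continuous_mull; exact: cS (tD _ tt).
move=> t tt nY eps eps0.
have wt : w t = 0%E by apply: contrapT => wt; apply: nY; apply: YP => /(_ tt).
(* Where tau' = 0 the quantised factor is exactly 0, so the unknown behaviour of S at tau t is
   irrelevant. *)
have [d0|dn0] := eqVneq (dt tau t) 0.
  apply: nearW => k x; rewrite d0 quant0 /seg_ham -/(dt tau t) d0 !mul0r subrr normr0//.
have nZ : ~ Z (tau t).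
  move=> Zt; move: wt; rewrite /w indicE mem_set// mule1 => -[] /eqP.
  by rewrite normr_eq0 (negbTE dn0).
have [B B0 BP] := continuous_bounded (cH _ (tD _ tt)).
set d := dt tau t in dn0 *.
have p1 : 0 < eps / 2 / (B + 1) by rewrite !divr_gt0 ?ltr_wpDl.
(* The 1 in the minimum bounds the simple functions by B + 1 for large k. *)
have p2 : 0 < Num.min 1 (eps / 2 / (`|d| + 1)) by rewrite lt_min ltr01 !divr_gt0 ?ltr_wpDl.
have := SH _ (tD _ tt) nZ _ p2; have := quant_cvg p1.
apply: filterS2 => k /(_ d) hq hS x; rewrite /seg_ham -/(dt tau t) -/d.
have := hS x; rewrite lt_min => /andP[s1 s2].
have hH := BP x.
have -> : quant k d * S k (tau t) x - d * H (tau t) x =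
  (quant k d - d) * S k (tau t) x + d * (S k (tau t) x - H (tau t) x) by ring.
rewrite (le_lt_trans (ler_normD _ _))// !normrM [eps]splitr.
apply: ler_ltD.
  have sB : `|S k (tau t) x| <= B + 1.
    have -> : S k (tau t) x = H (tau t) x + (S k (tau t) x - H (tau t) x) by ring.
    by apply: le_trans (ler_normD _ _) _; apply: lerD => //; exact: ltW.
  have -> : eps / 2 = eps / 2 / (B + 1) * (B + 1) by rewrite mulfVK ?gt_eqF ?ltr_wpDl.
  by apply: ler_pM => //; exact: ltW.
have -> : eps / 2 = (`|d| + 1) * (eps / 2 / (`|d| + 1)) by rewrite [RHS]mulrC mulfVK ?gt_eqF ?ltr_wpDl.
apply: (@le_lt_trans _ _ (`|d| * (eps / 2 / (`|d| + 1)))).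
  by rewrite ler_wpM2l// ltW.
by rewrite ltr_pM2r ?ltrDl// !divr_gt0 ?ltr_wpDl.
Qed.

(** The norm is continuous for uniform convergence, so off the null set Z its value at H t is a
    limit of measurable simple functions. On Z the majorant is infinite, at no cost to its
    integral. *)
Lemma strong_norm_le H e : (forall t, t \in `[0, 1] -> continuous (H t)) -> strong_meas H ->
  (ham_norm1oo alpha P H <= e%:E)%E -> norm_le H e.
Proof.
move=> cH [S [Z [fS cS [mZ Z0] SH]]] He; split=> //.
have mD : measurable D by exact: measurable_itv.
have [C C0 CP] := ham_norm_bound alpha P.
have hnB f h : continuous f -> continuous h -> forall d, (forall x, `|f x - h x| <= d) ->
    hn f - hn h <= C * d.
  move=> cf ch d fh; rewrite lerBlDr.
  have -> : f = (fun x => (f x - h x) + h x) by apply/funext => x; rewrite subrK.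
  have cfh : continuous (fun x => f x - h x) by move=> x; apply: cvgB; [exact: cf|exact: ch].
  by apply: le_trans (ham_normD alpha P cfh ch) _; rewrite lerD2r; exact: CP.
have mh : measurable_fun (D `\` Z) (fun t => hn (H t)).
  apply: (@measurable_fun_cvg _ _ _ _ (fun k t => hn (S k t))).
    by move=> k; apply: measurable_funS (finite_steps_measurable hn (fS k)) => //; exact: subDsetl.
  move=> t [tt nZ]; apply/cvgrPdist_lt => eps eps0.
  have p1 : 0 < eps / 2 / C by rewrite !divr_gt0.
  have := SH t tt nZ _ p1; apply: filterS => k hS.
  have C2 : C * (eps / 2 / C) = eps / 2 by rewrite mulrC mulfVK// gt_eqF.
  have h1 := hnB _ _ (cH t tt) (cS k t tt) _ (fun x => ltW (_ : `|H t x - S k t x| < _)).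
  have {h1} h1 : hn (H t) - hn (S k t) <= eps / 2.
    by rewrite -C2; apply: h1 => x; rewrite distrC; exact: hS.
  have h2 : hn (S k t) - hn (H t) <= eps / 2.
    rewrite -C2; apply: hnB; [exact: cS|exact: cH|by move=> x; exact: ltW (hS x)].
  by rewrite ltr_norml; lra.
have mDZ : measurable (D `\` Z) by exact: measurableD.
pose A : R -> \bar R := (fun t => (hn (H t))%:E) \_ (D `\` Z).
have mA : measurable_fun setT A.
  have mE : measurable_fun (D `\` Z) (fun t => (hn (H t))%:E : \bar R) by apply/measurable_EFinP.
  exact: ((measurable_restrictT _ mDZ).1 mE).
(* On Z measurability of the norm is unknown; the infinite value makes the majorant valid there. *)
pose B : R -> \bar R := (cst +oo%E) \_ (D `&` Z).
have mB : measurable_fun setT B.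
  have mE : measurable_fun (D `&` Z) (cst +oo%E : R -> \bar R) by exact: measurable_cst.
  exact: ((measurable_restrictT _ (measurableI _ _ mD mZ)).1 mE).
have A0 t : (0 <= A t)%E.
  rewrite /A patchE; case: ifPn => //; rewrite inE => -[tt _].
  by rewrite lee_fin; apply: ham_norm_ge0; exact: cH.
have B0 t : (0 <= B t)%E by rewrite /B patchE; case: ifPn => _ //=; rewrite le0y.
exists (fun t => A t + B t)%E; split.
- exact: emeasurable_funD.
- by move=> t; rewrite adde_ge0.
- move=> t tt; have [Zt|nZ] := pselect (Z t).
    have -> : B t = +oo%E by rewrite /B patchE mem_set.
    by rewrite addey ?leey// gt_eqF// (lt_le_trans _ (A0 t))// ltNy0.
  have -> : A t = (hn (H t))%:E by rewrite /A patchE mem_set.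
  by rewrite leeDl.
apply: le_trans He.
have -> : (\int[mu]_(t in D) (A t + B t) = \int[mu]_(t in D) A t)%E.
  apply: ae_eq_integral => //; [exact: measurable_funTS (emeasurable_funD mA mB)|exact: measurable_funTS|].
  exists Z; split=> // t /= /not_implyP[tt AB]; apply: contrapT => nZ; apply: AB.
  by rewrite /B patchE memNset ?adde0// => -[].
apply: le_lower_integral => t tt; first exact: A0.
rewrite /A patchE; case: ifPn => // _; rewrite lee_fin; apply: ham_norm_ge0; exact: cH.
Qed.

Lemma L1_C0_seg H tau : time_ok tau -> L1_C0 alpha P H -> L1_C0 alpha P (seg_ham H tau).
Proof.
move=> tok /L1_C0P[cH sH fH]; have [_ tD _] := tok; apply/L1_C0P; split.
- by move=> t tt; apply: continuous_mull; exact: cH (tD _ tt).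
- exact: strong_meas_seg.
have H0 : (0 <= ham_norm1oo alpha P H)%E.
  by apply: integral_ge0 => t tt; rewrite lee_fin; apply: ham_norm_ge0; exact: cH.
have Hf : ham_norm1oo alpha P H = (fine (ham_norm1oo alpha P H))%:E by rewrite fineK// ge0_fin_numE.
have hle : norm_le H (fine (ham_norm1oo alpha P H)) by apply: strong_norm_le; rewrite -?Hf.
exact: le_lt_trans (norm_le_ham (norm_le_seg tok hle)) (ltry _).
Qed.

Lemma L1_C0_cat H G : L1_C0 alpha P H -> L1_C0 alpha P G -> L1_C0 alpha P (cat_ham H G).
Proof.
have fin K : L1_C0 alpha P K -> exists e, norm_le K e.
  move=> /L1_C0P[cK sK fK]; exists (fine (ham_norm1oo alpha P K)).
  apply: strong_norm_le => //; rewrite fineK// ge0_fin_numE//.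
  by apply: integral_ge0 => t tt; rewrite lee_fin; apply: ham_norm_ge0; exact: cK.
move=> lH lG; have [a aH] := fin _ lH; have [b bG] := fin _ lG.
move: lH lG => /L1_C0P[cH sH fH] /L1_C0P[cG sG fG]; apply/L1_C0P; split.
- by move=> t tt; apply: continuous_addr; [exact: cH|exact: cG].
- exact: strong_measD.
exact: le_lt_trans (norm_le_ham (norm_leD aH bG)) (ltry _).
Qed.

Section Filter.
Context {I : Type} (F : set_system I) {FF : Filter F}.

Definition ham_cv (H_ : I -> R -> M -> R) H := forall e, 0 < e ->
  \forall i \near F, norm_le (fun t x => H_ i t x - H t x) e.

Lemma ham_cv_cat (H_ G_ : I -> R -> M -> R) H G : ham_cv H_ H -> ham_cv G_ G ->
  ham_cv (fun i => cat_ham (H_ i) (G_ i)) (cat_ham H G).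
Proof.
move=> cH cG e e0; have e2 : 0 < e / 2 by rewrite divr_gt0.
have := cG _ e2; have := cH _ e2; apply: filterS2 => i h1 h2.
rewrite [e]splitr; apply: norm_le_eq (norm_leD h1 h2) => t _; apply/funext => x.
by rewrite /cat_ham; ring.
Qed.

(** As for continuity of translations in L^1: H is replaced by a continuous K close to it in norm.
    The errors H_ i - H and H - K do not grow under a time change by [norm_le_seg], and for K the
    convergence of the time changes gives uniform convergence. *)
Lemma ham_cv_seg (H_ : I -> R -> M -> R) H (tau_ : I -> R -> R) tau :
  ham_cv H_ H -> (forall e, 0 < e -> exists2 K, continuous_family K &
    norm_le (fun t x => H t x - K t x) e) ->
  (forall i, time_ok (tau_ i)) -> time_ok tau -> time_cv F tau_ tau ->
  time_cv F (fun i => dt (tau_ i)) (dt tau) ->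
  ham_cv (fun i => seg_ham (H_ i) (tau_ i)) (seg_ham H tau).
Proof.
move=> cvH apx tok_ tok cvt cvd e e0.
have e4 : 0 < e / 4 by rewrite divr_gt0.
have [K cK HK] := apx _ e4.
have [dtau ctau cdt] := time_ok_continuous tok; have [_ tD _] := tok.
have tD_ i : time_map (tau_ i) by case: (tok_ i).
have [C C0 CP] := norm_le_sup.
have [L L0 LP] := unit_itv_bounded cdt.
have [B B0 BP] : exists2 B, 0 <= B & forall t x, t \in `[0, 1] -> `|K t x| <= B.
  have [B [_ BP]] := compact_bounded (continuous_compact cK cylinder_compact).
  have B1 : B < B + 1 by rewrite ltrDl.
  exists `|B + 1| => // t x tt; apply: le_trans (ler_norm _); apply: (BP _ B1).
  by exists (t, x).
have Kc t : t \in `[0, 1] -> continuous (K t) by move=> tt; exact: continuous_family_at.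
(* One of four error terms gets e / 4; C passes from the supremum to the norm, the 2 splits the
   product difference into a change of tau' times K, bounded by B, and tau', bounded by L, times a
   change of K. *)
have p1 : 0 < e / 4 / C / 2 / (B + 1) by rewrite !divr_gt0 ?ltr_wpDl.
have p2 : 0 < e / 4 / C / 2 / (L + 1) by rewrite !divr_gt0 ?ltr_wpDl.
have [d d0 dP] := family_uniform P rdist_cts rdistxx cK p2.
have h1 := cvH _ e4; have h2 := cvd _ p1.
have h3 : \forall i \near F, forall t x, t \in `[0, 1] ->
    rdist (K (tau_ i t) x) (K (tau t) x) < e / 4 / C / 2 / (L + 1).
  have := cvt _ d0; apply: filterS => i ti t x tt.
  by apply: dP; [exact: tD_|exact: tD|exact: ti|rewrite rhoxx].
move: h1 h2 h3; apply: filterS3 => i h1 h2 h3.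
have s1 := norm_le_seg (tok_ i) h1.
have s2 := norm_le_seg (tok_ i) HK.
have s4 := norm_leN (norm_le_seg tok HK).
have s3 : norm_le (fun t x => seg_ham K (tau_ i) t x - seg_ham K tau t x) (e / 4).
  have <- : C * (e / 4 / C) = e / 4 by rewrite mulrC mulfVK// gt_eqF.
  apply: CP => [t tt|t x tt].
    have c1 : continuous (seg_ham K (tau_ i) t) by apply: continuous_mull; exact: Kc (tD_ i _ tt).
    have c2 : continuous (seg_ham K tau t) by apply: continuous_mull; exact: Kc (tD _ tt).
    by move=> x; apply: cvgB; [exact: c1|exact: c2].
  have k1 := BP (tau_ i t) x (tD_ i _ tt); have k2 := h2 t tt; have k3 := h3 t x tt.
  have k4 := LP t tt; rewrite /rdist in k3.
  rewrite /seg_ham -!/(dt _ t).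
  have -> : dt (tau_ i) t * K (tau_ i t) x - dt tau t * K (tau t) x =
    (dt (tau_ i) t - dt tau t) * K (tau_ i t) x + dt tau t * (K (tau_ i t) x - K (tau t) x) by ring.
  apply: le_trans (ler_normD _ _) _; rewrite !normrM [leRHS]splitr.
  apply: lerD.
    have -> : e / 4 / C / 2 = e / 4 / C / 2 / (B + 1) * (B + 1) by rewrite mulfVK ?gt_eqF ?ltr_wpDl.
    by apply: ler_pM => //; [exact: ltW|apply: le_trans k1 _; rewrite lerDl].
  have -> : e / 4 / C / 2 = (L + 1) * (e / 4 / C / 2 / (L + 1)).
    by rewrite [RHS]mulrC mulfVK ?gt_eqF ?ltr_wpDl.
  by apply: ler_pM => //; [apply: le_trans k4 _; rewrite lerDl|exact: ltW].
have -> : e = e / 4 + e / 4 + (e / 4 + e / 4) by field.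
apply: norm_le_eq (norm_leD (norm_leD s1 s2) (norm_leD s3 s4)) => t _; apply/funext => x.
by rewrite /seg_ham; ring.
Qed.

End Filter.

End Hamiltonians.

(** * Concatenation of topological contact systems *)

Section Clocks.
Context {R : realType}.
Implicit Types (sigma : R -> R) (a b : R).

Definition clock sigma := [/\ smooth_open setT (sigma : R^o -> R^o),
  forall x y, x <= y -> sigma x <= sigma y & forall t, 0 <= sigma t <= 1].

Definition ramp sigma a b : R -> R := fun s => a + (b - a) * sigma s.

(** [early] moves only during [0, 1/3] and [late] only during [2/3, 1]; the pause in between
    contains 1/2 in its interior. The summands 0 and - 2 have the shape required by [clock_step]. *)
Definition early : R -> R := fun s => step (0 + 3 * s).
Definition late : R -> R := fun s => step (- 2 + 3 * s).

Lemma clock_step (c : R) : clock (fun s => step (c + 3 * s)).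
Proof.
split=> [|x y xy|t]; last by rewrite step_ge0 step_le1.
  apply: (@smooth_open_comp _ _ _ _ _ setT (fun s : R^o => c + 3 * s : R^o)).
  - exact: has_coordinates_R.
  - exact: openT.
  - exact: openT.
  - by [].
  - exact: smooth_affine.
  - exact: smooth_step.
by apply: step_ndecr; lra.
Qed.

Lemma clock_derivable sigma : clock sigma -> forall t, derivable (sigma : R^o -> R^o) t 1.
Proof. by move=> [ss _ _] t; apply/derivable1_diffP; exact: (smooth_open_differentiable ss). Qed.

Lemma clock_dt_ge0 sigma t : clock sigma -> 0 <= dt sigma t.
Proof.
move=> cs; have [_ ndecr _] := cs.
apply: limr_ge; first exact: (@clock_derivable _ cs t).
apply: nearW => h /=; rewrite /GRing.scale/= mulr1.
have [h0|h0] := leP 0 h.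
  by rewrite mulr_ge0 ?invr_ge0// subr_ge0 ndecr// lerDr.
by rewrite mulr_le0 ?invr_le0 ?(ltW h0)// subr_le0 ndecr// gerDr ltW.
Qed.

Lemma dt_ramp sigma a b t : clock sigma -> dt (ramp sigma a b) t = (b - a) * dt sigma t.
Proof.
move=> cs; have d1 := DeriveDef (@clock_derivable _ cs t) erefl.
have d2 := is_deriveD (is_derive_cst (a : R^o) (t : R^o) (1 : R^o)) (is_deriveZ (b - a) d1).
have [_ e] := d2; have <- : 'D_1 (cst (a : R^o) + (b - a) \*: (sigma : R^o -> R^o)) t =
  (b - a) * dt sigma t by rewrite e add0r.
by [].
Qed.

Lemma time_ok_ramp sigma a b : clock sigma -> a \in `[0, 1] -> b \in `[0, 1] ->
  time_ok (ramp sigma a b).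
Proof.
move=> cs; rewrite !in_itv/= => /andP[a0 a1] /andP[b0 b1]; have [ss nd s01] := cs; split.
- apply: (@smooth_open_comp _ _ _ _ _ setT (sigma : R^o -> R^o) (fun x : R^o => a + (b - a) * x : R^o)).
  + exact: has_coordinates_R.
  + exact: openT.
  + exact: openT.
  + by [].
  + exact: ss.
  + exact: smooth_affine.
- move=> t _; rewrite in_itv/=; have /andP[t0 t1] := s01 t.
  have -> : ramp sigma a b t = (1 - sigma t) * a + sigma t * b by rewrite /ramp; ring.
  have h1 : 0 <= 1 - sigma t by lra.
  rewrite addr_ge0 ?mulr_ge0//=.
  have h2 : (1 - sigma t) * a <= 1 - sigma t by rewrite ler_piMr.
  have h3 : sigma t * b <= sigma t by rewrite ler_piMr.
  by lra.
have [ab|ba] := leP a b.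
  exists 1 => [|t]; first by rewrite normr1.
  by rewrite mul1r ger0_norm// dt_ramp// mulr_ge0 ?subr_ge0// clock_dt_ge0.
exists (-1) => [|t]; first by rewrite normrN normr1.
rewrite mulN1r ler0_norm// dt_ramp// mulr_le0_ge0 ?clock_dt_ge0//.
by rewrite subr_le0 ltW.
Qed.

Definition param_cv (I : Type) (F : set_system I) (a_ : I -> R) a :=
  forall e, 0 < e -> \forall i \near F, `|a_ i - a| < e.

Lemma time_cv_ramp (I : Type) (F : set_system I) (FF : Filter F) (a_ b_ : I -> R) sigma a b :
  clock sigma -> param_cv F a_ a -> param_cv F b_ b ->
  time_cv F (fun i => ramp sigma (a_ i) (b_ i)) (ramp sigma a b) /\
  time_cv F (fun i => dt (ramp sigma (a_ i) (b_ i))) (dt (ramp sigma a b)).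
Proof.
move=> cs cva cvb; have [ss nd s01] := cs; split=> e e0.
  have e3 : 0 < e / 3 by rewrite divr_gt0.
  have := cvb _ e3; have := cva _ e3; apply: filterS2 => i ha hb t _.
  have /andP[t0 t1] := s01 t.
  have -> : ramp sigma (a_ i) (b_ i) t - ramp sigma a b t =
    (1 - sigma t) * (a_ i - a) + sigma t * (b_ i - b) by rewrite /ramp; ring.
  have h1 : 0 <= 1 - sigma t by lra.
  rewrite (le_lt_trans (ler_normD _ _))// !normrM (ger0_norm t0) (ger0_norm h1).
  have h2 : (1 - sigma t) * `|a_ i - a| <= `|a_ i - a| by rewrite ler_piMl//; lra.
  have h3 : sigma t * `|b_ i - b| <= `|b_ i - b| by rewrite ler_piMl.
  by lra.
have cdt : continuous (dt sigma).
  by move=> t; exact: (smooth_open_continuous (smooth_open_derive (1 : R^o) ss)).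
have [L L0 LP] := unit_itv_bounded cdt.
have e3 : 0 < e / 2 / (L + 1) by rewrite !divr_gt0 ?ltr_wpDl.
have := cvb _ e3; have := cva _ e3; apply: filterS2 => i ha hb t tt.
rewrite !dt_ramp//.
have -> : (b_ i - a_ i) * dt sigma t - (b - a) * dt sigma t =
  ((b_ i - b) - (a_ i - a)) * dt sigma t by ring.
rewrite normrM; apply: (@le_lt_trans _ _ (`|(b_ i - b) - (a_ i - a)| * L)).
  by rewrite ler_wpM2l// LP.
have h1 : `|(b_ i - b) - (a_ i - a)| < e / 2 / (L + 1) + e / 2 / (L + 1).
  by rewrite (le_lt_trans (ler_normB _ _))// ltrD.
have h2 : e = (e / 2 / (L + 1) + e / 2 / (L + 1)) * (L + 1).
  by rewrite mulrDl !mulfVK -?splitr ?gt_eqF ?ltr_wpDl.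
rewrite [ltRHS]h2; apply: (@le_lt_trans _ _ ((e / 2 / (L + 1) + e / 2 / (L + 1)) * L)).
  by rewrite ler_wpM2r// ltW.
by rewrite ltr_pM2l ?ltrDl// addr_gt0.
Qed.

Lemma early0 a b : ramp early a b 0 = a.
Proof. by rewrite /ramp /early step_le0 ?mulr0 ?addr0. Qed.

Lemma early1 a b s : 1 <= 3 * s -> ramp early a b s = b.
Proof. by move=> h; rewrite /ramp /early step_ge1 ?add0r// mulr1 addrC subrK. Qed.

Lemma late0 a b s : 3 * s <= 2 -> ramp late a b s = a.
Proof. by move=> h; rewrite /ramp /late step_le0 ?mulr0 ?addr0//; lra. Qed.

Lemma late1 a b : ramp late a b 1 = b.
Proof. by rewrite /ramp /late step_ge1 ?mulr1 ?subrKC//; lra. Qed.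

Lemma dt_locally_cst (tau : R -> R) t c : (\forall s \near t, tau s = c) -> dt tau t = 0.
Proof.
move=> tc; rewrite /dt; have -> : 'D_1 (tau : R^o -> R^o) t = 'D_1 (cst (c : R^o)) t.
  exact: near_eq_derive.
exact: derive_cst.
Qed.

End Clocks.

Section Systems.
Context {R : realType} {n : nat} {M : closedManifold R n.*2.+1}.
Variables (alpha : contactForm M) (g : riemannianMetric M) (P : partitionOfUnity M).

Record sys := Sys { flow : R -> homeo M; ham : R -> M -> R; conf : R -> M -> R }.

(* The flow of [conc q p a b0 b1] starts at the identity, runs through q up to
   the time a, then through p, translated to the right, from b0 to b1; its time
   one map is p_b1 p_b0^-1 q_a. *)
Definition conc (q p : sys) (a b0 b1 : R) : sys := Sys
  (cat_iso (seg_iso (flow p) (ramp late b0 b1)) (seg_iso (flow q) (ramp early 0 a)))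
  (cat_ham (seg_ham (ham p) (ramp late b0 b1)) (seg_ham (ham q) (ramp early 0 a)))
  (cat_conf (seg_conf (flow p) (conf p) (ramp late b0 b1))
    (seg_iso (flow q) (ramp early 0 a)) (seg_conf (flow q) (conf q) (ramp early 0 a))).

Definition smooth_sys (p : sys) := smooth_contact_system alpha (flow p) (ham p) (conf p).

Let z01 : (0 : R) \in `[0, 1]. Proof. by rewrite in_itv/= lexx ler01. Qed.

Let o01 : (1 : R) \in `[0, 1]. Proof. by rewrite in_itv/= lexx ler01. Qed.

Lemma smooth_conc (q p : sys) a b0 b1 : smooth_sys q -> smooth_sys p ->
  a \in `[0, 1] -> b0 \in `[0, 1] -> b1 \in `[0, 1] -> smooth_sys (conc q p a b0 b1).
Proof.
move=> sq sp a01 b001 b101.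
have [sB tB _] := time_ok_ramp (clock_step (- 2)) b001 b101.
have [sA tA _] := time_ok_ramp (clock_step 0) z01 a01.
apply: smooth_cat; [exact: smooth_seg|exact: smooth_seg|move=> t t01].
(* Below 1/2 [late] still rests at its start; from 1/2 on [early] rests at its end. Both hold in a
   neighbourhood of t, since the pause extends beyond 1/2 on either side. *)
have [th|th] := ltP t (1 / 2); [left|right].
  have nB : \forall s \near t, ramp late b0 b1 s = b0.
    have := lt_nbhsl th; apply: filterS => s sh; apply: late0.
    by have : s < 1 / 2 by []; lra.
  split; last by apply/funext => x; rewrite /seg_ham [X in X * _](dt_locally_cst nB) mul0r.
  apply: filterS nB => s Bs _ x; rewrite /seg_iso /= Bs late0 ?hinvK//; lra.
have nA : \forall s \near t, ramp early 0 a s = a.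
  have t3 : 1 / 3 < t by apply: lt_le_trans th; lra.
  have := lt_nbhsr t3; apply: filterS => s sh; apply: early1.
  by have : 1 / 3 < s by []; lra.
split; last by apply/funext => x; rewrite /seg_ham [X in X * _](dt_locally_cst nA) mul0r.
have At := nbhs_singleton nA.
by apply: filterS nA => s As _ x; rewrite /seg_iso /= As At.
Qed.

(** The properties required of a limit system. Approximability of the Hamiltonian by continuous
    families is the form of integrability used when the time changes vary. *)
Definition sys_ok (p : sys) := [/\ continuous_family (fun t x => flow p t x), continuous_family (conf p) &
  forall e, 0 < e -> exists2 K, continuous_family K &
    norm_le alpha P (fun t x => ham p t x - K t x) e].

Definition sys_cv (I : Type) (F : set_system I) (p_ : I -> sys) (p : sys) :=
  [/\ iso_cv P F (fun i => flow (p_ i)) (flow p),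
      ucv F (@rdist R) (fun i => conf (p_ i)) (conf p) &
      ham_cv alpha P F (fun i => ham (p_ i)) (ham p)].

Lemma continuous_family_seg (Phi : R -> homeo M) (tau : R -> R) :
  continuous_family (fun t x => Phi t x) -> continuous tau -> time_map tau ->
  continuous_family (fun t x => seg_iso Phi tau t x).
Proof.
move=> cP ctau tD.
apply: (continuous_family_comp (continuous_family_reparam cP ctau tD)).
by apply: continuous_family_cst; exact: hinv_continuous.
Qed.

(** The arbitrary filter covers two uses: along the natural numbers, with fixed times, concatenated
    approximants converge; along [near_dist] the concatenation is continuous in its first system and
    in the times. *)
Lemma sys_cv_conc (I : Type) (F : set_system I) (FF : Filter F) (q_ p_ : I -> sys) (q p : sys)
    (a_ b_ c_ : I -> R) a b c :
  sys_ok q -> sys_ok p -> sys_cv F q_ q -> sys_cv F p_ p ->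
  (forall i, a_ i \in `[0, 1]) -> (forall i, b_ i \in `[0, 1]) -> (forall i, c_ i \in `[0, 1]) ->
  a \in `[0, 1] -> b \in `[0, 1] -> c \in `[0, 1] ->
  param_cv F a_ a -> param_cv F b_ b -> param_cv F c_ c ->
  sys_cv F (fun i => conc (q_ i) (p_ i) (a_ i) (b_ i) (c_ i)) (conc q p a b c).
Proof.
move=> [cq hq aq] [cp hp ap] [q1 q2 q3] [p1 p2 p3] ai bi ci a01 b01 c01 cva cvb cvc.
have cv0 : param_cv F (fun=> 0 : R) 0.
  by move=> e e0; apply: nearW => i; rewrite subrr normr0.
have okB_ i := time_ok_ramp (clock_step (- 2)) (bi i) (ci i).
have okA_ i := time_ok_ramp (clock_step 0) z01 (ai i).
have okB := time_ok_ramp (clock_step (- 2)) b01 c01.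
have okA := time_ok_ramp (clock_step 0) z01 a01.
have [tcB dcB] := time_cv_ramp FF (clock_step (- 2)) cvb cvc.
have [tcA dcA] := time_cv_ramp FF (clock_step 0) cv0 cva.
have [_ cB _] := time_ok_continuous okB; have [_ cA _] := time_ok_continuous okA.
have tB_ i : time_map (ramp late (b_ i) (c_ i)) by case: (okB_ i).
have tA_ i : time_map (ramp early 0 (a_ i)) by case: (okA_ i).
have tB : time_map (ramp late b c) by case: okB.
have tA : time_map (ramp early 0 a) by case: okA.
have sB := iso_cv_seg cp cB p1 tcB tB_ tB.
have sA := iso_cv_seg cq cA q1 tcA tA_ tA.
have csB := continuous_family_seg cp cB tB.
have csA := continuous_family_seg cq cA tA.
have hB := conf_cv_seg cp hp cB p1 p2 tcB tB_ tB.
have hA := conf_cv_seg cq hq cA q1 q2 tcA tA_ tA.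
have cfB : continuous_family (seg_conf (flow p) (conf p) (ramp late b c)).
  have c1 := continuous_family_cst (@hinv_continuous _ (flow p (ramp late b c 0))).
  have c2 := continuous_family_comp (continuous_family_reparam hp cB tB) c1.
  have c3 : continuous_family
      (fun=> fun x => conf p (ramp late b c 0) (hinv (flow p (ramp late b c 0)) x)).
    apply: continuous_family_cst => x; apply: continuous_comp; first exact: hinv_continuous.
    by apply: continuous_family_at => //; exact: tB.
  by move=> z; apply: cvgB; [exact: c2|exact: c3].
have mB := ham_cv_seg p3 ap okB_ okB tcB dcB.
have mA := ham_cv_seg q3 aq okA_ okA tcA dcA.
move: (sB FF) (sA FF) (hB FF) (hA FF) (mB FF) (mA FF) => {}sB {}sA {}hB {}hA {}mB {}mA.
split.
- exact: (iso_cv_cat csB csA sB sA).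
- exact: (conf_cv_cat cfB sA hB hA).
exact: (ham_cv_cat mB mA).
Qed.

Lemma sys_cv_cst (I : Type) (F : set_system I) (FF : Filter F) (p : sys) : sys_cv F (fun=> p) p.
Proof.
have c0 : forall e : R, 0 < e -> e > 0 by [].
split.
- by split=> e e0; apply: nearW => i t x _; rewrite rhoxx.
- by move=> e e0; apply: nearW => i t x _; rewrite rdistxx.
have [C C0 CP] := norm_le_sup alpha P.
move=> e e0; apply: nearW => i.
have -> : e = C * (e / C) by rewrite mulrC mulfVK// gt_eqF.
apply: (norm_le_eq (H := fun _ _ => 0)).
  by move=> t _; apply/funext => x; rewrite subrr.
by apply: CP => [t _ x|t x _]; [exact: cvg_cst|rewrite normr0 divr_ge0 ?ltW].
Qed.

Lemma unif_norm_lt (u : R -> M -> R) (e : R) t x :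
  (unif_norm u < e%:E)%E -> t \in `[0, 1] -> `|u t x| < e.
Proof.
move=> ue tt; rewrite -lte_fin; apply: le_lt_trans ue.
by apply: ereal_sup_ubound; exists (t, x).
Qed.

Lemma unif_norm_le (u : R -> M -> R) (e : R) :
  (forall t x, t \in `[0, 1] -> `|u t x| <= e) -> (unif_norm u <= e%:E)%E.
Proof.
by move=> ue; apply: ge_ereal_sup => _ [[t x] [/= tt _] <-]; rewrite lee_fin; exact: ue.
Qed.

Lemma unif_norm_ge0 (u : R -> M -> R) : (0 <= unif_norm u)%E.
Proof.
have [x0 _] := @manifold_nonempty _ _ M.
apply: (@le_trans _ _ (`|u 0 x0|%:E)); first by rewrite lee_fin.
by apply: ereal_sup_ubound; exists (0, x0).
Qed.

Lemma cvg0P (I : Type) (F : set_system I) (FF : Filter F) (f : I -> R) :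
  (forall i, 0 <= f i) ->
  f @ F --> (0 : R) <-> forall e, 0 < e -> \forall i \near F, f i < e.
Proof.
move=> f0; split=> [/cvgrPdist_lt cf e e0|fe].
  by have := cf e e0; apply: filterS => i; rewrite sub0r normrN ger0_norm.
apply/cvgrPdist_lt => e e0; have := fe e e0; apply: filterS => i.
by rewrite sub0r normrN ger0_norm.
Qed.

Lemma cvge0_lt (I : Type) (F : set_system I) (f : I -> \bar R) (e : R) :
  f @ F --> 0%E -> 0 < e -> \forall i \near F, (f i < e%:E)%E.
Proof.
move=> cf e0; apply: (cf [set y | (y < e%:E)%E]).
by apply: open_nbhs_nbhs; split; [exact: open_ereal_lt_ereal|rewrite /= lte_fin].
Qed.

Lemma lt_cvge0 (I : Type) (F : set_system I) (FF : Filter F) (f : I -> \bar R) :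
  (forall e : R, 0 < e -> \forall i \near F, (0 <= f i <= e%:E)%E) -> f @ F --> 0%E.
Proof.
move=> fe; apply/fine_cvgP; split.
  have := fe 1 ltr01; apply: filterS => i /andP[f0 f1].
  by rewrite ge0_fin_numE// (le_lt_trans f1)// ltry.
apply/cvgrPdist_le => e e0; have := fe e e0; apply: filterS => i /andP[f0 f1].
rewrite sub0r normrN /= ger0_norm ?fine_ge0//.
by rewrite -lee_fin fineK// ge0_fin_numE// (le_lt_trans f1)// ltry.
Qed.

Definition of_tcds (p : tcds alpha g P) : sys := Sys (isotopy p) (hamiltonian p) (conf_factor p).

Lemma ham_cv_of_norm (I : Type) (F : set_system I) (FF : Filter F)
    (H_ : I -> R -> M -> R) (H : R -> M -> R) :
  (forall t, t \in `[0, 1] -> continuous (H t)) -> strong_meas H ->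
  (forall i t, t \in `[0, 1] -> continuous (H_ i t)) -> (forall i, strong_meas (H_ i)) ->
  (forall e : R, 0 < e -> \forall i \near F, (ham_norm1oo alpha P (H \- H_ i)%R < e%:E)%E) ->
  ham_cv alpha P F H_ H.
Proof.
move=> cH sH cH_ sH_ HH e e0; have := HH e e0; apply: filterS => i hi.
have h : norm_le alpha P (fun t x => H t x - H_ i t x) e.
  apply: strong_norm_le.
  - by move=> t tt x; apply: cvgB; [exact: cH|exact: cH_].
  - exact: (strong_measD sH (strong_measN (sH_ i))).
  - exact: (ltW hi).
by apply: norm_le_eq (norm_leN h) => t _; apply/funext => x; rewrite opprB.
Qed.

(** Joint continuity of the smooth approximants enters twice: it makes their Hamiltonians strongly
    measurable, which turns convergence in [ham_norm1oo] into convergence with measurable majorants,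
    and it passes to the limit conformal factor. *)
Lemma tcds_approx (p : tcds alpha g P) : exists p_ : nat -> sys,
  [/\ forall k, smooth_sys (p_ k), sys_cv \oo p_ (of_tcds p) & sys_ok (of_tcds p)].
Proof.
have [cP /L1_C0P[cH sH fH] [Phi_ [H_ [h_ [smo cvP cvh cvH]]]]] := tcdsP p.
pose p_ k := Sys (Phi_ k) (H_ k) (h_ k); exists p_.
have cHk k : continuous_family (H_ k) := smooth_system_ham_continuous (smo k).
have chk k : continuous_family (h_ k) := smooth_system_conf_continuous (smo k).
have uh : ucv \oo (@rdist R) h_ (conf_factor p).
  move=> e e0; have := cvge0_lt cvh e0; apply: filterS => k hk t x tt.
  exact: (unif_norm_lt x hk tt).
have hcv : ham_cv alpha P \oo H_ (hamiltonian p).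
  apply: ham_cv_of_norm => //.
  - by move=> k t tt; exact: continuous_family_at.
  - by move=> k; exact: (strong_meas_continuous P).
  by move=> e e0; exact: cvge0_lt cvH e0.
split=> //; first split=> //.
  apply: dist_iso_cv.
  exact: ((cvg0P _ (fun k => isotopy_dist_ge0 g (Phi_ k) (isotopy p))).1 cvP).
split=> //; first exact: (ucv_continuous_family _ chk uh).
move=> e e0; have [k hk] := filter_ex (hcv e e0).
exists (H_ k) => //; apply: norm_le_eq (norm_leN hk) => t _; apply/funext => x.
by rewrite opprB.
Qed.

(** The starting map is inherited from the smooth approximants by uniform convergence. *)
Lemma isotopy0 (p : tcds alpha g P) x : isotopy p 0 x = x.
Proof.
have [p_ [smo [[cv _] _ _] _]] := tcds_approx p.
apply/esym; apply: (@rho_eq0 _ _ _ P); apply/eqP; rewrite eq_le rho_ge0 andbT.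
apply/ler_addgt0Pr => e e0; rewrite add0r.
have [k hk] := filter_ex (cv e e0); have [_ id0 _ _] := smo k.
by have := hk 0 x z01; rewrite id0 => /ltW.
Qed.

Lemma conc_tcdsP (q p : tcds alpha g P) a b c :
  a \in `[0, 1] -> b \in `[0, 1] -> c \in `[0, 1] ->
  let s := conc (of_tcds q) (of_tcds p) a b c in
  topological_contact_system alpha g P (flow s) (ham s) (conf s).
Proof.
move=> a01 b01 c01 s.
have [q_ [sq cq okq]] := tcds_approx q; have [p_ [sp cp okp]] := tcds_approx p.
have okB := time_ok_ramp (clock_step (- 2)) b01 c01.
have okA := time_ok_ramp (clock_step 0) z01 a01.
have [_ cB _] := time_ok_continuous okB; have [_ cA _] := time_ok_continuous okA.
have pcv u : param_cv \oo (fun=> u) (u : R).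
  by move=> e e0; apply: nearW => i; rewrite subrr normr0.
have [c1 c2 c3] := sys_cv_conc _ okq okp cq cp (fun=> a01) (fun=> b01) (fun=> c01)
  a01 b01 c01 (pcv a) (pcv b) (pcv c).
split.
- have [cfq _ _] := okq; have [cfp _ _] := okp.
  have [_ tB _] := okB; have [_ tA _] := okA.
  exact: (continuous_family_comp (continuous_family_seg cfp cB tB)
    (continuous_family_seg cfq cA tA)).
- have [_ lq _] := tcdsP q; have [_ lp _] := tcdsP p.
  exact: (L1_C0_cat (L1_C0_seg okB lp) (L1_C0_seg okA lq)).
pose s_ k := conc (q_ k) (p_ k) a b c.
exists (fun k => flow (s_ k)), (fun k => ham (s_ k)), (fun k => conf (s_ k)); split.
- by move=> k; exact: (smooth_conc (sq k) (sp k) a01 b01 c01).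
- apply: ((cvg0P _ (fun k => isotopy_dist_ge0 g (flow (s_ k)) (flow s))).2 _) => e e0.
  have h : \forall k \near \oo, isotopy_dist g (flow (s_ k)) (flow s) < e /\
      isotopy_dist g (flow s) (flow (s_ k)) < e by exact: (iso_cv_dist g c1 e0).
  by apply: filterS h => k [].
- apply: lt_cvge0 => e e0; have := c2 e e0; apply: filterS => k hk; apply/andP; split.
    exact: unif_norm_ge0.
  by apply: unif_norm_le => t x tt; exact: ltW (hk t x tt).
apply: lt_cvge0 => e e0; have := c3 e e0; apply: filterS => k hk; apply/andP; split.
  apply: integral_ge0 => t tt; rewrite lee_fin; apply: ham_norm_ge0.
  by have [ch _] := norm_leN hk; have := ch t tt; under eq_fun do rewrite opprB.
apply: norm_le_ham; apply: norm_le_eq (norm_leN hk) => t _; apply/funext => x.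
by rewrite opprB.
Qed.

Definition clamp (t : R) : R := Num.max 0 (Num.min 1 t).

Lemma clamp01 t : clamp t \in `[0, 1].
Proof. by rewrite in_itv/= /clamp le_max lexx ge_max ler01 ge_min lexx. Qed.

Lemma clampE t : t \in `[0, 1] -> clamp t = t.
Proof. by rewrite in_itv/= /clamp => /andP[t0 t1]; rewrite min_r// max_r. Qed.

Lemma clamp_lipschitz s t : `|clamp s - clamp t| <= `|s - t|.
Proof.
rewrite /clamp /Num.max /Num.min.
by repeat case: ifPn; rewrite -?leNgt => *; rewrite ler_norml; apply/andP; split;
  (have [h|h] := lerP 0 (s - t); [rewrite ?(ger0_norm h)|rewrite ?(ltr0_norm h)]); lra.
Qed.

(* Clamping the parameters makes the concatenation total. *)
Definition conc_tcds (q p : tcds alpha g P) (a b c : R) : tcds alpha g P :=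
  TCDS (conc_tcdsP q p (clamp01 a) (clamp01 b) (clamp01 c)).

Lemma conc_tcds1 (q p : tcds alpha g P) a b c x :
  a \in `[0, 1] -> b \in `[0, 1] -> c \in `[0, 1] ->
  isotopy (conc_tcds q p a b c) 1 x = isotopy p c (hinv (isotopy p b) (isotopy q a x)).
Proof.
move=> a01 b01 c01; rewrite /= late1 (late0 _ _ (s := 0)) ?mulr0// early0 (early1 _ _ (s := 1)) ?mulr1 ?ler1n//.
by rewrite !clampE// -{1}(isotopy0 q x) hfunK.
Qed.

Lemma sys_cv_tcds_dist (I : Type) (F : set_system I) (FF : Filter F)
    (p_ : I -> tcds alpha g P) (p : tcds alpha g P) :
  sys_cv F (fun i => of_tcds (p_ i)) (of_tcds p) ->
  forall e : R, 0 < e -> \forall i \near F, (tcds_dist p (p_ i) < e%:E)%E.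
Proof.
move=> [c1 c2 c3] e e0; have e4 : 0 < e / 4 by rewrite divr_gt0.
have h1 : \forall i \near F, isotopy_dist g (isotopy (p_ i)) (isotopy p) < e / 4 /\
    isotopy_dist g (isotopy p) (isotopy (p_ i)) < e / 4 by exact: (iso_cv_dist g c1 e4).
have h2 := c2 _ e4; have h3 := c3 _ e4.
move: h1 h2 h3; apply: filterS3 => i [_ h1] h2 h3.
have u : (unif_norm (conf_factor p \- conf_factor (p_ i))%R <= (e / 4)%:E)%E.
  by apply: unif_norm_le => t x tt; have := h2 t x tt; rewrite /rdist distrC => /ltW.
have v : (ham_norm1oo alpha P (hamiltonian p \- hamiltonian (p_ i))%R <= (e / 4)%:E)%E.
  apply: norm_le_ham; apply: norm_le_eq (norm_leN h3) => t _; apply/funext => x.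
  by rewrite opprB.
apply: (@le_lt_trans _ _ ((e / 4)%:E + (e / 4)%:E + (e / 4)%:E)%E).
  by rewrite /tcds_dist; apply: leeD => //; apply: leeD => //; rewrite lee_fin ltW.
by rewrite -!EFinD lte_fin; lra.
Qed.

Lemma tcds_dist_sys_cv (I : Type) (F : set_system I) (FF : Filter F)
    (p_ : I -> tcds alpha g P) (p : tcds alpha g P) :
  (forall e : R, 0 < e -> \forall i \near F, (tcds_dist p (p_ i) < e%:E)%E) ->
  sys_cv F (fun i => of_tcds (p_ i)) (of_tcds p).
Proof.
move=> d.
have L1 (q : tcds alpha g P) : [/\ forall t, t \in `[0, 1] -> continuous (hamiltonian q t),
    strong_meas (hamiltonian q) & (ham_norm1oo alpha P (hamiltonian q) < +oo)%E].
  by have [_ l _] := tcdsP q; apply/L1_C0P.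
have [cH sH _] := L1 p.
have u0 i : (0 <= unif_norm (conf_factor p \- conf_factor (p_ i))%R)%E := unif_norm_ge0 _.
have v0 i : (0 <= ham_norm1oo alpha P (hamiltonian p \- hamiltonian (p_ i))%R)%E.
  apply: integral_ge0 => t tt; rewrite lee_fin; apply: ham_norm_ge0 => x.
  by have [cHi _ _] := L1 (p_ i); apply: cvgB; [exact: cH|exact: cHi].
have i0 i : (0 <= (isotopy_dist g (isotopy p) (isotopy (p_ i)))%:E)%E.
  by rewrite lee_fin isotopy_dist_ge0.
split.
- have h e : 0 < e -> \forall i \near F, isotopy_dist g (isotopy p) (isotopy (p_ i)) < e.
    move=> e0; have := d e e0; apply: filterS => i hi.
    by rewrite -lte_fin; apply: le_lt_trans hi; rewrite /tcds_dist -addeA leeDl// adde_ge0.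
  exact: (dist_iso_cv_sym P h).
- move=> e e0; have := d e e0; apply: filterS => i hi t x tt.
  rewrite /rdist distrC; apply: (@unif_norm_lt (conf_factor p \- conf_factor (p_ i))%R) => //.
  by apply: le_lt_trans hi; rewrite /tcds_dist addeAC leeDr// adde_ge0.
apply: ham_cv_of_norm => //.
- by move=> i; have [] := L1 (p_ i).
- by move=> i; have [] := L1 (p_ i).
move=> e e0; have := d e e0; apply: filterS => i; apply: le_lt_trans.
by rewrite /tcds_dist leeDr// adde_ge0.
Qed.

(** Generated by products of a [tcds_dist] ball around q and an interval around t, so that joint
    continuity in system and time becomes convergence along a filter. *)
Definition near_dist (q : tcds alpha g P) (t : R) : set_system (tcds alpha g P * R) :=
  [set A | exists2 d, 0 < d & forall q' t', (tcds_dist q q' < d%:E)%E -> `|t' - t| < d -> A (q', t')].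

Instance near_dist_filter q t : Filter (near_dist q t).
Proof.
split=> [|A B [d d0 dA] [e e0 eB]|A B AB [d d0 dA]].
- by exists 1.
- exists (Num.min d e); first by rewrite lt_min d0.
  move=> q' t'; rewrite EFin_min !lt_min => /andP[d1 e1] /andP[d2 e2].
  by split; [exact: dA|exact: eB].
by exists d => // q' t' h1 h2; apply: AB; exact: dA.
Qed.

(** Times depending on t in a 1-Lipschitz way cover every path that occurs, whose parameters are t
    itself or constants. Varying q as well gives the uniformity used in [joining_near]. *)
Lemma conc_tcds_cv (q p : tcds alpha g P) (u v w : R -> R) t :
  (forall r s, `|u r - u s| <= `|r - s|) -> (forall r s, `|v r - v s| <= `|r - s|) ->
  (forall r s, `|w r - w s| <= `|r - s|) -> forall e : R, 0 < e ->
  exists2 d, 0 < d & forall q' t', (tcds_dist q q' < d%:E)%E -> `|t' - t| < d ->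
    (tcds_dist (conc_tcds q p (u t) (v t) (w t)) (conc_tcds q' p (u t') (v t') (w t')) < e%:E)%E.
Proof.
move=> lu lv lw.
have [_ [_ _ okq]] := tcds_approx q; have [_ [_ _ okp]] := tcds_approx p.
have cvq : sys_cv (near_dist q t) (fun z => of_tcds z.1) (of_tcds q).
  by apply: tcds_dist_sys_cv => e e0; exists e.
have pcv (f : R -> R) : (forall r s, `|f r - f s| <= `|r - s|) ->
    param_cv (near_dist q t) (fun z => clamp (f z.2)) (clamp (f t)).
  move=> lf e e0; exists e => // q' t' _ tt'; apply: le_lt_trans tt'.
  exact: le_trans (clamp_lipschitz _ _) (lf _ _).
have cvp : sys_cv (near_dist q t) (fun=> of_tcds p) (of_tcds p) by exact: sys_cv_cst.
have cv : sys_cv (near_dist q t) (fun z => of_tcds (conc_tcds z.1 p (u z.2) (v z.2) (w z.2)))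
    (of_tcds (conc_tcds q p (u t) (v t) (w t))).
  exact: (sys_cv_conc _ okq okp cvq cvp
    (fun z => clamp01 (u z.2)) (fun z => clamp01 (v z.2)) (fun z => clamp01 (w z.2))
    (clamp01 (u t)) (clamp01 (v t)) (clamp01 (w t)) (pcv u lu) (pcv v lv) (pcv w lw)).
move=> e e0; have [d d0 dP] : near_dist q t (fun z => (tcds_dist (conc_tcds q p (u t) (v t) (w t))
    (conc_tcds z.1 p (u z.2) (v z.2) (w z.2)) < e%:E)%E).
  exact: (sys_cv_tcds_dist _ cv e0).
by exists d => // q' t' h1 h2; exact: (dP q' t' h1 h2).
Qed.

(** A constant family converges to its value. *)
Lemma tcds_dist_refl (q : tcds alpha g P) (e : R) : 0 < e -> (tcds_dist q q < e%:E)%E.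
Proof.
move=> e0; have cv : sys_cv \oo (fun _ : nat => of_tcds q) (of_tcds q) by exact: sys_cv_cst.
have h : \forall i \near \oo, (tcds_dist q q < e%:E)%E.
  exact: (@sys_cv_tcds_dist nat \oo _ (fun=> q) q cv e e0).
by have [] := filter_ex h.
Qed.

Lemma ev1_path_continuous (q p : tcds alpha g P) (u v w : R -> R) :
  (forall r s, `|u r - u s| <= `|r - s|) -> (forall r s, `|v r - v s| <= `|r - s|) ->
  (forall r s, `|w r - w s| <= `|r - s|) ->
  continuous (fun t => ev1 (conc_tcds q p (u t) (v t) (w t))).
Proof.
move=> lu lv lw t A.
rewrite nbhsE => -[U [oU Ut] UA].
have oU' : tcds_open (@ev1 _ _ _ alpha g P @^-1` U) := oU.
have [e e0 eU] := oU' _ Ut.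
have [d d0 dP] := conc_tcds_cv q p t lu lv lw e0.
apply/nbhs_ballP; exists d => // t' tt'; apply: UA; apply: eU; apply: dP.
  exact: tcds_dist_refl.
by move: tt'; rewrite /ball/= distrC.
Qed.

Lemma chomeo_eq (phi psi : contactHomeo alpha g P) : (forall x, phi x = psi x) -> phi = psi.
Proof.
move=> h; have : chomeo phi = chomeo psi by exact: homeo_eq.
case: phi psi h => f fP [f' f'P] /= _ ff'; subst f'.
by congr ContactHomeo; exact: Prop_irrelevance.
Qed.

Lemma ev1_surj (phi : contactHomeo alpha g P) : exists p, ev1 p = phi.
Proof.
have [p pE] := chomeoP phi; exists p; apply: chomeo_eq => x /=.
by rewrite pE.
Qed.

Lemma lipschitz_cst (c : R) (r s : R) : `|(fun=> c) r - (fun=> c) s : R| <= `|r - s|.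
Proof. by rewrite subrr normr0. Qed.

Definition joining (q p : tcds alpha g P) (t : R) := ev1 (conc_tcds q p t t 1).

Lemma joining_continuous (q p : tcds alpha g P) : continuous (joining q p).
Proof.
by apply: (@ev1_path_continuous q p id id (fun=> 1)) => // r s; exact: lipschitz_cst.
Qed.

Lemma joining0 (q p : tcds alpha g P) : joining q p 0 = ev1 p.
Proof.
apply: chomeo_eq => x; rewrite [LHS](conc_tcds1 q p x z01 z01 o01).
by rewrite isotopy0 -{1}(isotopy0 p x) hfunK.
Qed.

Lemma joining1 (q p : tcds alpha g P) : joining q p 1 = ev1 q.
Proof. by apply: chomeo_eq => x; rewrite [LHS](conc_tcds1 q p x o01 o01 o01) hinvK. Qed.

Lemma joining_diag (p : tcds alpha g P) t : t \in `[0, 1] -> joining p p t = ev1 p.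
Proof. by move=> tt; apply: chomeo_eq => x; rewrite [LHS](conc_tcds1 p p x tt tt o01) hfunK. Qed.

Lemma topological_automorphism_ev1 (p : tcds alpha g P) :
  topological_automorphism alpha g (isotopy p 1).
Proof.
have [_ _ [Phi_ [H_ [h_ [smo cvP cvh _]]]]] := tcdsP p.
exists (fun k => Phi_ k 1), (fun k => h_ k 1), (conf_factor p 1); split.
- by move=> k; have [_ _ c _] := smo k; exact: c.
- apply: ((cvg0P _ (fun k => homeo_dist_ge0 g (Phi_ k 1) (isotopy p 1))).2 _) => e e0.
  have h : \forall k \near \oo, isotopy_dist g (Phi_ k) (isotopy p) < e.
    exact: ((cvg0P _ (fun k => isotopy_dist_ge0 g (Phi_ k) (isotopy p))).1 cvP).
  by apply: filterS h => k; apply: le_lt_trans; exact: homeo_dist_le_isotopy.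
apply/uniform_cvgP => e e0; have := cvge0_lt cvh e0; apply: filterS => k hk x.
exact: (unif_norm_lt x hk o01).
Qed.

Lemma contact_isotopy_joining (q p : tcds alpha g P) : exists Psi : R -> contactHomeo alpha g P,
  [/\ topological_contact_isotopy alpha g P (fun t => Psi t : M -> M),
      continuous Psi, Psi 0 = ev1 p & Psi 1 = ev1 q].
Proof.
pose Phi := conc_tcds q p 1 1 0.
have PsiE t x : t \in `[0, 1] ->
    ev1 (conc_tcds Phi p t 0 1) x = isotopy p 1 (isotopy Phi t x).
  move=> tt; rewrite [LHS](conc_tcds1 Phi p x tt z01 o01).
  by rewrite -{1}(isotopy0 p (isotopy Phi t x)) hfunK.
exists (fun t => ev1 (conc_tcds Phi p t 0 1)); split.
- exists (isotopy p 1), Phi; split; first exact: topological_automorphism_ev1.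
  by move=> t tt; apply/funext => x; exact: PsiE.
- by apply: (@ev1_path_continuous Phi p id (fun=> 0) (fun=> 1)) => // r s; exact: lipschitz_cst.
- by apply: chomeo_eq => x; rewrite PsiE// isotopy0.
apply: chomeo_eq => x; rewrite PsiE//.
by rewrite [isotopy Phi 1 x](conc_tcds1 q p x o01 o01 z01) isotopy0 hinvK.
Qed.

Lemma joining_near (p : tcds alpha g P) (U : set (contactHomeo alpha g P)) :
  open U -> U (ev1 p) -> exists2 d, 0 < d & forall q, (tcds_dist p q < d%:E)%E ->
    forall t, t \in `[0, 1] -> U (joining q p t).
Proof.
move=> oU Up; have oU' : tcds_open (@ev1 _ _ _ alpha g P @^-1` U) := oU.
have cover := (compact_near_coveringP _).1 (@unit_itv_compact R) R (0 : R)^'+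
  (fun d t => forall q, (tcds_dist p q < d%:E)%E -> U (joining q p t)) _.
have /cover hd : forall t : R, `[0, 1]%classic t -> \forall t' \near t & d \near (0 : R)^'+,
    forall q, (tcds_dist p q < d%:E)%E -> U (joining q p t').
  move=> t tt; have Ut : (@ev1 _ _ _ alpha g P @^-1` U) (conc_tcds p p t t 1).
    by rewrite /preimage/= -/(joining p p t) joining_diag.
  have [e e0 eU] := oU' _ Ut.
  have [d d0 dP] := @conc_tcds_cv p p id id (fun=> 1) t (fun _ _ => lexx _)
    (fun _ _ => lexx _) (lipschitz_cst 1) e e0.
  exists (ball t d, [set x | x < d]); first split=> /=.
  - exact: nbhsx_ballx.
  - exact: nbhs_right_lt.
  move=> [t' d'] [/= tt' dd'] q hq; apply: (eU _); apply: (dP q t').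
    by apply: lt_trans hq _; rewrite lte_fin.
  by rewrite distrC.
have [d [d0 dP]] := filter_ex (filterI (nbhs_right_gt (0 : R)) hd).
by exists d => // q hq t tt; exact: dP.
Qed.

End Systems.

(** * Path components and the theorem *)

Section PathConnected.
Context (R : realType) {T : topologicalType}.

Definition path_in (U : set T) (x y : T) := exists gamma : R -> T,
  [/\ {within `[0, 1], continuous gamma}, gamma 0 = x, gamma 1 = y &
      forall t, t \in `[0, 1] -> U (gamma t)].

Lemma path_in_reparam (U : set T) (gamma : R -> T) (c d : R) :
  {within `[0, 1], continuous gamma} -> (forall t, t \in `[0, 1] -> U (gamma t)) ->
  (forall t, t \in `[0, 1] -> c + d * t \in `[0, 1]) -> path_in U (gamma c) (gamma (c + d)).
Proof.
move=> /subspace_continuousP cg Ug cd; exists (fun t => gamma (c + d * t)); split.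
- apply/subspace_continuousP => t tt A gA.
  have h := cg (c + d * t) (cd t tt) A gA.
  rewrite -[nbhs _ A]/(\forall s \near within `[0, 1] (nbhs (c + d * t)), A (gamma s)) near_withinE in h.
  rewrite -[nbhs _ A]/(\forall s \near within `[0, 1] (nbhs t), A (gamma (c + d * s))) near_withinE.
  have ca : (fun s : R => c + d * s) @ t --> c + d * t.
    by apply: cvgD; [exact: cvg_cst|exact: mulrl_continuous].
  have := ca _ h; rewrite -[nbhs _ _]/(\forall s \near t, `[0, 1]%classic (c + d * s) -> A (gamma (c + d * s))).
  by apply: filterS => s hs ss; apply: hs; exact: cd.
- by rewrite mulr0 addr0.
- by rewrite mulr1.
by move=> t tt; apply: Ug; exact: cd.
Qed.

Lemma path_in_sym (U : set T) x y : path_in U x y -> path_in U y x.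
Proof.
move=> [gamma [cg <- <- Ug]].
have := @path_in_reparam U gamma 1 (- 1) cg Ug; rewrite subrr; apply => t.
by rewrite !in_itv/= => /andP[? ?]; apply/andP; split; lra.
Qed.

Lemma path_in_trans (U : set T) y x z : path_in U x y -> path_in U y z -> path_in U x z.
Proof.
move=> [f [cf f0 f1 Uf]] [h [ch h0 h1 Uh]]; exists (path_cat f h); split.
- by apply: path_cat_continuous => //; rewrite f1 h0.
- by rewrite /path_cat ifT ?mulr0// divr_ge0.
- rewrite /path_cat ifF; last by apply/negbTE; rewrite -ltNge; lra.
  by have -> : 2 * 1 - 1 = 1 :> R by ring.
move=> t; rewrite in_itv/= => /andP[t0 t1]; rewrite /path_cat; case: ifPn => th.
  by apply: Uf; rewrite in_itv/=; apply/andP; split; lra.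
by apply: Uh; rewrite in_itv/=; rewrite -ltNge in th; apply/andP; split; lra.
Qed.

(** A path in U stays in the component where it starts, because its initial segments, rescaled, are
    themselves paths in U. *)
Lemma path_in_component (U : set T) x : path_connected R [set y | path_in U x y].
Proof.
move=> y z xy xz; have [gamma [cg g0 g1 Ug]] := path_in_trans (path_in_sym xy) xz.
exists gamma; split=> // t tt; apply: path_in_trans xy _; rewrite -g0.
have := @path_in_reparam U gamma 0 t cg Ug; rewrite add0r; apply => s.
move: tt; rewrite !in_itv/= => /andP[t0 t1] /andP[s0 s1].
by rewrite add0r mulr_ge0//= mulr_ile1.
Qed.

End PathConnected.

Theorem theorem6p4 (R : realType) (n : nat) (M : closedManifold R n.*2.+1)
    (alpha : contactForm M) (g : riemannianMetric M) (P : partitionOfUnity M) :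
  [/\ path_connected R [set: contactHomeo alpha g P],
      locally_path_connected R (contactHomeo alpha g P) &
      forall phi psi : contactHomeo alpha g P,
        exists Psi : R -> contactHomeo alpha g P,
          [/\ topological_contact_isotopy alpha g P (fun t => Psi t : M -> M),
              {within `[0, 1], continuous Psi},
              Psi 0 = phi & Psi 1 = psi]].
Proof.
split.
- move=> x y _ _; have [p <-] := ev1_surj x; have [q <-] := ev1_surj y.
  exists (joining q p); split=> //; [|exact: joining0|exact: joining1].
  by apply: continuous_subspaceT; exact: joining_continuous.
- move=> x U; rewrite nbhsE => -[U' [oU' U'x] U'U].
  exists [set y | path_in R U' x y]; split.
  (* The component is open in the quotient topology if its preimage under [ev1] contains a ball
     around each system p in it; the path from x to [ev1 p] is prolonged by [joining q p]. *)
  + have oV : tcds_open (@ev1 _ _ _ alpha g P @^-1` [set y | path_in R U' x y]).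
      move=> p xp; have U'p : U' (ev1 p).
        by have [gamma [_ _ <- Ug]] := xp; apply: Ug; rewrite in_itv/= ler01 lexx.
      have [d d0 dP] := joining_near oU' U'p; exists d => // q pq.
      apply: path_in_trans xp _; exists (joining q p); split.
      * by apply: continuous_subspaceT; exact: joining_continuous.
      * exact: joining0.
      * exact: joining1.
      * exact: dP.
    exact: oV.
  + by exists (fun=> x); split=> //; apply: continuous_subspaceT => t; exact: cvg_cst.
  + move=> y [gamma [_ _ <- Ug]]; apply: U'U; apply: Ug.
    by rewrite in_itv/= ler01 lexx.
  + exact: path_in_component.
move=> phi psi; have [p <-] := ev1_surj phi; have [q <-] := ev1_surj psi.
have [Psi [iPsi cPsi Psi0 Psi1]] := contact_isotopy_joining q p.
by exists Psi; split=> //; exact: continuous_subspaceT.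
Qed.
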